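(* Let $A$ be a $\sigma$-unital $C^*$-algebra, let $G$ be a second-countable compact group, and let $\alpha\colon G\to\mathrm{Aut}(A)$ be an action with the Rokhlin property. If $A$ is simple, then so are $A^\alpha$ and $A\rtimes_\alpha G$.
   Context: Conventions: homomorphisms between $C^*$-algebras are $*$-homomorphisms, subalgebras are $C^*$-subalgebras; actions on $C^*$-algebras are point-norm continuous; $A^\alpha$ is the fixed point algebra and $A\rtimes_\alpha G$ the crossed product. Sequence algebras: for a $C^*$-algebra $A$, let $\ell^\infty(\mathbb{N},A)$ be the $C^*$-algebra of bounded sequences in $A$, $c_0(\mathbb{N},A)$ the ideal of norm-null sequences, $A_\infty=\ell^\infty(\mathbb{N},A)/c_0(\mathbb{N},A)$ with quotient map $\eta_A$; $A$ sits in $A_\infty$ as constant sequences. For a subalgebra $D\subseteq A$, let $\mathrm{Ann}(D,A_\infty)$ be the annihilator of $D$ in $A_\infty$, an ideal of $A_\infty\cap D'$, let $F(D,A)=(A_\infty\cap D')/\mathrm{Ann}(D,A_\infty)$ and let $\kappa_{D,A}$ be the quotient map. If $\alpha\colon G\to\mathrm{Aut}(A)$ is an action and $D$ is $\alpha$-invariant, entrywise application of $\alpha$ gives actions (not necessarily continuous) $\alpha^\infty$ on $\ell^\infty(\mathbb{N},A)$, $\alpha_\infty$ on $A_\infty$ and on $A_\infty\cap D'$, and $F(\alpha)$ on $F(D,A)$. Let $\ell^\infty_\alpha(\mathbb{N},A)$ be the set of $a\in\ell^\infty(\mathbb{N},A)$ with $g\mapsto\alpha^\infty_g(a)$ norm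 continuous, $A_{\infty,\alpha}=\eta_A(\ell^\infty_\alpha(\mathbb{N},A))$ and $F_\alpha(D,A)=\kappa_{D,A}(A_{\infty,\alpha}\cap D')$. Rokhlin property: an action $\alpha\colon G\to\mathrm{Aut}(A)$ of a second-countable compact group $G$ on a $\sigma$-unital $C^*$-algebra $A$ has the Rokhlin property if for every separable $\alpha$-invariant subalgebra $D\subseteq A$ there is an equivariant unital homomorphism $\varphi\colon(C(G),\mathtt{Lt})\to(F_\alpha(D,A),F(\alpha))$, where $\mathtt{Lt}$ is the action of $G$ on $C(G)$ induced by left translation. *)

(* Defs.v *)
From HB Require Import structures.
From mathcomp Require Import all_boot all_order all_algebra.
From mathcomp Require Import all_classical all_reals all_analysis.
From mathcomp Require Import complex.

Set Implicit Arguments.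
Unset Strict Implicit.
Unset Printing Implicit Defensive.

Import Order.TTheory GRing.Theory Num.Theory.
Import numFieldNormedType.Exports.

Local Open Scope classical_set_scope.
Local Open Scope ring_scope.

(* Naming R[i] as a numClosedFieldType gives it the norm and the topology that
   the library attaches to every numFieldType. *)
Definition Cplx (R : realType) : numClosedFieldType := complex R.

(** C*-algebras *)

(* The ring structures of the library are unital, so the product is a separate
   operation. The norm takes its values in Cplx R, as for every normed module
   over Cplx R; in this order z <= w implies that w - z is real. *)
HB.mixin Record CompleteNormedModule_isCStar (R : realType) (A : Type)
    of CompleteNormedModule (Cplx R) A := {
  cmul : A -> A -> A;
  star : A -> A;
  cmulA : associative cmul;
  cmulDl : left_distributive cmul +%R;
  cmulDr : right_distributive cmul +%R;
  cmulZl : forall (z : Cplx R) (x y : A), cmul (z *: x) y = z *: cmul x y;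
  cmulZr : forall (z : Cplx R) (x y : A), cmul x (z *: y) = z *: cmul x y;
  starK : involutive star;
  starD : {morph star : x y / x + y};
  starZ : forall (z : Cplx R) (x : A), star (z *: x) = z^* *: star x;
  starM : forall x y : A, star (cmul x y) = cmul (star y) (star x);
  cnormM : forall x y : A, `|cmul x y| <= `|x| * `|y|;
  cnorm_star : forall x : A, `|cmul (star x) x| = `|x| ^+ 2
}.

#[short(type="cstarAlgType")]
HB.structure Definition CStarAlg (R : realType) :=
  {A of CompleteNormedModule (Cplx R) A & CompleteNormedModule_isCStar R A}.

Declare Scope cstar_scope.
Delimit Scope cstar_scope with cstar.
Infix "**" := cmul (at level 40, left associativity) : cstar_scope.
Local Open Scope cstar_scope.

Section CStar.
Context {R : realType}.
Local Notation C := (Cplx R).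

Record star_hom (A B : cstarAlgType R) (f : A -> B) : Prop := StarHom {
  star_homD : {morph f : x y / x + y};
  star_homZ : forall (z : C) x, f (z *: x) = z *: f x;
  star_homM : {morph f : x y / x ** y};
  star_homS : {morph f : x / star x}
}.

Record cstar_subalgebra (A : cstarAlgType R) (D : set A) : Prop := CStarSub {
  sub_closed : closed D;
  sub0 : D 0;
  subD : forall x y, D x -> D y -> D (x + y);
  subZ : forall (z : C) x, D x -> D (z *: x);
  subM : forall x y, D x -> D y -> D (x ** y);
  subS : forall x, D x -> D (star x)
}.

(* Closed two-sided ideals of the C*-subalgebra S of A. *)
Record closed_ideal (A : cstarAlgType R) (S I : set A) : Prop := ClosedIdeal {
  ideal_sub : I `<=` S;
  ideal_closed : closed I;
  ideal0 : I 0;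
  idealD : forall x y, I x -> I y -> I (x + y);
  idealZ : forall (z : C) x, I x -> I (z *: x);
  idealMl : forall x y, S x -> I y -> I (x ** y);
  idealMr : forall x y, I x -> S y -> I (x ** y)
}.

Definition simple (A : cstarAlgType R) (S : set A) : Prop :=
  (exists2 x, S x & x != 0) /\
  forall I, closed_ideal S I -> I = [set 0] \/ I = S.

Definition positive (A : cstarAlgType R) (x : A) : Prop :=
  exists y, x = star y ** y.

Definition sigma_unital (A : cstarAlgType R) : Prop :=
  exists e : nat -> A,
    [/\ forall n, positive (e n),
        forall n, `|e n| <= 1,
        forall a, (fun n => e n ** a) @ \oo --> a &
        forall a, (fun n => a ** e n) @ \oo --> a].

Definition separable_set (A : cstarAlgType R) (D : set A) : Prop :=
  exists S, [/\ countable S, S `<=` D & D `<=` closure S].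

End CStar.

(** Topological groups *)

HB.mixin Record isTopologicalGroup (G : Type)
    of Group G & PointedTopological G := {
  mulg_continuous : continuous (fun x : G * G => (x.1 * x.2)%g);
  invg_continuous : continuous (fun x : G => x^-1%g)
}.

(* The base point is only there because measurable types are pointed. *)
#[short(type="topGroupType")]
HB.structure Definition TopologicalGroup :=
  {G of Group G & PointedTopological G & isTopologicalGroup G}.

(** Actions *)

(* Each [act g] is bijective, with inverse [act g^-1]. *)
Record cstar_action (R : realType) (G : topGroupType) (A : cstarAlgType R) :=
  CStarAction {
    act :> G -> A -> A;
    act_hom : forall g, star_hom (act g);
    act1 : forall a, act 1%g a = a;
    actM : forall g h a, act (g * h)%g a = act g (act h a);
    act_continuous : forall a, continuous (act^~ a)
  }.

Section Rokhlin.
Context {R : realType} {G : topGroupType} {A : cstarAlgType R}.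
Variable alpha : cstar_action G A.
Local Notation C := (Cplx R).

Definition fixed_points : set A := [set a | forall g, alpha g a = a].

Definition invariant_set (D : set A) : Prop :=
  forall g d, D d -> D (alpha g d).

Definition linfty : set (nat -> A) :=
  [set a | exists M : C, forall n, `|a n| <= M].

Definition c0 : set (nat -> A) := [set a | a @ \oo --> (0 : A)].

Definition act_seq (g : G) (a : nat -> A) : nat -> A := fun n => alpha g (a n).

Definition linfty_act : set (nat -> A) :=
  [set a | linfty a /\
    forall (g : G) (e : C), 0 < e ->
      \forall h \near g, forall n, `|act_seq h a n - act_seq g a n| <= e].

(* The sequences whose class in A_oo = linfty / c0 commutes with D. *)
Definition commutant (D : set A) : set (nat -> A) :=
  [set a | linfty a /\ forall d, D d -> c0 (fun n => a n ** d - d ** a n)].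

(* The sequences whose class in A_oo annihilates D on both sides. *)
Definition annihilator (D : set A) : set (nat -> A) :=
  [set a | linfty a /\
    forall d, D d -> c0 (fun n => a n ** d) /\ c0 (fun n => d ** a n)].

(* F(D, A) = (A_oo `&` D') / Ann(D, A_oo) is the quotient of [commutant D] by
   [annihilator D], both of which contain c0. Its elements are cosets; [Fclass]
   maps a sequence in [commutant D] to its image in F(D, A). *)
Definition Fclass (D : set A) (a : nat -> A) : set (nat -> A) :=
  [set b | commutant D b /\ annihilator D (fun n => b n - a n)].

Definition Falpha (D : set A) : set (set (nat -> A)) :=
  [set Fclass D a | a in commutant D `&` linfty_act].

Definition Fact (g : G) (X : set (nat -> A)) : set (nat -> A) := act_seq g @` X.

Definition Lt (g : G) (f : G -> C) : G -> C := fun h => f (g^-1 * h)%g.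

(* Equivariant unital *-homomorphisms from C(G) to F_alpha(D, A). The values of
   phi outside C(G) are irrelevant. Operations on cosets are expressed through
   arbitrary representatives: [phi f a] says that a represents phi f. *)
Record equivariant_unital_hom (D : set A)
    (phi : (G -> C) -> set (nat -> A)) : Prop := EquivariantUnitalHom {
  hom_range : forall f, continuous f -> Falpha D (phi f);
  homD : forall f g a b, continuous f -> continuous g -> phi f a -> phi g b ->
    phi (fun s => f s + g s) (fun n => a n + b n);
  homZ : forall (z : C) f a, continuous f -> phi f a ->
    phi (fun s => z * f s) (fun n => z *: a n);
  homM : forall f g a b, continuous f -> continuous g -> phi f a -> phi g b ->
    phi (fun s => f s * g s) (fun n => a n ** b n);
  homS : forall f a, continuous f -> phi f a ->
    phi (fun s => (f s)^*) (fun n => star (a n));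
  hom_unit : forall e a, phi (fun=> 1) e -> Falpha D (Fclass D a) ->
    commutant D a ->
    Fclass D (fun n => e n ** a n) = Fclass D a /\
    Fclass D (fun n => a n ** e n) = Fclass D a;
  hom_equivariant : forall g f, continuous f -> phi (Lt g f) = Fact g (phi f)
}.

Definition rokhlin_property : Prop :=
  forall D : set A, cstar_subalgebra D -> separable_set D -> invariant_set D ->
    exists phi, equivariant_unital_hom D phi.

End Rokhlin.

(** Crossed products by compact groups *)

Definition borel (G : topGroupType) := g_sigma_algebraType (@open G).

Section CrossedProduct.
Context {R : realType} {G : topGroupType} {A : cstarAlgType R}.
Variable alpha : cstar_action G A.
Local Notation C := (Cplx R).

(* On a second-countable compact Hausdorff group every Borel probability
   measure is regular, and a left-invariant one is bi-invariant and unique. *)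
Definition haar (mu : probability (borel G) R) : Prop :=
  forall (g : G) (B : set (borel G)), measurable B ->
    mu [set (g * x)%g | x in (B : set G)] = mu B.

(* The integral of a continuous function on a compact group, as the limit of
   the integrals of simple functions that converge to it uniformly. *)
Definition is_integral (mu : probability (borel G) R) (f : G -> A) (v : A) :=
  forall e : C, 0 < e ->
    exists (n : nat) (E : 'I_n -> set (borel G)) (x : 'I_n -> A),
      [/\ forall i, measurable (E i), trivIset setT E, \bigcup_i E i = setT,
          forall i s, E i s -> `|f s - x i| <= e &
          `|v - \sum_(i < n) (real_complex R (fine (mu (E i))) : C) *: x i|
            <= e].

Definition integral_A (mu : probability (borel G) R) (f : G -> A) : A :=
  xget 0 [set v | is_integral mu f v].

Definition conv (mu : probability (borel G) R) (f h : G -> A) : G -> A :=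
  fun s => integral_A mu (fun r => f r ** alpha r (h (r^-1 * s)%g)).

(* There is no modular function, G being unimodular. *)
Definition conv_star (f : G -> A) : G -> A :=
  fun s => alpha s (star (f s^-1%g)).

Definition L1norm (mu : probability (borel G) R) (f : G -> A) : R :=
  \int[mu]_s complex.Re (`|f s| : C).

(* L1-contractive *-homomorphisms from the convolution algebra C(G, A). *)
Record L1_hom (mu : probability (borel G) R) (B : cstarAlgType R)
    (psi : (G -> A) -> B) : Prop := L1Hom {
  L1_homD : forall f h, continuous f -> continuous h ->
    psi (fun s => f s + h s) = psi f + psi h;
  L1_homZ : forall (z : C) f, continuous f ->
    psi (fun s => z *: f s) = z *: psi f;
  L1_homM : forall f h, continuous f -> continuous h ->
    psi (conv mu f h) = psi f ** psi h;
  L1_homS : forall f, continuous f -> psi (conv_star f) = star (psi f);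
  L1_hom_le : forall f, continuous f ->
    `|psi f| <= (real_complex R (L1norm mu f) : C)
}.

(* B is the crossed product of A by alpha, that is, the enveloping C*-algebra
   of L^1(G, A): the completion of C(G, A) for the norm
     sup {`|psi f| | psi an L1-contractive *-homomorphism to a C*-algebra},
   with j the canonical map. As j is itself such a homomorphism, the supremum
   is a maximum. It is the same as the supremum over representations on Hilbert
   spaces, since every C*-algebra has a faithful one. *)
Definition is_crossed_product (B : cstarAlgType R) : Prop :=
  exists (mu : probability (borel G) R) (j : (G -> A) -> B),
    [/\ haar mu, L1_hom mu j,
        closure (j @` [set f | continuous f]) = [set: B] &
        forall (B' : cstarAlgType R) (psi : (G -> A) -> B'), L1_hom mu psi ->
          forall f, continuous f -> `|psi f| <= `|j f|].

End CrossedProduct.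

(* Main.v *)
From HB Require Import structures.
From mathcomp Require Import all_boot all_order all_algebra perm.
From mathcomp Require Import all_classical all_reals all_analysis measurable_realfun.
From mathcomp Require Import complex ring lra.
Require Import Defs.

(* Given a separable invariant D, the Rokhlin homomorphism C(G) -> F_alpha(D, A) multiplies
   with D to a contractive homomorphism from C(G, D) to sequences in A. It maps the orbit
   function s |-> alpha_s x to a sequence that lies asymptotically in A^alpha, and it is
   A^alpha-bilinear. If I is a nonzero closed ideal of A^alpha and A is simple, any b in
   A^alpha is nearly a sum of products x d y with d in I; the homomorphism turns it into
   a sum of products x' d y' with x', y' in A^alpha, so that b is in I.
   Approximating a homomorphism from C(G) also shows that the functions
   k_{a,b}(s) = a alpha_s(b) span a dense subspace of C(G, A) (saturation). In the
   crossed product, k_{a,b} * h * k_{c,d} = k_{a E(b H), d} where E is the conditional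
   expectation on A^alpha and H the integral of h(r) alpha_r(c); for a, d in A^alpha this
   is a constant function with value in A^alpha. The constants embed A^alpha
   isometrically, because the crossed product acts on the completion of A for the
   A^alpha-valued form E(x* y). Hence an ideal J of the crossed product meets A^alpha
   either in 0, and then k_{a,b} J k_{c,d} = 0 for all a, b, c, d and J = 0, or in all of
   A^alpha, and then J is everything. *)

Set Implicit Arguments.
Unset Strict Implicit.
Unset Printing Implicit Defensive.

Import Order.TTheory GRing.Theory Num.Theory.
Import numFieldNormedType.Exports.

Local Open Scope classical_set_scope.
Local Open Scope ring_scope.
Local Open Scope cstar_scope.

(** * Norms and square roots *)

(** A Rokhlin homomorphism is only given for separable [D], with values modulo annihilators of [D].
    Hence the elements at stake are fixed before [D] and the homomorphism are chosen, and values are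
    only used through their products with elements of [D]. An image that is asymptotically invariant
    is not yet close to a fixed point: it is nearly invariant under each group element from some
    index on, equicontinuity and compactness make that index uniform, and averaging then gives a
    true fixed point nearby. Approximate membership is enough because ideals are closed. Norm
    estimates rest on one device in place of spectra: the real part of a unitary is a contraction.
    The square roots that produce the unitaries come from an iteration. Contractivity of
    homomorphisms, the order on positive elements and Cauchy-Schwarz all go back to it. The module
    on which the crossed product acts keeps its [A]-valued form instead of being turned into a
    Hilbert space by states; its adjointable operators form a C*-algebra, the kind of target that
    the universal property asks for. *)

Section LinComb.
Variables (K : comPzRingType) (V : lmodType K).

Inductive lexp :=
  | LZero | LAtom of nat | LAdd of lexp & lexp | LOpp of lexp | LScale of K & lexp.

Fixpoint leval (s : seq V) (e : lexp) : V :=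
  match e with
  | LZero => 0 | LAtom i => nth 0 s i | LAdd e1 e2 => leval s e1 + leval s e2
  | LOpp e1 => - leval s e1 | LScale c e1 => c *: leval s e1
  end.

Fixpoint lcoef (e : lexp) (i : nat) : K :=
  match e with
  | LZero => 0 | LAtom j => if j == i then 1 else 0
  | LAdd e1 e2 => lcoef e1 i + lcoef e2 i
  | LOpp e1 => - lcoef e1 i | LScale c e1 => c * lcoef e1 i
  end.

(** A conjunction of equations and not a boolean test, since each equation between coefficients is
    left to [ring]. *)
Fixpoint leq_coefs (n : nat) (e1 e2 : lexp) : Prop :=
  if n is m.+1 then lcoef e1 m = lcoef e2 m /\ leq_coefs m e1 e2 else True.

Lemma levalE s e : leval s e = \sum_(i < size s) lcoef e i *: nth 0 s i.
Proof.
elim: e => [|j|e1 IH1 e2 IH2|e1 IH1|c e1 IH1] /=.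
- by rewrite big1 // => i _; rewrite scale0r.
- have [lt_j|ge_j] := ltnP j (size s); last first.
    rewrite nth_default // big1 // => i _.
    case: eqP => [ji|_]; last by rewrite scale0r.
    by move: ge_j; rewrite ji leqNgt ltn_ord.
  rewrite (bigD1 (Ordinal lt_j)) //= eqxx scale1r big1 ?addr0 // => i.
  by rewrite -val_eqE /= eq_sym => /negPf ->; rewrite scale0r.
- by rewrite IH1 IH2 -big_split; apply: eq_bigr => i _; rewrite scalerDl.
- by rewrite IH1 -sumrN; apply: eq_bigr => i _; rewrite scaleNr.
- by rewrite IH1 scaler_sumr; apply: eq_bigr => i _; rewrite scalerA.
Qed.

Lemma leval_eq s e1 e2 : leq_coefs (size s) e1 e2 -> leval s e1 = leval s e2.
Proof.
rewrite !levalE => H; apply: eq_bigr => i _; congr (_ *: _).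
elim: (size s) {i}(val i) (ltn_ord i) H => // n IH i.
rewrite ltnS leq_eqVlt => /orP[/eqP ->|]; first by case.
by move=> lt_in [_]; exact: IH.
Qed.

End LinComb.

Ltac lmod_mem x s :=
  match s with
  | nil => constr:(false) | x :: _ => constr:(true) | _ :: ?s' => lmod_mem x s'
  end.
Ltac lmod_atoms V t s :=
  match t with
  | @GRing.zero _ => s
  | GRing.add ?a ?b => let s1 := lmod_atoms V a s in lmod_atoms V b s1
  | GRing.opp ?a => lmod_atoms V a s
  | GRing.scale _ ?a => lmod_atoms V a s
  | _ => let b := lmod_mem t s in
         match b with true => s | false => constr:(@cons V t s) end
  end.
Ltac lmod_index x s :=
  match s with
  | x :: _ => constr:(0%N)
  | _ :: ?s' => let n := lmod_index x s' in constr:(S n)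
  end.
Ltac lmod_reify K t s :=
  match t with
  | @GRing.zero _ => constr:(@LZero K)
  | GRing.add ?a ?b => let u := lmod_reify K a s in let v := lmod_reify K b s in
       constr:(@LAdd K u v)
  | GRing.opp ?a => let u := lmod_reify K a s in constr:(@LOpp K u)
  | GRing.scale ?c ?a => let u := lmod_reify K a s in constr:(@LScale K c u)
  | _ => let n := lmod_index t s in constr:(@LAtom K n)
  end.
(* Proves an equation between linear combinations by comparing coefficients. *)
Ltac lmod_ring_with K :=
  match goal with |- @eq ?V ?t1 ?t2 =>
    let s0 := constr:(@nil V) in
    let s1 := lmod_atoms V t1 s0 in
    let s2 := lmod_atoms V t2 s1 in
    let e1 := lmod_reify K t1 s2 in
    let e2 := lmod_reify K t2 s2 in
    apply: (@leval_eq K _ s2 e1 e2);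
    cbn [leq_coefs lcoef size eqn eq_op];
    repeat (split; [try ring|]); try exact I
  end.

(** * Real-valued norms, limits and continuity *)

Section Complex.
Context {R : realType}.
Local Notation C := (Cplx R).

Definition rc (r : R) : C := real_complex R r.
Definition iu : C := 'i.

Lemma rcD : {morph rc : x y / x + y}. Proof. exact: (rmorphD (real_complex R)). Qed.
Lemma rcB : {morph rc : x y / x - y}. Proof. exact: (rmorphB (real_complex R)). Qed.
Lemma rcN : {morph rc : x / - x}. Proof. exact: (rmorphN (real_complex R)). Qed.
Lemma rcM : {morph rc : x y / x * y}. Proof. exact: (rmorphM (real_complex R)). Qed.
Lemma rcX n : {morph rc : x / x ^+ n}. Proof. exact: (rmorphXn (real_complex R)). Qed.
Lemma rc0 : rc 0 = 0. Proof. by []. Qed.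
Lemma rc1 : rc 1 = 1. Proof. by []. Qed.
Lemma rc_nat n : rc n%:R = n%:R. Proof. exact: (rmorph_nat (real_complex R)). Qed.
Lemma rc_le x y : (rc x <= rc y) = (x <= y). Proof. exact: lecR. Qed.
Lemma rc_lt x y : (rc x < rc y) = (x < y). Proof. exact: ltcR. Qed.
Lemma conj_rc x : (rc x)^* = rc x. Proof. exact: conjc_real. Qed.
Lemma norm_rc x : `|rc x| = rc `|x|.
Proof. by rewrite normc_def /= expr0n addr0 sqrtr_sqr. Qed.
Lemma rc_inj : injective rc. Proof. by move=> x y []. Qed.
Lemma conj_iu : iu^* = - iu. Proof. exact: conjCi. Qed.
Lemma iu2 : iu * iu = -1. Proof. by rewrite -expr2 sqrCi. Qed.
Lemma norm_iu : `|iu| = 1. Proof. exact: normCi. Qed.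
Lemma rc_sum (I : Type) (r : seq I) (P : pred I) (F : I -> R) :
  rc (\sum_(i <- r | P i) F i) = \sum_(i <- r | P i) rc (F i).
Proof. exact: (rmorph_sum (real_complex R)). Qed.
Lemma rc_Re (z : C) : 0 <= z -> z = rc (complex.Re z).
Proof. by move=> z0; rewrite /rc RRe_real // ger0_real. Qed.

(** The norm as a real number, so that estimates can be closed by real arithmetic. *)
Definition nrm {V : normedModType C} (x : V) : R := complex.Re `|x|.
Definition cn (z : C) : R := complex.Re `|z|.
Lemma cnE z : `|z| = rc (cn z). Proof. exact/rc_Re/normr_ge0. Qed.
Lemma cn_rc x : cn (rc x) = `|x|. Proof. by rewrite /cn norm_rc. Qed.
Lemma cn_iu : cn iu = 1. Proof. by rewrite /cn norm_iu. Qed.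
Lemma cnM x y : cn (x * y) = cn x * cn y.
Proof. by apply: rc_inj; rewrite rcM -!cnE normrM. Qed.
Lemma cn_ge0 z : 0 <= cn z. Proof. by rewrite -rc_le rc0 -cnE. Qed.
Lemma cnD x y : cn (x + y) <= cn x + cn y.
Proof. by rewrite -rc_le rcD -!cnE ler_normD. Qed.
Lemma cnN x : cn (- x) = cn x. Proof. by rewrite /cn normrN. Qed.
Lemma cn0 : cn 0 = 0. Proof. by rewrite /cn normr0. Qed.
Lemma cn_conj x : cn x^* = cn x. Proof. by rewrite /cn norm_conjC. Qed.
Lemma cn_sqr x : x^* * x = rc (cn x ^+ 2).
Proof. by rewrite rcX -cnE normCK mulrC. Qed.

Lemma invS_gt0 k : (0 : R) < k.+1%:R^-1. Proof. by rewrite invr_gt0. Qed.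
Lemma inv_small (e : R) : 0 < e -> exists N, forall n, (N <= n)%N -> n.+1%:R^-1 <= e.
Proof.
move=> e0; exists (Num.truncn e^-1) => n Nn.
rewrite invf_ple ?posrE //; apply/ltW/(lt_le_trans (truncnS_gt _)).
by rewrite ler_nat ltnS.
Qed.

Section Nrm.
Variable V : normedModType C.
Implicit Types x y z : V.
Lemma nrmE x : `|x| = rc (nrm x). Proof. exact/rc_Re/normr_ge0. Qed.
Lemma nrm_ge0 x : 0 <= nrm x. Proof. by rewrite -rc_le rc0 -nrmE. Qed.
Lemma nrm0 : nrm (0 : V) = 0. Proof. by rewrite /nrm normr0. Qed.
Lemma nrm0_eq x : nrm x = 0 -> x = 0.
Proof. by move=> x0; apply/normr0_eq0; rewrite nrmE x0. Qed.
Lemma nrm_le0 x : nrm x <= 0 -> x = 0.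
Proof. by move=> x0; apply: nrm0_eq; apply/eqP; rewrite eq_le x0 nrm_ge0. Qed.
Lemma nrmD x y : nrm (x + y) <= nrm x + nrm y.
Proof. by rewrite -rc_le rcD -!nrmE ler_normD. Qed.
Lemma nrmN x : nrm (- x) = nrm x. Proof. by rewrite /nrm normrN. Qed.
Lemma nrmB x y : nrm (x - y) <= nrm x + nrm y. Proof. by rewrite -(nrmN y) nrmD. Qed.
Lemma nrmC x y : nrm (x - y) = nrm (y - x). Proof. by rewrite -nrmN opprB. Qed.
Lemma nrmZ (z : C) x : nrm (z *: x) = cn z * nrm x.
Proof. by apply: rc_inj; rewrite rcM -cnE -!nrmE normrZ. Qed.
Lemma nrmZr (r : R) x : 0 <= r -> nrm (rc r *: x) = r * nrm x.
Proof. by move=> r0; rewrite nrmZ cn_rc ger0_norm. Qed.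
Lemma nrm_tri y x z : nrm (x - z) <= nrm (x - y) + nrm (y - z).
Proof. by apply: le_trans (nrmD _ _); rewrite addrA subrK. Qed.
Lemma nrm_le_sub x y : nrm x <= nrm y + nrm (x - y).
Proof. by apply: le_trans (nrmD _ _); rewrite addrC subrK. Qed.
Lemma nrm_sum (I : Type) (r : seq I) (P : pred I) (F : I -> V) :
  nrm (\sum_(i <- r | P i) F i) <= \sum_(i <- r | P i) nrm (F i).
Proof. by rewrite -rc_le rc_sum -nrmE; apply: le_trans (ler_norm_sum _ _ _) _;
  apply: ler_sum => i _; rewrite nrmE. Qed.

Lemma posC (e : C) : 0 < e -> exists2 r : R, 0 < r & e = rc r.
Proof.
move=> e0; exists (complex.Re e); last by rewrite -rc_Re // ltW.
by rewrite -rc_lt -rc_Re // ltW.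
Qed.

Lemma cvg_nrmP {T : Type} {F : set_system T} {FF : Filter F} (f : T -> V) y :
  f @ F --> y <-> forall e : R, 0 < e -> \forall t \near F, nrm (f t - y) <= e.
Proof.
split=> [/cvgrPdist_le H e e0|H].
  have := H (rc e); rewrite -rc0 rc_lt => /(_ e0).
  by apply: filterS => t; rewrite nrmE rc_le nrmC.
apply/cvgrPdist_le => _ /posC[e e0 ->]; apply: filterS (H e e0) => t.
by rewrite nrmE rc_le nrmC.
Qed.

Lemma cvg_seqP (u : nat -> V) y :
  u @ \oo --> y <->
  forall e : R, 0 < e -> exists N, forall n, (N <= n)%N -> nrm (u n - y) <= e.
Proof.
split=> [/cvg_nrmP H e /H[N _ HN]|H]; first by exists N => n; exact: HN.
by apply/cvg_nrmP => e /H[N HN]; exists N => // n; exact: HN.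
Qed.

Lemma closedP (I : set V) :
  closed I <-> forall x, (forall e : R, 0 < e -> exists2 y, I y & nrm (y - x) <= e) -> I x.
Proof.
split=> [cI x H|H].
  apply: cI; rewrite closureEnbhs /= => A B; move=> IA xB.
  have /nbhs_normP[_ /posC[e e0 ->] eB] := xB.
  have [y Iy ye] := H _ (divr_gt0 e0 (ltr0n _ 2)).
  exists y; split; first exact: IA.
  apply: eB => /=; rewrite nrmE rc_lt nrmC; apply: le_lt_trans ye _.
  by rewrite ltr_pdivrMr // ltr_pMr // ltr1n.
move=> x clx; apply: H => e e0; have re0 : 0 < rc e by rewrite -rc0 rc_lt.
have [] := clx (ball x (rc e)) (nbhsx_ballx _ _ re0).
move=> y [Iy xy]; exists y => //; move: xy.
by rewrite -ball_normE /= nrmE rc_lt nrmC; exact: ltW.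
Qed.

Lemma closureP (I : set V) x :
  closure I x <-> forall e : R, 0 < e -> exists2 y, I y & nrm (y - x) <= e.
Proof.
split=> [clx e e0|H].
  have re0 : 0 < rc e by rewrite -rc0 rc_lt.
  have [y [Iy xy]] := clx (ball x (rc e)) (nbhsx_ballx _ _ re0).
  by exists y => //; move: xy; rewrite -ball_normE /= nrmE rc_lt nrmC; exact: ltW.
apply: (iffLR (closedP _) (@closed_closure _ I)) => e /H[y Iy ye].
by exists y => //; exact: subset_closure.
Qed.

Lemma continuousP_nrm (T : topologicalType) (f : T -> V) :
  continuous f <-> forall t e, 0 < e -> \forall s \near t, nrm (f s - f t) <= e.
Proof. by split=> [fc t|fc t]; [exact/cvg_nrmP/fc|apply/cvg_nrmP/fc]. Qed.

End Nrm.


Lemma continuousP_cn (T : topologicalType) (f : T -> C) :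
  continuous f <-> forall t e, 0 < e -> \forall s \near t, cn (f s - f t) <= e.
Proof. exact: (@continuousP_nrm C^o T f). Qed.

(** Joint continuity in a generality that covers both the product of an algebra and the forms of
    Hilbert modules. *)
Lemma bilin_near (U V W : normedModType C) (m : U -> V -> W) a b (e : R) :
  (forall x y z, m (x - y) z = m x z - m y z) -> (forall x y z, m x (y - z) = m x y - m x z) ->
  (forall x y, nrm (m x y) <= nrm x * nrm y) -> 0 < e ->
  exists2 d : R, 0 < d & forall x y, nrm (x - a) <= d -> nrm (y - b) <= d ->
    nrm (m x y - m a b) <= e.
Proof.
move=> mBl mBr mM e0; pose K := nrm a + nrm b + 1.
have K0 : 0 < K by rewrite ltr_wpDl // addr_ge0 ?nrm_ge0.
pose d := Num.min 1 (e / (2 * K)).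
have d1 : d <= 1 by rewrite ge_min lexx.
have dK : d * (2 * K) <= e by rewrite -ler_pdivlMr ?mulr_gt0 // ge_min lexx orbT.
exists d => [|x y g1 g2]; first by rewrite lt_min ltr01 divr_gt0 // mulr_gt0.
have -> : m x y - m a b = m (x - a) y + m a (y - b) by rewrite mBl mBr addrA subrK.
apply: le_trans (nrmD _ _) _.
have b1 := mM (x - a) y; have b2 := mM a (y - b).
have yK : nrm y <= K by have := nrm_le_sub y b; have := nrm_ge0 a; rewrite /K; lra.
have aK : nrm a <= K by have := nrm_ge0 b; rewrite /K; lra.
have c1 := ler_pM (nrm_ge0 _) (nrm_ge0 _) g1 yK.
have c2 := ler_pM (nrm_ge0 _) (nrm_ge0 _) aK g2.
by lra.
Qed.

Lemma seq_cvg_cst (V : normedModType C) (x : V) : (fun=> x) @ \oo --> x.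
Proof. exact: cvg_cst. Qed.
Lemma seq_cvgD (V : normedModType C) (x y : nat -> V) (a b : V) :
  x @ \oo --> a -> y @ \oo --> b -> (fun n => x n + y n) @ \oo --> a + b.
Proof. by move=> *; exact: cvgD. Qed.
Lemma seq_cvgZ (V : normedModType C) (z : C) (x : nat -> V) (a : V) :
  x @ \oo --> a -> (fun n => z *: x n) @ \oo --> z *: a.
Proof. by move=> *; exact: cvgZr. Qed.

Lemma cauchy_seqP (V : completeNormedModType C) (u : nat -> V) :
  (forall e : R, 0 < e -> exists N, forall m n, (N <= m)%N -> (N <= n)%N ->
     nrm (u m - u n) <= e) ->
  exists y : V, u @ \oo --> y.
Proof.
move=> H; exists (lim (u @ \oo)); apply: cauchy_cvg; apply/cauchy_ballP.
move=> _ /posC[e e0 ->]; have [N HN] := H _ (divr_gt0 e0 (ltr0n _ 2)).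
exists (u @` [set n | (N <= n)%N], u @` [set n | (N <= n)%N]).
  by split; exists N => // n /= Nn; exists n.
move=> [_ _] /= [[m Nm <-] [n Nn <-]]; rewrite -ball_normE /= nrmE rc_lt.
apply: le_lt_trans (HN _ _ Nm Nn) _.
by rewrite ltr_pdivrMr // ltr_pMr // ltr1n.
Qed.

End Complex.

Ltac lmod_ring := match goal with R : realType |- _ => lmod_ring_with (Cplx R) end.

(** * C*-algebra identities, square roots and contractivity *)

Section Alg.
Context {R : realType} {A : cstarAlgType R}.
Local Notation C := (Cplx R).
Implicit Types x y : A.
Lemma cmul0l x : 0 ** x = 0. Proof. by have := cmulZl 0 0 x; rewrite !scale0r. Qed.
Lemma cmul0r x : x ** 0 = 0. Proof. by have := cmulZr 0 x 0; rewrite !scale0r. Qed.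
Lemma cmulNl x y : (- x) ** y = - (x ** y). Proof. by rewrite -scaleN1r cmulZl scaleN1r. Qed.
Lemma cmulNr x y : x ** (- y) = - (x ** y). Proof. by rewrite -scaleN1r cmulZr scaleN1r. Qed.
Lemma cmulBl x y z : (x - y) ** z = x ** z - y ** z. Proof. by rewrite cmulDl cmulNl. Qed.
Lemma cmulBr x y z : x ** (y - z) = x ** y - x ** z. Proof. by rewrite cmulDr cmulNr. Qed.
Lemma star0 : star (0 : A) = 0. Proof. by have := starZ 0 (0 : A); rewrite rmorph0 !scale0r. Qed.
Lemma starN x : star (- x) = - star x.
Proof. by rewrite -scaleN1r starZ rmorphN1 scaleN1r. Qed.
Lemma starB x y : star (x - y) = star x - star y. Proof. by rewrite starD starN. Qed.
Lemma starZr (r : R) x : star (rc r *: x) = rc r *: star x.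
Proof. by rewrite starZ conj_rc. Qed.
Definition calgE := (@cmulDl R A, @cmulDr R A, cmulNl, cmulNr, @cmulZl R A, @cmulZr R A, @cmulA R A,
  @starD R A, starN, @starM R A, starZr, @starK R A, cmul0l, cmul0r, star0).
Lemma cmul_suml (I : Type) (r : seq I) (P : pred I) (F : I -> A) x :
  (\sum_(i <- r | P i) F i) ** x = \sum_(i <- r | P i) (F i ** x).
Proof. by elim/big_rec2: _ => [|i y z _ <-]; rewrite ?cmul0l ?cmulDl. Qed.
Lemma cmul_sumr (I : Type) (r : seq I) (P : pred I) (F : I -> A) x :
  x ** (\sum_(i <- r | P i) F i) = \sum_(i <- r | P i) (x ** F i).
Proof. by elim/big_rec2: _ => [|i y z _ <-]; rewrite ?cmul0r ?cmulDr. Qed.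

Lemma nrmM x y : nrm (x ** y) <= nrm x * nrm y.
Proof. by rewrite -rc_le rcM -!nrmE cnormM. Qed.
Lemma nrm_sqr x : nrm (star x ** x) = nrm x ^+ 2.
Proof. by apply: rc_inj; rewrite rcX -!nrmE cnorm_star. Qed.
Lemma nrm_star x : nrm (star x) = nrm x.
Proof.
have le_star y : nrm y <= nrm (star y).
  have [->|y0] := eqVneq (nrm y) 0; first exact: nrm_ge0.
  have y_gt0 : 0 < nrm y by rewrite lt_neqAle eq_sym y0 nrm_ge0.
  by rewrite -(ler_pM2r y_gt0) -expr2 -nrm_sqr nrmM.
by apply/eqP; rewrite eq_le le_star andbT -{2}(starK x) le_star.
Qed.
Lemma nrm_sa x : star x = x -> nrm (x ** x) = nrm x ^+ 2.
Proof. by move=> {1}<-; exact: nrm_sqr. Qed.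
Lemma sa_eq0 x : star x = x -> x ** x = 0 -> x = 0.
Proof.
move=> /nrm_sa H x0; apply: nrm0_eq; apply/eqP.
by rewrite -(sqrf_eq0 (nrm x)) -H x0 nrm0.
Qed.
(* Testing the left multiplication by x on star x itself. *)
Lemma nrm_lmul x (M : R) : 0 <= M -> (forall y, nrm (x ** y) <= M * nrm y) -> nrm x <= M.
Proof.
move=> M0 H; have := H (star x); have := nrm_sqr (star x); rewrite starK nrm_star => ->.
have [->//|x0] := eqVneq (nrm x) 0.
have x_gt0 : 0 < nrm x by rewrite lt_neqAle eq_sym x0 nrm_ge0.
by rewrite expr2 ler_pM2r.
Qed.

(* As [a + i (1 - b)] is unitary, its real part [a] is a contraction. *)
Lemma unitary_trick (a b : A) : star a = a -> star b = b -> a ** b = b ** a ->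
  a ** a + b ** b = rc 2 *: b -> nrm a <= 1.
Proof.
move=> sa sb ab E; apply: nrm_lmul => // y; rewrite mul1r.
have iu2' : iu * iu = -1 :> C := iu2.
(* [A] may lack a unit, so the unitaries [a + iu (1 - b)] and [a - iu (1 - b)] exist only as
   operators; [p + s *: q] is their value at [y] for [s = iu] and [s = - iu]. *)
pose q : A := y - b ** y; pose p := a ** y.
have K (s : C) : s^* = - s -> s * s = -1 -> nrm (p + s *: q) = nrm y.
  move=> ss s2; apply/eqP; rewrite -(@eqrXn2 _ 2) ?nrm_ge0 // -!nrm_sqr; apply/eqP.
  congr nrm; rewrite /p /q starD starZ ss !calgE sa sb.
  have -> : star y ** a ** b ** y = star y ** b ** a ** y.
    by rewrite -(cmulA (star y)) ab cmulA.
  have -> : star y ** b ** b ** y = rc 2 *: (star y ** b ** y) - star y ** a ** a ** y.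
    have <- : star y ** (a ** a + b ** b) ** y = rc 2 *: (star y ** b ** y).
      by rewrite E !calgE.
    by rewrite !calgE addrC addKr.
  have r2 : rc 2 = 1 + 1 :> C by rewrite -rc1 -rcD.
  by rewrite r2; lmod_ring; ring: s2.
have H : rc 2 *: p = (p + iu *: q) + (p - iu *: q).
  have r2 : rc 2 = 1 + 1 :> C by rewrite -rc1 -rcD.
  by lmod_ring; rewrite r2; ring.
have := nrmD (p + iu *: q) (p - iu *: q).
rewrite -H nrmZr // K ?conj_iu // -scaleNr K ?rmorphN /= ?conj_iu ?mulrNN //; lra.
Qed.

Lemma cmul_cvg (x y : nat -> A) (a b : A) : x @ \oo --> a -> y @ \oo --> b ->
  (fun n => x n ** y n) @ \oo --> a ** b.
Proof.
move=> /cvg_seqP xa /cvg_seqP yb; apply/cvg_seqP => e e0.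
have [d d0 Hd] := bilin_near a b cmulBl cmulBr nrmM e0.
have [N1 H1] := xa _ d0; have [N2 H2] := yb _ d0.
by exists (maxn N1 N2) => n; rewrite geq_max => /andP[/H1 h1 /H2 h2]; exact: Hd.
Qed.

Lemma star_cvg (x : nat -> A) (a : A) : x @ \oo --> a ->
  (fun n => star (x n)) @ \oo --> star a.
Proof.
move=> /cvg_seqP xa; apply/cvg_seqP => e /xa[N HN]; exists N => n /HN.
by rewrite -starB nrm_star.
Qed.

Lemma lim_uniq (x : nat -> A) (a b : A) : x @ \oo --> a -> x @ \oo --> b -> a = b.
Proof. exact: cvg_unique. Qed.

(* The iterates [b_{m+1} = (u + b_m^2) / 2], which solve [(1 - b)^2 = 1 - u] in the
   limit, and the same iterates for the number 1. *)
Fixpoint sqrt_iter (u : A) (m : nat) : A :=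
  if m is k.+1 then rc 2^-1 *: (u + sqrt_iter u k ** sqrt_iter u k) else 0.
Fixpoint sqrt_iter1 (m : nat) : R :=
  if m is k.+1 then 2^-1 * (1 + sqrt_iter1 k * sqrt_iter1 k) else 0.

Lemma sqrt_iter1_bound m : 0 <= sqrt_iter1 m <= 1.
Proof.
elim: m => [|m /andP[h0 h1]] /=; first by rewrite lexx ler01.
by have := ler_pM h0 h0 h1 h1; have := mulr_ge0 h0 h0; lra.
Qed.

Lemma sqrt_iter1_mono m n : (m <= n)%N -> sqrt_iter1 m <= sqrt_iter1 n.
Proof.
apply: (homo_leq (f := sqrt_iter1) (r := <=%R)) => // [y x z|k]; first exact: le_trans.
elim: k => [|k IH]; first by case/andP: (sqrt_iter1_bound 1).
rewrite [in leLHS]/= [in leRHS]/= ler_pM2l ?invr_gt0 // lerD2l.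
by case/andP: (sqrt_iter1_bound k) => h0 _; exact: ler_pM.
Qed.

Lemma sqrt_iter1_cvg : cvgn sqrt_iter1.
Proof.
apply: nondecreasing_is_cvgn; first by move=> m n; exact: sqrt_iter1_mono.
by exists 1 => _ [m _ <-]; case/andP: (sqrt_iter1_bound m).
Qed.

(** Intertwining of two different elements, and not only commutation, is carried through to the
    square roots because [pos_star_mul] depends on it. *)
Lemma sqrt_iter_comm u u' y m : u ** y = y ** u' ->
  sqrt_iter u m ** y = y ** sqrt_iter u' m.
Proof.
move=> uy; elim: m => [|m IH] /=; first by rewrite cmul0l cmul0r.
by rewrite !calgE uy -cmulA IH cmulA IH -cmulA.
Qed.

Lemma sqrt_iter_sa u m : star u = u -> star (sqrt_iter u m) = sqrt_iter u m.
Proof. by move=> su; elim: m => [|m IH] /=; rewrite ?star0 // !calgE su IH. Qed.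

Lemma sqrt_iter_le u m : nrm u <= 1 -> nrm (sqrt_iter u m) <= sqrt_iter1 m.
Proof.
move=> u1; elim: m => [|m IH] /=; first by rewrite nrm0.
rewrite nrmZr ?invr_ge0 // ler_pM2l ?invr_gt0 //; apply: le_trans (nrmD _ _) _.
by apply: lerD => //; apply: le_trans (nrmM _ _) _; apply: ler_pM => //; exact: nrm_ge0.
Qed.

(** The iterates commute, so differences of squares factor as for numbers; the increments are thus
    dominated by those of the convergent scalar iteration. *)
Lemma sqrt_iter_sub u m n : nrm u <= 1 -> (m <= n)%N ->
  nrm (sqrt_iter u n - sqrt_iter u m) <= sqrt_iter1 n - sqrt_iter1 m.
Proof.
move=> u1; elim: m n => [|m IH] [|n] //; rewrite ?ltn0 ?ltnS ?subr0.
- by move=> _; exact: sqrt_iter_le.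
- by move=> _; exact: sqrt_iter_le.
move=> mn /=.
have cc k l : sqrt_iter u k ** sqrt_iter u l = sqrt_iter u l ** sqrt_iter u k.
  by apply: sqrt_iter_comm; symmetry; apply: sqrt_iter_comm.
set x := sqrt_iter u n; set y := sqrt_iter u m.
have -> : rc 2^-1 *: (u + x ** x) - rc 2^-1 *: (u + y ** y) =
  rc 2^-1 *: ((x - y) ** (x + y)).
  by rewrite !calgE (cc m n : y ** x = x ** y); lmod_ring.
rewrite nrmZr ?invr_ge0 // -mulrBr ler_pM2l ?invr_gt0 //.
have -> : 1 + sqrt_iter1 n * sqrt_iter1 n - (1 + sqrt_iter1 m * sqrt_iter1 m) =
  (sqrt_iter1 n - sqrt_iter1 m) * (sqrt_iter1 n + sqrt_iter1 m) by ring.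
apply: le_trans (nrmM _ _) _; apply: ler_pM (nrm_ge0 _) (nrm_ge0 _) (IH _ mn) _.
by apply: le_trans (nrmD _ _) _; apply: lerD; exact: sqrt_iter_le.
Qed.

Lemma sqrt_iter_limit u : nrm u <= 1 ->
  exists b : A, sqrt_iter u @ \oo --> b.
Proof.
move=> u1; apply: cauchy_seqP => e e0.
have /cvgrPdist_le /(_ _ (divr_gt0 e0 (ltr0n _ 2)))[N _ HN] := sqrt_iter1_cvg.
exists N => m n.
wlog mn : m n / (m <= n)%N => [H|] Nm Nn.
  by case: (leqP m n) => [|/ltnW] mn; [exact: H|rewrite nrmC; exact: H].
rewrite nrmC; apply: le_trans (sqrt_iter_sub u1 mn) _.
have := HN _ Nm; have := HN _ Nn; rewrite /= !ler_norml; lra.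
Qed.

(** Plays the role of [1 - sqrt (1 - u)], which makes sense without a unit. *)
Definition sqrt_lim (u : A) : A := lim (sqrt_iter u @ \oo).

Lemma sqrt_lim_cvg u : nrm u <= 1 -> sqrt_iter u @ \oo --> sqrt_lim u.
Proof. by move=> /sqrt_iter_limit[b ub]; apply: cvgP ub. Qed.

Lemma sqrt_limE u : nrm u <= 1 -> u + sqrt_lim u ** sqrt_lim u = rc 2 *: sqrt_lim u.
Proof.
move=> u1; have H := sqrt_lim_cvg u1.
have H1 : (fun m => sqrt_iter u m.+1) @ \oo --> rc 2^-1 *: (u + sqrt_lim u ** sqrt_lim u).
  by apply: seq_cvgZ; apply: seq_cvgD; [exact: seq_cvg_cst|exact: cmul_cvg].
have H2 : (fun m => sqrt_iter u m.+1) @ \oo --> sqrt_lim u.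
  by move: H; rewrite -(cvg_shiftS (sqrt_iter u)).
by rewrite -[in RHS](lim_uniq H1 H2) scalerA -rcM divff ?pnatr_eq0 // rc1 scale1r.
Qed.

Lemma sqrt_lim_sa u : nrm u <= 1 -> star u = u -> star (sqrt_lim u) = sqrt_lim u.
Proof.
move=> u1 su; have H := sqrt_lim_cvg u1; apply: lim_uniq (star_cvg H) _.
by under eq_fun do rewrite sqrt_iter_sa //.
Qed.

Lemma sqrt_lim_comm u u' y : nrm u <= 1 -> nrm u' <= 1 -> u ** y = y ** u' ->
  sqrt_lim u ** y = y ** sqrt_lim u'.
Proof.
move=> u1 u'1 uy.
have H := cmul_cvg (sqrt_lim_cvg u1) (@seq_cvg_cst _ _ y).
apply: lim_uniq H _; under eq_fun do rewrite (sqrt_iter_comm _ uy).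
exact: cmul_cvg (@seq_cvg_cst _ _ y) (sqrt_lim_cvg u'1).
Qed.

Lemma sqrt_lim_le u : nrm u <= 1 -> nrm (sqrt_lim u) <= 1.
Proof.
move=> u1; rewrite leNgt; apply/negP => h.
have /cvg_seqP := sqrt_lim_cvg u1 => /(_ ((nrm (sqrt_lim u) - 1) / 2)).
case=> [|N /(_ N (leqnn _))]; first by rewrite divr_gt0 ?subr_gt0.
have := nrm_le_sub (sqrt_lim u) (sqrt_iter u N); rewrite (nrmC (sqrt_lim u)).
by have := sqrt_iter_le N u1; case/andP: (sqrt_iter1_bound N); lra.
Qed.

Lemma nrm_sa_pow_le (V : normedModType C) (x : V) (M : R) : 0 <= M -> nrm x ^+ 2 <= M ^+ 2 -> nrm x <= M.
Proof. by move=> M0; rewrite ler_sqr // nnegrE ?nrm_ge0. Qed.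
End Alg.

(** With [b = sqrt_lim (a ** a)] the hypotheses of [unitary_trick] are algebraic identities between
    [a] and [b], hence hold for [f a] and [f b]. *)
Lemma star_hom_le1 (R : realType) (A B : cstarAlgType R) (f : A -> B) (a : A) :
  star_hom f -> star a = a -> nrm a <= 1 -> nrm (f a) <= 1.
Proof.
move=> hf sa a1.
have u1 : nrm (a ** a) <= 1 by rewrite nrm_sa // expr_le1 ?nrm_ge0.
have su : star (a ** a) = a ** a by rewrite starM sa.
apply: (@unitary_trick _ _ _ (f (sqrt_lim (a ** a)))).
- by rewrite -(star_homS hf) sa.
- by rewrite -(star_homS hf) sqrt_lim_sa.
- rewrite -!(star_homM hf) (sqrt_lim_comm u1 u1) //; by rewrite cmulA.
- by rewrite -!(star_homM hf) -(star_homD hf) sqrt_limE // (star_homZ hf).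
Qed.

Lemma star_hom_nrm (R : realType) (A B : cstarAlgType R) (f : A -> B) (a : A) :
  star_hom f -> nrm (f a) <= nrm a.
Proof.
move=> hf; apply: nrm_sa_pow_le; first exact: nrm_ge0.
rewrite -!nrm_sqr -(star_homS hf) -(star_homM hf).
set h := star a ** a.
have sh : star h = h by rewrite /h starM starK.
have f0 : f 0 = 0 by have := star_homZ hf 0 0; rewrite !scale0r.
have [/nrm0_eq ->|h0] := eqVneq (nrm h) 0; first by rewrite f0 !nrm0.
have h_gt0 : 0 < nrm h by rewrite lt_neqAle eq_sym h0 nrm_ge0.
have i0 : 0 <= (nrm h)^-1 by rewrite invr_ge0 nrm_ge0.
have := @star_hom_le1 _ _ _ f (rc (nrm h)^-1 *: h) hf.
rewrite starZr sh nrmZr // mulVf // (star_homZ hf) nrmZr //.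
by move=> /(_ erefl (lexx _)); rewrite ler_pdivrMl // mulr1.
Qed.

Lemma act_nrm (R : realType) (G : topGroupType) (A : cstarAlgType R)
  (alpha : cstar_action G A) g a : nrm (alpha g a) = nrm a.
Proof.
apply/eqP; rewrite eq_le (star_hom_nrm _ (act_hom alpha g)) /=.
rewrite -{1}(act1 alpha a) -(mulVg g) actM.
exact: (star_hom_nrm _ (act_hom alpha g^-1%g)).
Qed.

Section Eps.
Context {R : realType}.
(** The restriction to [d <= 1] lets callers absorb terms in [d * d] into terms in [d]. *)
Lemma le_of_eps (a b K : R) : (forall d : R, 0 < d -> d <= 1 -> a <= b + d * K) -> a <= b.
Proof.
move=> H; apply/ler_addgt0Pr => e e0.
have K1 : 0 < `|K| + 1 by rewrite ltr_wpDl.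
pose d := Num.min 1 (e / (`|K| + 1)).
have d0 : 0 < d by rewrite lt_min ltr01 divr_gt0.
apply: le_trans (H _ d0 _) _; first by rewrite ge_min lexx.
rewrite lerD2l; apply: le_trans (_ : d * (`|K| + 1) <= _).
  by rewrite ler_wpM2l ?(ltW d0) //; have := ler_norm K; lra.
by rewrite -ler_pdivlMr // ge_min lexx orbT.
Qed.
Lemma eq_of_eps (V : normedModType (Cplx R)) (x y : V) (K : R) :
  (forall d : R, 0 < d -> d <= 1 -> nrm (x - y) <= d * K) -> x = y.
Proof.
move=> H; apply/eqP; rewrite -subr_eq0; apply/eqP/nrm_le0/(le_of_eps (K := K)) => d d0 d1.
by rewrite add0r; exact: H.
Qed.
End Eps.

(** * Averaging over the group *)

Section Compactness.
Variables (G : topGroupType).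
Hypothesis compact_G : compact [set: G].

Lemma finite_subcover (U : G -> set G) : (forall g, nbhs g (U g)) ->
  exists s : seq G, forall h, exists2 g, g \in s & U g h.
Proof.
move=> HU; have := compact_G; rewrite compact_cover => /(_ G setT (fun g => (U g)^°)).
case; first by move=> g _; exact: open_interior.
  by move=> g _; exists g => //; exact: HU.
move=> D _ HD; exists (finmap.enum_fset D) => h; have [g gD hg] := HD h I.
by exists g => //; exact: interior_subset hg.
Qed.

(** The neighbourhood [U] is chosen before [i]. In this form equicontinuity turns estimates at
    single points of [G] into estimates on all of [G]. *)
Lemma near_compact (I : Type) (F : set_system I) (P : I -> G -> Prop) : Filter F ->
  (forall g : G, exists2 U : set G, nbhs g U & \forall i \near F, forall h, U h -> P i h) ->
  \forall i \near F, forall g, P i g.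
Proof.
move=> FF H; have /compact_near_coveringP /(_ I F P FF) := compact_G.
move=> HK; suff /HK : forall x, [set: G] x -> \near x & F, P F x.
  by apply: filterS => i Pi g; exact: Pi.
move=> g _; have [U gU FU] := H g.
by exists (U, [set i | forall h, U h -> P i h]) => // -[h i] /= [Uh Vi]; exact: Vi.
Qed.

End Compactness.

(** * Fixed points by averaging over finite nets *)

Section Averaging.
Context {R : realType} {G : topGroupType} {A : cstarAlgType R}.
Variable alpha : cstar_action G A.
Hypothesis compact_G : compact [set: G].
Local Notation C := (Cplx R).

Lemma actD g : {morph alpha g : x y / x + y}. Proof. exact: star_homD (act_hom alpha g). Qed.
Lemma actZ g (z : C) x : alpha g (z *: x) = z *: alpha g x.
Proof. exact: star_homZ (act_hom alpha g) _ _. Qed.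
Lemma actMul g : {morph alpha g : x y / x ** y}. Proof. exact: star_homM (act_hom alpha g). Qed.
Lemma actS g : {morph alpha g : x / star x}. Proof. exact: star_homS (act_hom alpha g). Qed.
Lemma act_0 g : alpha g 0 = 0. Proof. by have := actZ g 0 0; rewrite !scale0r. Qed.
Lemma actN g : {morph alpha g : x / - x}.
Proof. by move=> x; rewrite -scaleN1r actZ scaleN1r. Qed.
Lemma actB g : {morph alpha g : x y / x - y}. Proof. by move=> x y; rewrite actD actN. Qed.
Lemma act_sum g (I : Type) (r : seq I) (P : pred I) (F : I -> A) :
  alpha g (\sum_(i <- r | P i) F i) = \sum_(i <- r | P i) alpha g (F i).
Proof. by elim/big_rec2: _ => [|i y z _ <-]; rewrite ?act_0 ?actD. Qed.
Lemma actVK g x : alpha g^-1%g (alpha g x) = x.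
Proof. by rewrite -actM mulVg act1. Qed.
Lemma act_sub_nrm g h x : nrm (alpha g x - alpha h x) = nrm (alpha (h^-1 * g)%g x - x).
Proof. by rewrite -[RHS](act_nrm alpha h) actB -actM mulgA mulgV mul1g. Qed.

Lemma act_near x g (e : R) : 0 < e -> \forall h \near g, nrm (alpha h x - alpha g x) <= e.
Proof. exact: (iffLR (continuousP_nrm (alpha^~ x)) (@act_continuous _ _ _ alpha x)). Qed.

(** The orbit of [x] is compact, so [alpha h - alpha g] is uniformly small on it for [h] near
    [g]. *)
Lemma act_near_unif x g (e : R) : 0 < e ->
  \forall h \near g, forall t, nrm (alpha (h * t)%g x - alpha (g * t)%g x) <= e.
Proof.
move=> e0; apply: (near_compact compact_G (P := fun h t => nrm (alpha (h * t)%g x - alpha (g * t)%g x) <= e)).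
move=> t.
have /(_ (g, t)) := @mulg_continuous G.
move=> /(_ [set k | nrm (alpha k x - alpha (g * t)%g x) <= e / 2]).
case; first by apply: act_near; rewrite divr_gt0.
move=> [U V] /= [gU tV] UV; exists V => //; apply: filterS (gU) => h Uh k Vk.
have g1 := UV (h, k) (conj Uh Vk).
have g2 := UV (g, k) (conj (nbhs_singleton gU) Vk).
apply: le_trans (nrm_tri (alpha (g * t)%g x) _ _) _; rewrite [X in _ + X]nrmC.
by move: g1 g2 => /=; lra.
Qed.

Lemma act_net x (e : R) : 0 < e -> exists s : seq G, forall h, exists2 g, g \in s &
  forall t, nrm (alpha (h * t)%g x - alpha (g * t)%g x) <= e.
Proof. by move=> e0; apply: finite_subcover => // g; exact: act_near_unif. Qed.

Definition lin_bdd (L : A -> A) : Prop :=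
  [/\ {morph L : a b / a + b}, forall (c : C) a, L (c *: a) = c *: L a &
      exists K : R, forall a, nrm (L a) <= K * nrm a].

Lemma lin_bdd_id : lin_bdd id.
Proof. by split => //; exists 1 => a; rewrite mul1r. Qed.

Lemma lin_bdd_mulr d : lin_bdd (fun a => a ** d).
Proof.
split=> [a b|c a|]; rewrite ?cmulDl ?cmulZl //.
by exists (nrm d) => a; rewrite mulrC nrmM.
Qed.

Lemma lin_bdd_mull d : lin_bdd (fun a => d ** a).
Proof. by split=> [a b|c a|]; rewrite ?cmulDr ?cmulZr //; exists (nrm d) => a; rewrite nrmM. Qed.

Lemma lin_bdd_act L g : lin_bdd L -> lin_bdd (fun a => L (alpha g a)).
Proof.
case=> LD LZ [K LK]; split=> [a b|c a|]; rewrite ?actD ?actZ //.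
by exists K => a; rewrite -[nrm a](act_nrm alpha g).
Qed.

Lemma lin_bddB L L' : lin_bdd L -> lin_bdd L' -> lin_bdd (fun a => L a - L' a).
Proof.
case=> LD LZ [K LK] [LD' LZ' [K' LK']]; split=> [a b|c a|].
- by rewrite LD LD'; lmod_ring.
- by rewrite LZ LZ' scalerBr.
by exists (K + K') => a; rewrite mulrDl; apply: le_trans (nrmB _ _) (lerD _ _).
Qed.

(* The closed convex hull of the orbit of [x], through the closed convex sets
   [{y | nrm (L y - z) <= M}] that contain it. *)
Definition hull (x y : A) : Prop := forall (L : A -> A) z (M : R), lin_bdd L ->
  (forall g, nrm (L (alpha g x) - z) <= M) -> nrm (L y - z) <= M.

Definition osc_le (y : A) (d : R) : Prop := forall g, nrm (alpha g y - y) <= d.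

Lemma hull_refl x : hull x x.
Proof. by move=> L z M _ /(_ 1%g); rewrite act1. Qed.

Lemma hull_act x y g : hull x y -> hull x (alpha g y).
Proof.
move=> xy L z M LL H; apply: (xy (fun a => L (alpha g a))) => [|h].
  exact: lin_bdd_act.
by rewrite -actM.
Qed.

Lemma hull_trans x y z : hull x y -> hull y z -> hull x z.
Proof.
move=> xy yz L w M LL H; apply: (yz L w M LL) => g; exact: (hull_act g xy).
Qed.

Lemma hull_osc y y' d : hull y y' -> osc_le y d -> nrm (y' - y) <= d.
Proof. by move=> H yd; apply: (H id) => //; exact: lin_bdd_id. Qed.

Lemma hull_mean x y n (g : 'I_n -> G) : (0 < n)%N -> hull x y ->
  hull x (rc (n%:R^-1) *: \sum_i alpha (g i) y).
Proof.
move=> n0 xy L z M LL H; have [LD LZ _] := LL.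
have n_gt0 : (0 : R) < n%:R by rewrite ltr0n.
have L0 : L 0 = 0 by have := LZ 0 0; rewrite !scale0r.
have -> : L (rc n%:R^-1 *: \sum_i alpha (g i) y) - z =
  rc n%:R^-1 *: \sum_i (L (alpha (g i) y) - z).
  rewrite LZ big_split /= sumr_const card_ord scalerDr; congr (_ + _).
    by congr (_ *: _); elim/big_rec2: _ => [|i a b _ <-].
  rewrite -[(- z) *+ n]scaler_nat scalerA -rc_nat -rcM mulVf ?scale1r //.
  by rewrite pnatr_eq0 -lt0n.
rewrite nrmZr ?invr_ge0 // ler_pdivrMl //; apply: le_trans (nrm_sum _ _ _) _.
rewrite mulr_natl -[n in X in _ <= X]card_ord -sumr_const; apply: ler_sum => i _.
exact: (hull_act (g i) xy).
Qed.

(** The terms of the mean and of its translate by [h] are paired by a transposition that matches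
    [h * g ord0] with a nearby point [g j] of the net. This pair differs by at most [e], as the net
    estimate passes from [x] to its hull; every other pair differs by at most [d]. *)
Lemma osc_mean x y n (g : 'I_n -> G) (d e : R) : (0 < n)%N -> hull x y ->
  osc_le y d ->
  (forall h, exists i, forall t, nrm (alpha (h * t)%g x - alpha (g i * t)%g x) <= e) ->
  osc_le (rc (n%:R^-1) *: \sum_i alpha (g i) y) (d - (d - e) / n%:R).
Proof.
case: n g => // n g _ xy yd net h.
have n_gt0 : (0 : R) < n.+1%:R by rewrite ltr0n.
have [j Hj] := net (h * g ord0)%g.
pose s := tperm ord0 j.
have -> : alpha h (rc n.+1%:R^-1 *: \sum_i alpha (g i) y) - rc n.+1%:R^-1 *: \sum_i alpha (g i) y =
  rc n.+1%:R^-1 *: \sum_i (alpha (h * g i)%g y - alpha (g (s i)) y).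
  rewrite actZ act_sum -scalerBr; congr (_ *: _).
  rewrite [X in _ - X](reindex_inj (@perm_inj _ s)) /= -sumrB.
  by apply: eq_bigr => i _; rewrite actM.
rewrite nrmZr ?invr_ge0 // ler_pdivrMl //; apply: le_trans (nrm_sum _ _ _) _.
have -> : n.+1%:R * (d - (d - e) / n.+1%:R) = e + d *+ n.
  by rewrite mulrBr mulrCA divff ?pnatr_eq0 // mulr1 mulr_natl mulrS; lra.
rewrite big_ord_recl; apply: lerD.
  rewrite /s tpermL -[X in nrm X]subr0.
  apply: (xy (fun a => alpha (h * g ord0)%g a - alpha (g j) a)).
    by apply: lin_bddB; exact: (lin_bdd_act _ lin_bdd_id).
  by move=> t; rewrite subr0 -!actM.
rewrite -[n in X in _ <= X]card_ord -sumr_const; apply: ler_sum => i _.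
by rewrite act_sub_nrm.
Qed.

(** One net of [n] points for the tolerance [e / 2] serves for all steps, because every mean stays
    in the hull of [x]. As long as the bound exceeds [e], averaging lowers it by at least
    [c = e / 2 / n]; it starts at [2 * nrm x]. *)
Lemma hull_small_osc x (e : R) : 0 < e -> exists2 y, hull x y & osc_le y e.
Proof.
move=> e0; have [s Hs] := act_net x (divr_gt0 e0 (ltr0n _ 2)).
have s0 : (0 < size s)%N by have [g] := Hs 1%g; case: (s).
pose n := size s; pose g (i : 'I_n) := nth 1%g s i.
have n_gt0 : (0 : R) < n%:R by rewrite ltr0n.
pose c := e / 2 / n%:R.
have c0 : 0 < c by rewrite !divr_gt0.
suff H k y : hull x y -> osc_le y (e + k%:R * c) -> exists2 y, hull x y & osc_le y e.
  apply: (H (Num.truncn (2 * nrm x / c)).+1 x (@hull_refl x)) => h.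
  apply: le_trans (nrmB _ _) _; rewrite act_nrm -mulr2n -mulr_natl.
  have : 2 * nrm x <= (Num.truncn (2 * nrm x / c)).+1%:R * c.
    by rewrite -ler_pdivrMr //; apply/ltW/truncnS_gt.
  by lra.
elim: k y => [|k IH] y xy; first by rewrite mul0r addr0; exists y.
move=> yd; apply: IH (hull_mean g s0 xy) _ => h.
apply: le_trans (osc_mean (g := g) (e := e / 2) s0 xy yd _ h) _.
  move=> t; have [k' k's Hk] := Hs t.
  have k'n : (index k' s < n)%N by rewrite index_mem.
  by exists (Ordinal k'n); rewrite /g /= nth_index.
rewrite -natr1 mulrDl mul1r.
suff : c <= (e + (k%:R * c + c) - e / 2) / n%:R by lra.
rewrite /c ler_pM2r ?invr_gt0 // -/c.
have : 0 <= k%:R * c by rewrite mulr_ge0 // ltW.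
by lra.
Qed.

(** Iterated averaging stands in for the Haar integral, since a measure is only given together with
    a crossed product. The iterates are Cauchy: the hull of each lies within its oscillation. *)
Lemma fixed_in_hull x : exists2 y, fixed_points alpha y & hull x y.
Proof.
have /choice[f Hf] : forall p : A * nat, exists y, hull p.1 y /\ osc_le y p.2.+1%:R^-1.
  by move=> p; have [|y] := @hull_small_osc p.1 p.2.+1%:R^-1; [rewrite invr_gt0|exists y].
pose u := fix u n := if n is m.+1 then f (u m, m) else x.
have uh m k : hull (u m) (u (m + k)%N).
  elim: k => [|k IH]; first by rewrite addn0; exact: hull_refl.
  by rewrite addnS /=; apply: hull_trans IH _; case: (Hf (u (m + k)%N, (m + k)%N)).
have uo m : osc_le (u m.+1) m.+1%:R^-1 by case: (Hf (u m, m)).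
have [|y uy] := cauchy_seqP (u := u).
  move=> e /(fun e0 => divr_gt0 e0 (ltr0n _ 2)) /inv_small[N HN]; exists N.+1.
  have H m : (N.+1 <= m)%N -> nrm (u m - u N.+1) <= e / 2.
    move=> /subnK <-; rewrite addnC; apply: le_trans (HN _ (leqnn _)).
    by apply: hull_osc; [exact: uh|exact: uo].
  move=> m n /H hm /H hn; apply: le_trans (nrm_tri (u N.+1) _ _) _.
  by rewrite [X in _ + X]nrmC; lra.
move/cvg_seqP: uy => uy; exists y.
  move=> g; apply/eqP; rewrite -subr_eq0; apply/eqP/nrm_le0; apply/ler_addgt0Pr => e e0.
  have e3 : 0 < e / 3 by rewrite divr_gt0.
  have [N1 H1] := uy _ e3; have [N2 H2] := inv_small e3.
  have := H1 (maxn N1 N2).+1; rewrite leqW ?leq_maxl // => /(_ erefl) h1.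
  have := le_trans (uo (maxn N1 N2) g) (H2 _ (leq_maxr _ _)).
  set z := u _ in h1 *; move=> h2; rewrite add0r.
  have -> : alpha g y - y = (alpha g z - z) + (z - y) - alpha g (z - y).
    by rewrite actB; lmod_ring.
  by apply: le_trans (nrmB _ _) _; rewrite act_nrm; have := nrmD (alpha g z - z) (z - y); lra.
move=> L z M LL H; have [LD LZ [K LK]] := LL; apply/ler_addgt0Pr => e e0.
have K0 : 0 < `|K| + 1 by rewrite ltr_wpDl.
have [N /(_ N (leqnn _)) hN] := uy _ (divr_gt0 e0 K0).
have -> : L y - z = (L (u N) - z) - L (u N - y).
  by rewrite LD -(scaleN1r y) LZ; lmod_ring.
apply: le_trans (nrmB _ _) _; apply: lerD; first exact: (uh 0%N N).
apply: le_trans (LK _) _; apply: le_trans (_ : (`|K| + 1) * nrm (u N - y) <= _).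
  by apply: ler_wpM2r; [exact: nrm_ge0|apply: le_trans (ler_norm _) _; rewrite lerDl].
by rewrite mulrC -ler_pdivlMr.
Qed.

Lemma fixed_near x (e : R) : osc_le x e -> exists2 y, fixed_points alpha y & nrm (y - x) <= e.
Proof. by move=> xe; have [y fy xy] := fixed_in_hull x; exists y => //; exact: hull_osc. Qed.

Definition fixed_approx_unit (u : nat -> A) : Prop :=
  [/\ forall n, fixed_points alpha (u n), forall n, nrm (u n) <= 1,
      forall d, (fun n => u n ** d) @ \oo --> d &
      forall d, (fun n => d ** u n) @ \oo --> d].

(** Each [e n] is replaced by a fixed point of its hull. For this, [alpha g (e n) ** d - d] must be
    small uniformly in [g]; it has the norm of [e n ** d' - d'] with [d'] in the orbit of [d], which
    is compact, and a bounded approximate unit converges uniformly there. *)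
Lemma fixed_approx_unit_exists : sigma_unital A -> exists u, fixed_approx_unit u.
Proof.
case=> e [_ e1 el er]; have /choice[u Hu] : forall n, exists y, fixed_points alpha y /\ hull (e n) y.
  by move=> n; have [y ? ?] := fixed_in_hull (e n); exists y.
have e1' n : nrm (e n) <= 1 by rewrite -rc_le -nrmE rc1.
have unif (L : nat -> A -> A) : (forall n, lin_bdd (L n)) ->
    (forall n a, nrm (L n a) <= nrm a) -> 
    (forall a, (fun n => L n a) @ \oo --> a) -> forall d (eps : R), 0 < eps ->
    \forall n \near \oo, forall h, nrm (L n (alpha h d) - alpha h d) <= eps.
  move=> LL L1 Lc d eps eps0; apply: (near_compact compact_G) => g.
  have eps3 : 0 < eps / 3 by rewrite divr_gt0.
  exists [set h | nrm (alpha h d - alpha g d) <= eps / 3]; first exact: act_near.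
  have /cvg_nrmP /(_ _ eps3) := Lc (alpha g d); apply: filterS => n Hn h /= Hh.
  have [LD LZ _] := LL n.
  have -> : L n (alpha h d) - alpha h d = L n (alpha h d - alpha g d) +
      (L n (alpha g d) - alpha g d) - (alpha h d - alpha g d).
    by rewrite LD -(scaleN1r (alpha g d)) LZ; lmod_ring.
  apply: le_trans (nrmB _ _) _.
  have := nrmD (L n (alpha h d - alpha g d)) (L n (alpha g d) - alpha g d).
  by have := L1 n (alpha h d - alpha g d); lra.
exists u; split.
- by move=> n; case: (Hu n).
- move=> n; case: (Hu n) => _ h; rewrite -[X in nrm X]subr0.
  by apply: (h id) => [|g]; [exact: lin_bdd_id|rewrite subr0 act_nrm].
- move=> d; apply/cvg_nrmP => eps eps0.
  have := unif (fun n a => e n ** a) (fun n => lin_bdd_mull (e n)) _ el d eps eps0.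
  have le1 n a : nrm (e n ** a) <= nrm a.
    by apply: le_trans (nrmM _ _) _; rewrite ler_piMl ?nrm_ge0.
  move=> /(_ le1); apply: filterS => n Hn.
  case: (Hu n) => _ /(_ (fun a => a ** d)); apply; first exact: lin_bdd_mulr.
  move=> g; rewrite -(act_nrm alpha g^-1%g) actB actMul actVK; exact: Hn.
- move=> d; apply/cvg_nrmP => eps eps0.
  have := unif (fun n a => a ** e n) (fun n => lin_bdd_mulr (e n)) _ er d eps eps0.
  have le1 n a : nrm (a ** e n) <= nrm a.
    by apply: le_trans (nrmM _ _) _; rewrite ler_piMr ?nrm_ge0.
  move=> /(_ le1); apply: filterS => n Hn.
  case: (Hu n) => _ /(_ (fun a => d ** a)); apply; first exact: lin_bdd_mull.
  move=> g; rewrite -(act_nrm alpha g^-1%g) actB actMul actVK; exact: Hn.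
Qed.

End Averaging.

(** * Partitions of unity and separable subalgebras *)

Section RealContinuity.
Context {R : realType} {T : topologicalType}.
Local Notation C := (Cplx R).

Lemma continuousP_real (f : T -> R) :
  continuous f <-> forall t e, 0 < e -> \forall s \near t, `|f s - f t| <= e.
Proof.
split=> H t; last first.
  by apply/cvgrPdist_le => e e0; apply: filterS (H t e e0) => s; rewrite distrC.
by move=> e e0; have /cvgrPdist_le/(_ e e0) := H t; apply: filterS => s; rewrite distrC.
Qed.

Lemma continuous_lip (f : T -> R) (h : R -> R) (K : R) : 0 < K ->
  (forall x y, `|h x - h y| <= K * `|x - y|) -> continuous f -> continuous (fun t => h (f t)).
Proof.
move=> K0 hK /continuousP_real cf; apply/continuousP_real => t e e0.
apply: filterS (cf t _ (divr_gt0 e0 K0)) => s H; apply: le_trans (hK _ _) _.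
by rewrite mulrC -ler_pdivlMr.
Qed.

Lemma continuous_rc (f : T -> R) : continuous f -> continuous (fun t => rc (f t) : C).
Proof.
move=> /continuousP_real cf; apply/continuousP_cn => t e e0.
by apply: filterS (cf t e e0) => s; rewrite -rcB cn_rc.
Qed.

Lemma continuous_sum_real n (f : 'I_n -> T -> R) : (forall i, continuous (f i)) ->
  continuous (fun t => \sum_i f i t).
Proof.
elim: n f => [|n IH] f cf.
  by under eq_fun do rewrite big_ord0; move=> t; exact: cvg_cst.
under eq_fun do rewrite big_ord_recl.
by move=> t; apply: cvgD; [exact: cf|apply: IH => i; exact: cf].
Qed.
End RealContinuity.

Section Group.
Context {R : realType} {G : topGroupType}.
Hypothesis hausdorff_G : hausdorff_space G.
Hypothesis compact_G : compact [set: G].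

Lemma bump (g : G) (U : set G) : nbhs g U -> exists b : G -> R,
  [/\ continuous b, forall t, 0 <= b t <= 1, b g = 1 & forall t, ~ U t -> b t = 0].
Proof.
move=> gU; have nG := compact_normal hausdorff_G compact_G.
have : uniform_separator [set g] (~` U°).
  apply: (@normal_completely_regular R G nG (hausdorff_accessible hausdorff_G)).
    exact/open_closedC/open_interior.
  by move=> /(_ gU).
move=> /(@uniform_separatorP G R)[v [cv v01 v0 v1]].
exists (fun t => 1 - v t); split.
- apply: (continuous_lip (K := 1) (h := fun x => 1 - x)) => // x y.
  by rewrite mul1r opprB addrC addrA subrK distrC.
- move=> t; have : `[(0 : R), 1]%classic (v t) by apply: v01; exists t.
  by rewrite /= in_itv /=; lra.
- have -> : v g = 0 by apply: v0; exists g.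
  by rewrite subr0.
move=> t Ut; have -> : v t = 1; last by rewrite subrr.
by apply: v1; exists t => // /interior_subset.
Qed.

Lemma partition_of_unity (U : G -> set G) : (forall g, nbhs g (U g)) ->
  exists (n : nat) (p : 'I_n -> G) (f f' : 'I_n -> G -> R),
  [/\ forall i, continuous (f i) /\ continuous (f' i),
      forall i t, 0 <= f i t /\ 0 <= f' i t <= 1,
      forall t, \sum_i f i t = 1,
      forall i t, f' i t * f i t = f i t &
      forall i t, ~ U (p i) t -> f i t = 0 /\ f' i t = 0].
Proof.
move=> HU; have /choice[b Hb] := fun g => bump (HU g).
have [g|s Hs] := finite_subcover compact_G (U := fun g => [set t | 1 / 2 < b g t]).
  have [cb _ b1 _] := Hb g; have /(_ g (1 / 4)) := iffLR (continuousP_real (b g)) cb.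
  by rewrite divr_gt0 // => /(_ erefl); apply: filterS => t; rewrite /= b1 ler_norml; lra.
pose n := size s; pose p (i : 'I_n) := nth 1%g s i.
(* The cut at [1 / 2] makes room for [f']: [min (2 b) 1] equals 1 wherever [h] is nonzero and still
   vanishes where [b] does. *)
pose h i t : R := Num.max (b (p i) t - 1 / 2) 0.
have ch i : continuous (h i).
  have [cb _ _ _] := Hb (p i).
  apply: (continuous_lip (K := 1) (h := fun x => Num.max (x - 1 / 2) 0)) cb => // x y.
  by rewrite mul1r /Num.max; do 2 case: ltP => ?; rewrite ?subr0 ?sub0r ?normrN ?normr0 //;
    rewrite ler_norml; have := ler_norm (x - y); have := ler_norm (y - x); rewrite (distrC y); lra.
have h0 i t : 0 <= h i t by rewrite /h le_max lexx orbT.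
pose S t := \sum_i h i t.
have cS : continuous S by exact: continuous_sum_real.
have S0 t : 0 < S t.
  have [g gs bg] := Hs t; have gn : (index g s < n)%N by rewrite index_mem.
  rewrite /S (bigD1 (Ordinal gn)) //= ltr_wpDr ?sumr_ge0 //.
  by rewrite /h /p /= nth_index // lt_max subr_gt0 bg.
exists n, p, (fun i t => h i t / S t), (fun i t => Num.min (2 * b (p i) t) 1).
have [cb b01 _ bU] : [/\ forall i, continuous (b (p i)), forall i t, 0 <= b (p i) t <= 1, True &
   forall i t, ~ U (p i) t -> b (p i) t = 0].
  by split=> // i; case: (Hb (p i)).
split.
- move=> i; split; last first.
    apply: (continuous_lip (K := 2) (h := fun x => Num.min (2 * x) 1)) (cb i) => // x y.
    rewrite /Num.min; do 2 case: ltP => ?; rewrite ?subrr ?normr0 //;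
    rewrite ?ler_norml; have := ler_norm (x - y); have := ler_norm (y - x); rewrite (distrC y); have := normr_ge0 (x - y); lra.
  move=> t; apply: cvgM; first exact: ch.
  by apply: cvgV; [rewrite gt_eqF|exact: cS].
- move=> i t; split; first by rewrite divr_ge0 ?h0 // ltW.
  by rewrite le_min ge_min lexx orbT ler01 !andbT mulr_ge0 //; case/andP: (b01 i t).
- by move=> t; rewrite -mulr_suml -/(S t) divff // gt_eqF.
- move=> i t; have [bl|bg] := leP (b (p i) t) (1 / 2).
    have -> : h i t = 0 by rewrite /h; apply/max_idPr; rewrite subr_le0.
    by rewrite !mul0r mulr0.
  by rewrite (min_idPr _) ?mul1r //; lra.
- move=> i t /bU; rewrite /h => ->; rewrite mulr0; split; last by apply/min_idPl.
  by rewrite (max_idPr _) ?mul0r //; lra.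
Qed.

Lemma dense_seq : @second_countable G ->
  exists q : nat -> G, forall (g : G) (U : set G), nbhs g U -> exists n, U (q n).
Proof.
move=> [B /countable_injP[f finj] [Bo Bb]].
exists (fun n => xget 1%g [set g | exists2 V, B V /\ f V = n & V g]) => g U gU.
have [V [BV Vg] VU] := Bb g U gU; exists (f V).
case: xgetP => [y _ [V' [BV' fV']] V'y|/(_ g) H]; last by exfalso; apply: H; exists V.
apply: VU; have <- // : V' = V by apply: finj; rewrite ?inE.
Qed.

Variable A : cstarAlgType R.
Variable alpha : cstar_action G A.
Local Notation C := (Cplx R).

Section Generated.
Variables (q : nat -> G) (x : nat -> A).

Definition qc (p r : rat) : C := rc (ratr p) + iu * rc (ratr r).

(** The outer [option] is that of [unpickle]; a tag that decodes to nothing acts as [star], which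
    adds no new elements. *)
Definition term_op (o : option (option (nat + rat * rat))) (y : A) : A :=
  match o with
  | Some (Some (inl k)) => alpha (q k) y
  | Some (Some (inr (p, r))) => qc p r *: y
  | _ => star y
  end.

(* The elements of the *-algebra over Q[i] that is generated by the [x i] and closed
   under the [alpha (q k)], indexed by countably many terms. *)
Fixpoint term_val (t : GenTree.tree nat) : A :=
  match t with
  | GenTree.Leaf i => x i
  | GenTree.Node n [:: t1; t2] =>
      if n == 0%N then term_val t1 + term_val t2 else term_val t1 ** term_val t2
  | GenTree.Node n [:: t1] =>
      term_op (unpickle n) (term_val t1)
  | _ => 0
  end.

Lemma range_term_op o t : range term_val (term_op (Some o) (term_val t)).
Proof.
exists (GenTree.Node (pickle o) [:: t]) => //; rewrite -(pickleK o).
by [].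
Qed.

Definition gen_alg : set A := closure (range term_val).

Lemma qc_dense (z : C) (e : R) : 0 < e -> exists p r, cn (z - qc p r) <= e.
Proof.
move=> e0; have e2 : 0 < e / 2 by rewrite divr_gt0.
have H (y : R) : exists p : rat, `|y - ratr p| <= e / 2.
  have [|p] := @rat_in_itvoo R (y - e / 2) (y + e / 2); first by lra.
  by rewrite in_itv /= => /andP[? ?]; exists p; rewrite ler_norml; lra.
have [p Hp] := H (complex.Re z); have [r Hr] := H (complex.Im z).
exists p, r; have -> : z = rc (complex.Re z) + iu * rc (complex.Im z).
  by rewrite {1}(complexE z) complexiE.
rewrite /qc; have -> : forall a b c d : C, a + iu * b - (c + iu * d) = (a - c) + iu * (b - d).
  by move=> *; ring.
apply: le_trans (cnD _ _) _; rewrite cnM cn_iu mul1r -!rcB !cn_rc; lra.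
Qed.

Lemma gen_alg_sub i : gen_alg (x i).
Proof. by apply: subset_closure; exists (GenTree.Leaf i). Qed.

Lemma gen_alg_separable : separable_set gen_alg.
Proof.
exists (range term_val); split=> //; last exact: subset_closure.
exact: sub_countable (card_image_le _ _) (countableP _).
Qed.

Lemma gen_alg_cstar : cstar_subalgebra gen_alg.
Proof.
have half (e : R) : 0 < e -> 0 < e / 2 by move=> ?; rewrite divr_gt0.
split.
- exact: closed_closure.
- by apply: subset_closure; exists (GenTree.Node 0 [::]).
- move=> a b /closureP Ha /closureP Hb; apply/closureP => e /half e0.
  have [_ [s _ <-] sa] := Ha _ e0; have [_ [t _ <-] tb] := Hb _ e0.
  exists (term_val s + term_val t); first by exists (GenTree.Node 0 [:: s; t]).
  have -> : term_val s + term_val t - (a + b) = (term_val s - a) + (term_val t - b).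
    by lmod_ring.
  by apply: le_trans (nrmD _ _) _; lra.
- move=> z a /closureP Ha; apply/closureP => e /half e0.
  have K0 : 0 < cn z + 1 by rewrite ltr_wpDl ?cn_ge0.
  have [_ [s _ <-] sa] := Ha _ (divr_gt0 e0 K0).
  have L0 : 0 < nrm (term_val s) + 1 by rewrite ltr_wpDl ?nrm_ge0.
  have [p [r Hz]] := qc_dense z (divr_gt0 e0 L0).
  exists (qc p r *: term_val s).
    exact: (range_term_op (Some (inr (p, r)))).
  have -> : qc p r *: term_val s - z *: a = z *: (term_val s - a) - (z - qc p r) *: term_val s.
    by lmod_ring.
  apply: le_trans (nrmB _ _) _; rewrite !nrmZ.
  have h1 : cn z * nrm (term_val s - a) <= e / 2.
    apply: le_trans (_ : (cn z + 1) * nrm (term_val s - a) <= _).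
      by rewrite ler_wpM2r ?nrm_ge0 // lerDl.
    by rewrite mulrC -ler_pdivlMr.
  have h2 : cn (z - qc p r) * nrm (term_val s) <= e / 2.
    apply: le_trans (_ : cn (z - qc p r) * (nrm (term_val s) + 1) <= _).
      by rewrite ler_wpM2l ?cn_ge0 // lerDl.
    by rewrite -ler_pdivlMr.
  by lra.
- move=> a b /closureP Ha /closureP Hb.
  have /choice[s Hs] n : exists s, nrm (term_val s - a) <= n.+1%:R^-1.
    by have [|_ [s _ <-]] := Ha n.+1%:R^-1; [rewrite invr_gt0|exists s].
  have /choice[t Ht] n : exists s, nrm (term_val s - b) <= n.+1%:R^-1.
    by have [|_ [t _ <-]] := Hb n.+1%:R^-1; [rewrite invr_gt0|exists t].
  have cv (u : nat -> A) c : (forall n, nrm (u n - c) <= n.+1%:R^-1) -> u @ \oo --> c.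
    move=> H; apply/cvg_seqP => e e0; exists (Num.truncn e^-1) => n Nn.
    apply: le_trans (H n) _; rewrite invf_ple ?posrE //; apply/ltW/(lt_le_trans (truncnS_gt _)).
    by rewrite ler_nat ltnS.
  have /cvg_seqP H := cmul_cvg (cv _ _ Hs) (cv _ _ Ht).
  apply/closureP => e /H[N /(_ N (leqnn _)) HN]; exists (term_val (s N) ** term_val (t N)) => //.
  by exists (GenTree.Node 1 [:: s N; t N]).
- move=> a /closureP Ha; apply/closureP => e /Ha[_ [s _ <-] sa].
  exists (star (term_val s)); last by rewrite -starB nrm_star.
  exact: (range_term_op None).
Qed.

Hypothesis dense_q : forall (g : G) (U : set G), nbhs g U -> exists n, U (q n).

Lemma gen_alg_invariant : invariant_set alpha gen_alg.
Proof.
move=> g a /closureP Ha; apply/closureP => e e0.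
have e2 : 0 < e / 2 by rewrite divr_gt0.
have [_ [s _ <-] sa] := Ha _ e2.
have [k Hk] := dense_q (act_near alpha (term_val s) g e2).
exists (alpha (q k) (term_val s)).
  exact: (range_term_op (Some (inl k))).
apply: le_trans (nrm_tri (alpha g (term_val s)) _ _) _.
by rewrite -actB act_nrm; move: Hk => /=; lra.
Qed.
End Generated.

Lemma separable_hull (x : nat -> A) : @second_countable G ->
  exists D : set A, [/\ cstar_subalgebra D, separable_set D, invariant_set alpha D &
    forall i, D (x i)].
Proof.
move=> /dense_seq[q Hq]; exists (gen_alg q x); split.
- exact: gen_alg_cstar.
- exact: gen_alg_separable.
- exact: gen_alg_invariant.
- exact: gen_alg_sub.
Qed.

End Group.

(** * Functions with values in the sequence algebra *)

Section Limsup.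
Context {R : realType} {A : cstarAlgType R}.
Local Notation C := (Cplx R).
Implicit Types (y z : nat -> A) (M : R).

(** Bounds by [M] the norm of the class of [y] in the sequence algebra; representatives are used in
    place of classes throughout. *)
Definition limsup_le y M : Prop :=
  forall e : R, 0 < e -> exists N, forall n, (N <= n)%N -> nrm (y n) <= M + e.

Definition null_seq y : Prop := limsup_le y 0.
Definition eq_mod_null y z : Prop := null_seq (fun n => y n - z n).
Definition bdd y : Prop := exists2 K : R, 0 <= K & forall n, nrm (y n) <= K.

Lemma null_seq_c0 y : null_seq y <-> c0 y.
Proof.
rewrite /c0 /= cvg_seqP; split=> H e /H[N HN]; exists N => n /HN.
  by rewrite add0r subr0.
by rewrite add0r subr0.
Qed.

Lemma limsup_le_le y M M' : M <= M' -> limsup_le y M -> limsup_le y M'.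
Proof.
move=> MM' H e /H[N HN]; exists N => n /HN h.
by apply: le_trans h _; rewrite lerD2r.
Qed.

Lemma limsup_le_ext y z M : (forall n, y n = z n) -> limsup_le y M -> limsup_le z M.
Proof. by move=> /funext ->. Qed.

Lemma limsup_le_bound y M : (forall n, nrm (y n) <= M) -> limsup_le y M.
Proof. by move=> H e e0; exists 0%N => n _; rewrite (le_trans (H n)) // lerDl ltW. Qed.

Lemma limsup_leD y z M M' : limsup_le y M -> limsup_le z M' -> limsup_le (fun n => y n + z n) (M + M').
Proof.
move=> Hy Hz e e0; have e2 : 0 < e / 2 by rewrite divr_gt0.
have [N HN] := Hy _ e2; have [N' HN'] := Hz _ e2; exists (maxn N N') => n.
rewrite geq_max => /andP[/HN h /HN' h']; apply: le_trans (nrmD _ _) _; lra.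
Qed.

Lemma limsup_leN y M : limsup_le y M -> limsup_le (fun n => - y n) M.
Proof. by move=> H e /H[N HN]; exists N => n; rewrite nrmN; exact: HN. Qed.

Lemma limsup_leB y z M M' : limsup_le y M -> limsup_le z M' -> limsup_le (fun n => y n - z n) (M + M').
Proof. by move=> Hy /limsup_leN; exact: limsup_leD. Qed.

Lemma limsup_le_sum k (y : 'I_k -> nat -> A) (M : 'I_k -> R) :
  (forall i, limsup_le (y i) (M i)) -> limsup_le (fun n => \sum_i y i n) (\sum_i M i).
Proof.
elim: k y M => [|k IH] y M H.
  by rewrite big_ord0; apply: limsup_le_bound => n; rewrite big_ord0 nrm0.
rewrite big_ord_recl; apply: (limsup_le_ext (y := fun n => y ord0 n + \sum_i y (lift ord0 i) n)).
  by move=> n; rewrite big_ord_recl.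
exact: limsup_leD (H _) (IH _ _ (fun i => H _)).
Qed.

Lemma limsup_leZ (c : C) y M : limsup_le y M -> limsup_le (fun n => c *: y n) (cn c * M).
Proof.
move=> H e e0; have K0 : 0 < cn c + 1 by rewrite ltr_wpDl ?cn_ge0.
have [N HN] := H _ (divr_gt0 e0 K0); exists N => n /HN h; rewrite nrmZ.
apply: le_trans (ler_wpM2l (cn_ge0 c) h) _; rewrite mulrDr lerD2l.
by rewrite mulrA ler_pdivrMr // mulrC ler_pM2l // lerDl.
Qed.

Lemma limsup_leM y z M M' : 0 <= M -> 0 <= M' -> limsup_le y M -> limsup_le z M' ->
  limsup_le (fun n => y n ** z n) (M * M').
Proof.
move=> M0 M'0 Hy Hz e e0; pose K := M + M' + 1.
have K0 : 0 < K by rewrite ltr_wpDl // addr_ge0.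
pose d := Num.min 1 (e / K).
have d0 : 0 < d by rewrite lt_min ltr01 divr_gt0.
have [N HN] := Hy _ d0; have [N' HN'] := Hz _ d0; exists (maxn N N') => n.
rewrite geq_max => /andP[/HN h /HN' h']; apply: le_trans (nrmM _ _) _.
apply: le_trans (ler_pM (nrm_ge0 _) (nrm_ge0 _) h h') _.
have dK : d * K <= e by rewrite -ler_pdivlMr // ge_min lexx orbT.
have d1 : d <= 1 by rewrite ge_min lexx.
have : d * d <= d by rewrite ler_piMl // ltW.
by rewrite /K in dK; nra.
Qed.

Lemma bdd_lims y : bdd y -> exists2 K, 0 <= K & limsup_le y K.
Proof. by case=> K K0 /limsup_le_bound; exists K. Qed.

Lemma limsup_le_bdd y M : limsup_le y M -> bdd y.
Proof.
move=> /(_ 1 ltr01)[N HN].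
have S0 : 0 <= \sum_(i < N) nrm (y i) by apply: sumr_ge0 => i _; exact: nrm_ge0.
exists (`|M + 1| + \sum_(i < N) nrm (y i)); first by rewrite addr_ge0.
move=> n; have [nN|/HN h] := ltnP n N.
  rewrite (bigD1 (Ordinal nN)) //= addrCA lerDl addr_ge0 ?sumr_ge0 // => i _.
  exact: nrm_ge0.
by apply: le_trans h _; rewrite (le_trans (ler_norm _)) // lerDl.
Qed.

Lemma bdd_cst x : bdd (fun=> x).
Proof. by exists (nrm x) => //; exact: nrm_ge0. Qed.
Lemma bddM y z : bdd y -> bdd z -> bdd (fun n => y n ** z n).
Proof.
case=> K K0 HK [L L0 HL]; exists (K * L); first exact: mulr_ge0.
by move=> n; apply: le_trans (nrmM _ _) (ler_pM _ _ _ _); rewrite ?nrm_ge0.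
Qed.
Lemma bddD y z : bdd y -> bdd z -> bdd (fun n => y n + z n).
Proof.
case=> K K0 HK [L L0 HL]; exists (K + L); first exact: addr_ge0.
by move=> n; apply: le_trans (nrmD _ _) (lerD _ _).
Qed.

Lemma nul0 : null_seq (fun=> 0).
Proof. by apply: limsup_le_bound => n; rewrite nrm0. Qed.
Lemma null_seqD y z : null_seq y -> null_seq z -> null_seq (fun n => y n + z n).
Proof. by move=> Hy Hz; have := limsup_leD Hy Hz; rewrite addr0. Qed.
Lemma null_seqB y z : null_seq y -> null_seq z -> null_seq (fun n => y n - z n).
Proof. by move=> Hy Hz; have := limsup_leB Hy Hz; rewrite addr0. Qed.
Lemma null_seqZ (c : C) y : null_seq y -> null_seq (fun n => c *: y n).
Proof. by move=> /(limsup_leZ c); rewrite mulr0. Qed.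
Lemma null_seqMl y z : bdd y -> null_seq z -> null_seq (fun n => y n ** z n).
Proof. by move=> /bdd_lims[K K0 HK] Hz; have := limsup_leM K0 (lexx 0) HK Hz; rewrite mulr0. Qed.
Lemma null_seqMr y z : null_seq y -> bdd z -> null_seq (fun n => y n ** z n).
Proof. by move=> Hy /bdd_lims[K K0 HK]; have := limsup_leM (lexx 0) K0 Hy HK; rewrite mul0r. Qed.
Lemma null_seqS y : null_seq y -> null_seq (fun n => star (y n)).
Proof. by move=> H e /H[N HN]; exists N => n; rewrite nrm_star; exact: HN. Qed.
Lemma null_seq_ext y z : (forall n, y n = z n) -> null_seq y -> null_seq z.
Proof. exact: limsup_le_ext. Qed.

Lemma eq_mod_null_refl y : eq_mod_null y y.
Proof. by apply: null_seq_ext nul0 => n; rewrite subrr. Qed.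
Lemma eq_mod_null_sym y z : eq_mod_null y z -> eq_mod_null z y.
Proof. by move=> /limsup_leN; apply: limsup_le_ext => n; rewrite opprB. Qed.
Lemma eq_mod_null_trans z y x : eq_mod_null y z -> eq_mod_null z x -> eq_mod_null y x.
Proof.
by move=> yz zx; apply: null_seq_ext (null_seqD yz zx) => n; rewrite addrA subrK.
Qed.
Lemma eq_mod_null_limsup y z M : eq_mod_null y z -> limsup_le z M -> limsup_le y M.
Proof.
move=> /limsup_leD yz /yz; rewrite add0r; apply: limsup_le_ext => n; by rewrite subrK.
Qed.
Lemma eq_mod_null_bdd y z : eq_mod_null y z -> bdd z -> bdd y.
Proof. by move=> yz /bdd_lims[K _ /(eq_mod_null_limsup yz)/limsup_le_bdd]. Qed.
Lemma eq_mod_null_sum k (y z : 'I_k -> nat -> A) : (forall i, eq_mod_null (y i) (z i)) ->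
  eq_mod_null (fun n => \sum_i y i n) (fun n => \sum_i z i n).
Proof.
move=> H; have := limsup_le_sum (M := fun=> 0) H; rewrite big1 //; apply: limsup_le_ext => n.
by rewrite -sumrB.
Qed.
Lemma eq_mod_nullM y y' z z' : bdd y' -> bdd z -> eq_mod_null y y' -> eq_mod_null z z' ->
  eq_mod_null (fun n => y n ** z n) (fun n => y' n ** z' n).
Proof.
move=> By' Bz Hy Hz; apply: null_seq_ext (null_seqD (null_seqMr Hy Bz) (null_seqMl By' Hz)) => n.
by rewrite cmulBl cmulBr; lmod_ring.
Qed.

Lemma linfty_bdd y : linfty y <-> bdd y.
Proof.
split=> [[M HM]|[K _ HK]]; last by exists (rc K) => n; rewrite nrmE rc_le.
exists `|complex.Re M| => // n; have := HM n.
have M0 : 0 <= M := le_trans (normr_ge0 _) (HM 0%N).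
by rewrite nrmE (rc_Re M0) rc_le => /le_trans; apply; exact: ler_norm.
Qed.

End Limsup.

(** * From [C(G, D)] to sequences in [A] *)

Section Rokhlin.
Context {R : realType} {G : topGroupType} {A : cstarAlgType R}.
Variable alpha : cstar_action G A.
Hypothesis hausdorff_G : hausdorff_space G.
Hypothesis compact_G : compact [set: G].
Local Notation C := (Cplx R).
Variables (u : nat -> A) (D : set A) (phi : (G -> C) -> set (nat -> A)).
Hypothesis fau : fixed_approx_unit alpha u.
Hypothesis subalg_D : cstar_subalgebra D.
Hypothesis inv_D : invariant_set alpha D.
Hypothesis hphi : equivariant_unital_hom alpha D phi.

Definition equicont (y : nat -> A) : Prop := forall (g : G) (e : R), 0 < e ->
  \forall h \near g, forall n, nrm (alpha h (y n) - alpha g (y n)) <= e.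

Lemma phi_class f : continuous f -> exists a, [/\ commutant D a, bdd a, equicont a & phi f = Fclass D a].
Proof.
move=> cf; have [a [ca [_ ea]] <-] := hom_range hphi cf; exists a; split=> //.
  by apply/linfty_bdd; case: ca.
move=> g e e0; have := ea g (rc e); rewrite -rc0 rc_lt => /(_ e0).
by apply: filterS => h H n; rewrite -rc_le -nrmE; exact: H.
Qed.

Lemma phi_ex f : continuous f -> exists a, [/\ phi f a, bdd a & equicont a].
Proof.
move=> /phi_class[a [ca ba ea E]]; exists a; split=> //; rewrite E; split=> //; split.
  by apply/linfty_bdd; apply: eq_mod_null_bdd (bdd_cst (0 : A)); apply: null_seq_ext nul0 => n; rewrite subrr subr0.
by move=> d _; split; apply/null_seq_c0; apply: null_seq_ext nul0 => n; rewrite subrr ?cmul0l ?cmul0r.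
Qed.

Lemma phi_bdd f a : continuous f -> phi f a -> bdd a.
Proof. by move=> /phi_class[b [_ _ _ ->]] [[/linfty_bdd]]. Qed.

Lemma phi_comm f a d : continuous f -> phi f a -> D d ->
  eq_mod_null (fun n => a n ** d) (fun n => d ** a n).
Proof. by move=> /phi_class[b [_ _ _ ->]] [[_ H] _] /H/null_seq_c0. Qed.

(** Two representatives of a class differ by an annihilator of [D], so only their products with
    elements of [D] agree modulo null sequences. *)
Lemma phi_uniq f a b d : continuous f -> phi f a -> phi f b -> D d ->
  eq_mod_null (fun n => a n ** d) (fun n => b n ** d).
Proof.
move=> /phi_class[c [_ _ _ ->]] [_ [_ ac]] [_ [_ bc]] Dd.
have /null_seq_c0 h1 := (ac _ Dd).1; have /null_seq_c0 h2 := (bc _ Dd).1.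
by apply: null_seq_ext (null_seqB h1 h2) => n; rewrite !cmulBl; lmod_ring.
Qed.

Lemma continuous_cst_C (z : C) : continuous ((fun=> z) : G -> C).
Proof. by move=> t; exact: cvg_cst. Qed.
Lemma continuousD_C (f h : G -> C) : continuous f -> continuous h ->
  continuous (fun s => f s + h s).
Proof. by move=> cf ch t; apply: (@cvgD C C^o); [exact: cf|exact: ch]. Qed.
Lemma continuousM_C (f h : G -> C) : continuous f -> continuous h ->
  continuous (fun s => f s * h s).
Proof. by move=> cf ch t; apply: cvgM; [exact: cf|exact: ch]. Qed.
Lemma continuousZ_C (z : C) (f : G -> C) : continuous f -> continuous (fun s => z * f s).
Proof. by move=> cf; exact: (@continuousM_C (fun=> z) f (@continuous_cst_C z) cf). Qed.
Lemma continuous_conj (f : G -> C) : continuous f -> continuous (fun s => (f s)^*).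
Proof.
move=> /continuousP_cn cf; apply/continuousP_cn => t e e0.
by apply: filterS (cf t e e0) => s; rewrite -rmorphB cn_conj.
Qed.
Lemma continuous_cn (f : G -> C) : continuous f -> continuous (fun s => cn (f s)).
Proof.
move=> /continuousP_cn cf; apply/continuousP_real => t e e0.
apply: filterS (cf t e e0) => s; apply: le_trans; rewrite ler_norml.
have := cnD (f s - f t) (f t); have := cnD (f t - f s) (f s).
by rewrite !subrK -(cnN (f t - f s)) opprB; lra.
Qed.
Lemma mulg_left_continuous (g : G) : continuous (fun s : G => g * s)%g.
Proof.
move=> t U HU; have [[P Q] /= [gP tQ] PQ] := @mulg_continuous G (g, t) U HU.
apply: filterS tQ => s Qs; apply: (PQ (g, s)); split => //=; exact: nbhs_singleton gP.
Qed.
Lemma continuous_Lt g (f : G -> C) : continuous f -> continuous (Lt g f).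
Proof.
move=> cf t; apply: (cvg_comp (fun s => g^-1 * s)%g f); last exact: cf.
exact: mulg_left_continuous.
Qed.

(** [hom_unit] speaks of classes in [Falpha]. The approximate unit [u] supplies one, its entries
    being fixed by [alpha], and [u n ** d] tends to [d]. *)
Lemma phi_unit e d : phi (fun=> 1) e -> D d -> eq_mod_null (fun n => e n ** d) (fun=> d).
Proof.
move=> phie Dd; have be := phi_bdd (@continuous_cst_C 1) phie.
have [fu u1 ul ur] := fau.
have bu : bdd u by exists 1.
have ud : eq_mod_null (fun n => u n ** d) (fun=> d).
  by move=> eps e0; have /cvg_seqP/(_ _ e0)[N HN] := ul d; exists N => n /HN; rewrite add0r.
have du : eq_mod_null (fun n => d ** u n) (fun=> d).
  by move=> eps e0; have /cvg_seqP/(_ _ e0)[N HN] := ur d; exists N => n /HN; rewrite add0r.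
have cu : commutant D u.
  split=> [|d' _]; first exact/linfty_bdd.
  apply/null_seq_c0 => eps e0.
  have e2 : 0 < eps / 2 by rewrite divr_gt0.
  have /cvg_seqP/(_ _ e2)[N HN] := ul d'; have /cvg_seqP/(_ _ e2)[N' HN'] := ur d'.
  exists (maxn N N') => n; rewrite geq_max => /andP[/HN h /HN' h'].
  by apply: le_trans (nrm_tri d' _ _) _; rewrite [X in _ + X]nrmC; lra.
have Fu : Falpha alpha D (Fclass D u).
  exists u => //; split=> //; split; first by case: cu.
  move=> g eps e0; near=> h => n; rewrite /act_seq !(fu n) subrr normr0; exact: ltW.
have [E _] := hom_unit hphi phie Fu cu.
have uu : Fclass D u u.
  split=> //; split.
    by apply/linfty_bdd; apply: eq_mod_null_bdd (bdd_cst (0 : A)); apply: null_seq_ext nul0 => n; rewrite subrr subr0.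
  by move=> d' _; split; apply/null_seq_c0; apply: null_seq_ext nul0 => n; rewrite subrr ?cmul0l ?cmul0r.
move: uu; rewrite -E => -[_ [_ /(_ d Dd)[/null_seq_c0 H _]]].
apply: (@eq_mod_null_trans _ _ (fun n => e n ** (u n ** d))).
  by apply: eq_mod_nullM; [|exact: bdd_cst|exact: eq_mod_null_refl|exact: eq_mod_null_sym].
apply: (@eq_mod_null_trans _ _ (fun n => u n ** d)) => //.
apply: eq_mod_null_sym; apply: null_seq_ext H => n; by rewrite cmulBl cmulA.
Unshelve. all: by end_near.
Qed.

(* A real function bounded by 1 is the real part of a unitary of C(G). *)
Lemma phi_contr_real (f : G -> R) a d : continuous f -> (forall s, `|f s| <= 1) ->
  phi (fun s => rc (f s)) a -> D d -> limsup_le (fun n => a n ** d) (nrm d).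
Proof.
move=> cf f1 phia Dd.
pose g s := Num.sqrt (1 - f s ^+ 2).
have cg : continuous g.
  move=> t; apply: (cvg_comp (fun s => 1 - f s ^+ 2) Num.sqrt); last exact: sqrt_continuous.
  apply: cvgB; first exact: cvg_cst.
  by rewrite expr2; apply: cvgM; exact: cf.
pose w s : C := rc (f s) + iu * rc (g s).
have cw : continuous w.
  apply: continuousD_C; first exact: continuous_rc.
  by apply: continuousZ_C; exact: continuous_rc.
have [b [phib bb _]] := phi_ex cw.
(* By the C*-identity, as [star (b' n) ** b' n ** d] tends to [d]. *)
have unit (b' : nat -> A) w' : continuous w' -> (forall s, (w' s)^* * w' s = 1) -> phi w' b' ->
    limsup_le (fun n => b' n ** d) (nrm d).
  move=> cw' ww phib' e e0.
  have := homM hphi (continuous_conj cw') cw' (homS hphi cw' phib') phib'.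
  rewrite (_ : (fun s => _) = fun=> 1); last exact/funext.
  move=> /phi_unit /(_ Dd) H.
  have H2 := null_seqMl (bdd_cst (star d)) H.
  have e2 : 0 < e ^+ 2 by rewrite exprn_gt0.
  have [N HN] := H2 _ e2; exists N => n /HN h.
  have de : 0 <= nrm d + e by rewrite addr_ge0 ?nrm_ge0 // ltW.
  apply: nrm_sa_pow_le => //; rewrite -nrm_sqr starM.
  have -> : star d ** star (b' n) ** (b' n ** d) =
     star d ** d + star d ** (star (b' n) ** b' n ** d - d) by rewrite cmulBr !cmulA; lmod_ring.
  apply: le_trans (nrmD _ _) _; rewrite nrm_sqr; rewrite add0r in h.
  by have := nrm_ge0 d; nra.
have fg s : f s ^+ 2 + g s ^+ 2 = 1.
  rewrite /g sqr_sqrtr ?subrKC ?subr_ge0 //; last first.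
    by have := f1 s; rewrite -real_normK ?num_real // expr_le1 ?normr_ge0.
have wE s : (w s)^* = rc (f s) - iu * rc (g s).
  by rewrite /w rmorphD rmorphM /= !conj_rc conj_iu mulNr.
have ww s : (w s)^* * w s = 1.
  have := fg s; move/(canRL (addrK _))/(congr1 (@rc R)); rewrite rcB !rcX rc1 => H.
  have I2 : iu * iu = -1 :> C := iu2.
  by rewrite wE /w; ring: H I2.
have H1 := unit b w cw ww phib.
have H2 : limsup_le (fun n => star (b n) ** d) (nrm d).
  apply: (unit _ (fun s => (w s)^*)); last exact: (homS hphi cw phib).
    exact: continuous_conj.
  by move=> s; rewrite conjCK mulrC ww.
have phiS := homS hphi cw phib.
have phi2 := homZ hphi (rc 2^-1) (continuousD_C cw (continuous_conj cw)) (homD hphi cw (continuous_conj cw) phib phiS).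
have E : (fun s => rc 2^-1 * (w s + (w s)^*)) = (fun s => rc (f s)).
  apply/funext => s; rewrite wE /w.
  have -> : rc (f s) + iu * rc (g s) + (rc (f s) - iu * rc (g s)) = rc 2 * rc (f s).
    by rewrite (_ : rc 2 = 1 + 1) ?rc_nat //; ring.
  by rewrite mulrA -rcM mulVf ?mul1r // pnatr_eq0.
rewrite E in phi2.
have := limsup_leZ (rc 2^-1) (limsup_leD H1 H2); rewrite cn_rc ger0_norm ?invr_ge0 //.
have -> : 2^-1 * (nrm d + nrm d) = nrm d by lra.
move=> H3; apply: eq_mod_null_limsup (phi_uniq (continuous_rc cf) phia phi2 Dd) _.
by apply: limsup_le_ext H3 => n; rewrite cmulZl cmulDl.
Qed.

(** The C*-identity reduces this to the real function [(cn f / K) ^ 2], bounded by 1. A constant [K]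
    above [M] is used because [M] may vanish. *)
Lemma phi_contr (f : G -> C) (M : R) a d : 0 <= M -> continuous f -> (forall s, cn (f s) <= M) ->
  phi f a -> D d -> limsup_le (fun n => a n ** d) (M * nrm d).
Proof.
move=> M0 cf fM phia Dd.
have scale (K : R) : 0 < K -> M <= K -> limsup_le (fun n => a n ** d) (K * nrm d).
  move=> K0 MK; pose h s := (K^-1 * cn (f s)) ^+ 2.
  have ch : continuous h.
    have c1 : continuous (fun s => K^-1 * cn (f s)).
      by move=> t; apply: cvgM; [exact: cvg_cst|exact: continuous_cn].
    by rewrite /h => t; under eq_fun do rewrite expr2; apply: cvgM; exact: c1.
  have h1 s : `|h s| <= 1.
    rewrite ger0_norm ?exprn_ge0 ?mulr_ge0 ?invr_ge0 ?cn_ge0 ?(ltW K0) //.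
    rewrite expr_le1 ?mulr_ge0 ?invr_ge0 ?cn_ge0 ?(ltW K0) //.
    by rewrite ler_pdivrMl // mulr1 (le_trans (fM s)).
  have := homZ hphi (rc (K ^- 2)) (continuousM_C (continuous_conj cf) cf)
    (homM hphi (continuous_conj cf) cf (homS hphi cf phia) phia).
  rewrite (_ : (fun s => _) = (fun s => rc (h s))); last first.
    by apply/funext => s; rewrite cn_sqr -rcM /h exprMn exprVn.
  move=> /(phi_contr_real ch h1) /(_ Dd) H e e0.
  (* Makes [K ^ 2 * nrm d * c] at most [e ^ 2], an excess that the square of [K * nrm d + e]
     covers. *)
  pose c := e ^+ 2 / (K ^+ 2 * (nrm d + 1)).
  have d1 : 0 < nrm d + 1 by rewrite ltr_wpDl ?nrm_ge0.
  have c0 : 0 < c by rewrite divr_gt0 ?mulr_gt0 ?exprn_gt0.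
  have [N HN] := H _ c0; exists N => n /HN h'.
  apply: nrm_sa_pow_le; first by rewrite addr_ge0 ?mulr_ge0 ?nrm_ge0 // ltW.
  rewrite -nrm_sqr starM.
  have -> : star d ** star (a n) ** (a n ** d) =
    rc (K ^+ 2) *: (star d ** ((rc (K ^- 2) *: (star (a n) ** a n)) ** d)).
    rewrite cmulZl cmulZr scalerA -rcM mulfV ?expf_neq0 ?gt_eqF // rc1 scale1r.
    by rewrite !cmulA.
  rewrite nrmZr ?exprn_ge0 ?(ltW K0) //.
  apply: le_trans (ler_wpM2l _ (le_trans (nrmM _ _) (ler_wpM2l (nrm_ge0 _) h'))) _.
    by rewrite exprn_ge0 // ltW.
  rewrite nrm_star.
  have cE : c * (K ^+ 2 * (nrm d + 1)) = e ^+ 2 by rewrite /c divfK // gt_eqF ?mulr_gt0 ?exprn_gt0.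
  have cK : 0 <= c * K ^+ 2 by rewrite mulr_ge0 ?exprn_ge0 ?ltW.
  have : 0 <= K * nrm d * e by rewrite !mulr_ge0 ?nrm_ge0 ?ltW.
  by rewrite sqrrD exprMn; nra.
move=> e e0; have d1 : 0 < nrm d + 1 by rewrite ltr_wpDl ?nrm_ge0.
have e2 : 0 < e / 2 by rewrite divr_gt0.
have k0 : 0 < e / 2 / (nrm d + 1) by rewrite divr_gt0.
have [||N HN] := scale (M + e / 2 / (nrm d + 1)) _ _ _ e2.
- by rewrite ltr_wpDl.
- by rewrite lerDl ltW.
exists N => n /HN h; apply: le_trans h _.
rewrite mulrDl -addrA lerD2l -lerBrDr.
have -> : e - e / 2 = e / 2 by lra.
by rewrite -mulrA ger_pMr // ler_pdivrMl // mulr1 lerDl.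
Qed.


(* [y] is the image of [F] under the *-homomorphism from C(G) (x) D to the sequence
   algebra that maps [h (x) d] to [phi h d]. *)
Inductive Rep : (G -> A) -> (nat -> A) -> Prop :=
| Rep_el h a d : continuous h -> phi h a -> D d ->
    Rep (fun s => h s *: d) (fun n => a n ** d)
| Rep_add F y F' y' : Rep F y -> Rep F' y' ->
    Rep (fun s => F s + F' s) (fun n => y n + y' n)
| Rep_eqv F y F' y' : Rep F y -> (forall s, F' s = F s) -> eq_mod_null y' y -> Rep F' y'.

Lemma Rep_bdd F y : Rep F y -> bdd y.
Proof.
elim=> {F y} [h a d ch pa _|F y F' y' _ By _ By'|F y F' y' _ By _ /eq_mod_null_bdd]; last exact.
  by apply: bddM (phi_bdd ch pa) (bdd_cst _).
exact: bddD.
Qed.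

Lemma Rep_D F y s : Rep F y -> D (F s).
Proof.
elim=> {F y} [h a d ch pa Dd|F y F' y' _ DF _ DF'|F y F' y' _ DF FF' _].
- exact: subZ.
- exact: subD.
- by rewrite FF'.
Qed.

Lemma Rep_ext F F' y y' : Rep F y -> (forall s, F' s = F s) -> (forall n, y' n = y n) -> Rep F' y'.
Proof. by move=> RF FF' /funext ->; apply: Rep_eqv RF FF' (eq_mod_null_refl y). Qed.

Lemma phi_mul_comm h b a d h' : continuous h -> continuous h' -> phi h b -> phi h' a -> D d ->
  eq_mod_null (fun n => b n ** a n ** d) (fun n => a n ** b n ** d).
Proof.
move=> ch ch' pb pa Dd; apply: (phi_uniq (continuousM_C ch ch') _ _ Dd); first exact: (homM hphi ch ch').
have -> : (fun s => h s * h' s) = (fun s => h' s * h s) by apply/funext => s; rewrite mulrC.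
exact: (homM hphi ch' ch).
Qed.

Lemma Rep_phi h b F y : continuous h -> phi h b -> Rep F y ->
  Rep (fun s => h s *: F s) (fun n => b n ** y n).
Proof.
move=> ch pb; elim=> {F y} [h' a d ch' pa Dd|F y F' y' _ IH _ IH'|F y F' y' RF IH FF' yy'].
- apply: Rep_ext (Rep_el (continuousM_C ch ch') (homM hphi ch ch' pb pa) Dd) _ _ => s.
    by rewrite scalerA.
  by rewrite cmulA.
- by apply: Rep_ext (Rep_add IH IH') _ _ => s; rewrite ?scalerDr ?cmulDr.
- apply: Rep_eqv IH _ _ => [s|]; first by rewrite FF'.
  apply: eq_mod_nullM (phi_bdd ch pb) _ (eq_mod_null_refl b) (yy').
  by apply: eq_mod_null_bdd yy' (Rep_bdd RF).
Qed.

Lemma Rep_mulr d F y : D d -> Rep F y -> Rep (fun s => F s ** d) (fun n => y n ** d).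
Proof.
move=> Dd; elim=> {F y} [h' a d' ch' pa Dd'|F y F' y' _ IH _ IH'|F y F' y' RF IH FF' yy'].
- apply: Rep_ext (Rep_el ch' pa (subM subalg_D Dd' Dd)) _ _ => s.
    by rewrite cmulZl.
  by rewrite cmulA.
- by apply: Rep_ext (Rep_add IH IH') _ _ => s; rewrite cmulDl.
- apply: Rep_eqv IH _ _ => [s|]; first by rewrite FF'.
  apply: eq_mod_nullM yy' (eq_mod_null_refl _); [exact: Rep_bdd RF|exact: bdd_cst].
Qed.

Lemma Rep_cst d : D d -> Rep (fun=> d) (fun=> d).
Proof.
move=> Dd; have [e [pe _ _]] := phi_ex (@continuous_cst_C 1).
apply: Rep_eqv (Rep_el (@continuous_cst_C 1) pe Dd) _ _ => [s|].
  by rewrite scale1r.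
exact/eq_mod_null_sym/phi_unit.
Qed.

Lemma Rep_comm h b F y : continuous h -> phi h b -> Rep F y ->
  eq_mod_null (fun n => b n ** y n) (fun n => y n ** b n).
Proof.
move=> ch pb; have bb := phi_bdd ch pb.
elim=> {F y} [h' a d ch' pa Dd|F y F' y' _ IH _ IH'|F y F' y' RF IH FF' yy'].
- have ba := phi_bdd ch' pa.
  apply: (@eq_mod_null_trans _ _ (fun n => a n ** b n ** d)).
    apply: eq_mod_null_trans (phi_mul_comm ch ch' pb pa Dd).
    by apply: null_seq_ext nul0 => n; rewrite cmulA subrr.
  apply: null_seq_ext (null_seqMl ba (phi_comm ch pb Dd)) => n.
  by rewrite cmulBr !cmulA.
- by apply: null_seq_ext (null_seqD IH IH') => n; rewrite !calgE; lmod_ring.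
- have By := Rep_bdd RF; have By' := eq_mod_null_bdd yy' By.
  apply: (@eq_mod_null_trans _ _ (fun n => b n ** y n)).
    exact: eq_mod_nullM bb By' (eq_mod_null_refl b) yy'.
  apply: eq_mod_null_trans IH _; apply: eq_mod_null_sym; exact: eq_mod_nullM By bb yy' (eq_mod_null_refl b).
Qed.

Lemma Rep_uniq_phi h a b F y : continuous h -> phi h a -> phi h b -> Rep F y ->
  eq_mod_null (fun n => a n ** y n) (fun n => b n ** y n).
Proof.
move=> ch pa pb; have ba := phi_bdd ch pa; have bb := phi_bdd ch pb.
elim=> {F y} [h' c d ch' pc Dd|F y F' y' _ IH _ IH'|F y F' y' RF IH FF' yy'].
- apply: null_seq_ext (phi_uniq (continuousM_C ch ch') (homM hphi ch ch' pa pc) (homM hphi ch ch' pb pc) Dd) => n.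
  by rewrite !cmulA.
- by apply: null_seq_ext (null_seqD IH IH') => n; rewrite !calgE; lmod_ring.
- have By := Rep_bdd RF; have By' := eq_mod_null_bdd yy' By.
  apply: (@eq_mod_null_trans _ _ (fun n => a n ** y n)).
    exact: eq_mod_nullM ba By' (eq_mod_null_refl a) yy'.
  apply: eq_mod_null_trans IH _; apply: eq_mod_null_sym; exact: eq_mod_nullM bb By' (eq_mod_null_refl b) yy'.
Qed.

Lemma Rep_unit e F y : phi (fun=> 1) e -> Rep F y -> eq_mod_null (fun n => e n ** y n) y.
Proof.
have c1 := @continuous_cst_C 1.
move=> pe; have be := phi_bdd c1 pe.
elim=> {F y} [h a d ch pa Dd|F y F' y' _ IH _ IH'|F y F' y' RF IH FF' yy'].
- have : phi h (fun n => e n ** a n).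
    have := homM hphi c1 ch pe pa.
    by rewrite (_ : (fun s => 1 * h s) = h) //; apply/funext => s; rewrite mul1r.
  move=> /(phi_uniq ch)/(_ pa Dd); apply: null_seq_ext => n; by rewrite cmulA.
- by apply: null_seq_ext (null_seqD IH IH') => n; rewrite !calgE; lmod_ring.
- have By := Rep_bdd RF; have By' := eq_mod_null_bdd yy' By.
  apply: (@eq_mod_null_trans _ _ (fun n => e n ** y n)).
    exact: eq_mod_nullM be By' (eq_mod_null_refl e) yy'.
  exact: eq_mod_null_trans IH (eq_mod_null_sym yy').
Qed.

Lemma Rep_mul F y F' y' : Rep F y -> Rep F' y' ->
  Rep (fun s => F s ** F' s) (fun n => y n ** y' n).
Proof.
move=> RF RF'; have By' := Rep_bdd RF'.
elim: RF => {F y} [h a d ch pa Dd|F y F1 y1 _ IH _ IH1|F y F1 y1 RF IH FF1 yy1].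
- apply: Rep_ext (Rep_phi ch pa (F := fun s => d ** F' s) (y := fun n => d ** y' n) _) _ _.
  + elim: RF' {By'} => {F' y'} [h' b d' ch' pb Dd'|F y F1 y1 _ IH _ IH1|F y F1 y1 RF IH FF1 yy1].
    * apply: Rep_eqv (Rep_el ch' pb (subM subalg_D Dd Dd')) _ _ => [s|].
        by rewrite cmulZr.
      have := null_seqMr (eq_mod_null_sym (phi_comm ch' pb Dd)) (bdd_cst d').
      by apply: null_seq_ext => n; rewrite !cmulBl !cmulA.
    * by apply: Rep_ext (Rep_add IH IH1) _ _ => s; rewrite cmulDr.
    * apply: Rep_eqv IH _ _ => [s|]; first by rewrite FF1.
      apply: eq_mod_nullM (bdd_cst d) _ (eq_mod_null_refl _) (yy1).
      exact: eq_mod_null_bdd yy1 (Rep_bdd RF).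
  + by move=> s; rewrite cmulZl.
  + by move=> n; rewrite cmulA.
- by apply: Rep_ext (Rep_add IH IH1) _ _ => s; rewrite cmulDl.
- apply: Rep_eqv IH _ _ => [s|]; first by rewrite FF1.
  exact: eq_mod_nullM (Rep_bdd RF) By' yy1 (eq_mod_null_refl _).
Qed.

Lemma Rep_star F y : Rep F y -> Rep (fun s => star (F s)) (fun n => star (y n)).
Proof.
elim=> {F y} [h a d ch pa Dd|F y F' y' _ IH _ IH'|F y F' y' RF IH FF' yy'].
- have ps := homS hphi ch pa; have Ds := subS subalg_D Dd.
  apply: Rep_eqv (Rep_el (continuous_conj ch) ps Ds) _ _ => [s|].
    by rewrite starZ.
  apply: eq_mod_null_sym; apply: null_seq_ext (phi_comm (continuous_conj ch) ps Ds) => n.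
  by rewrite starM.
- by apply: Rep_ext (Rep_add IH IH') _ _ => s; rewrite starD.
- apply: Rep_eqv IH _ _ => [s|]; first by rewrite FF'.
  by apply: null_seq_ext (null_seqS yy') => n; rewrite starB.
Qed.

Lemma Rep_scale (z : C) F y : Rep F y -> Rep (fun s => z *: F s) (fun n => z *: y n).
Proof.
elim=> {F y} [h a d ch pa Dd|F y F' y' _ IH _ IH'|F y F' y' RF IH FF' yy'].
- apply: Rep_ext (Rep_el (@continuousZ_C z h ch) (homZ hphi z ch pa) Dd) _ _ => s.
    by rewrite scalerA.
  by rewrite cmulZl.
- by apply: Rep_ext (Rep_add IH IH') _ _ => s; rewrite scalerDr.
- apply: Rep_eqv IH _ _ => [s|]; first by rewrite FF'.
  by apply: null_seq_ext (null_seqZ z yy') => n; rewrite scalerBr.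
Qed.

Lemma Rep_sub F y F' y' : Rep F y -> Rep F' y' ->
  Rep (fun s => F s - F' s) (fun n => y n - y' n).
Proof.
move=> RF /(Rep_scale (-1)) RF'; apply: Rep_ext (Rep_add RF RF') _ _ => s; by rewrite scaleN1r.
Qed.

Lemma Rep_sum k (F : 'I_k -> G -> A) (y : 'I_k -> nat -> A) : (forall i, Rep (F i) (y i)) ->
  Rep (fun s => \sum_i F i s) (fun n => \sum_i y i n).
Proof.
elim: k F y => [|k IH] F y H.
  apply: Rep_ext (Rep_cst (sub0 subalg_D)) _ _ => s; by rewrite big_ord0.
apply: Rep_ext (Rep_add (H ord0) (IH _ _ (fun i => H (lift ord0 i)))) _ _ => s;
  by rewrite big_ord_recl.
Qed.

(** The action on [C(G, D)] combines translation with [alpha] and fixes the functions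
    [s |-> alpha s x]. This is where equivariance produces nearly fixed elements of [A]. *)
Lemma Rep_act g F y : Rep F y ->
  Rep (fun s => alpha g (F (g^-1 * s)%g)) (fun n => alpha g (y n)).
Proof.
elim=> {F y} [h a d ch pa Dd|F y F' y' _ IH _ IH'|F y F' y' RF IH FF' yy'].
- have ps : phi (Lt g h) (act_seq alpha g a).
    by rewrite (hom_equivariant hphi) //; exists a.
  apply: Rep_ext (Rep_el (@continuous_Lt g _ ch) ps (inv_D g Dd)) _ _ => s.
    by rewrite actZ.
  by rewrite actMul.
- by apply: Rep_ext (Rep_add IH IH') _ _ => s; rewrite actD.
- apply: Rep_eqv IH _ _ => [s|]; first by rewrite FF'.
  move=> e /yy'[N HN]; exists N => n /HN; by rewrite -actB act_nrm.
Qed.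

Lemma phi_sum k (f : 'I_k -> G -> C) (a : 'I_k -> nat -> A) : (forall i, continuous (f i)) ->
  (forall i, phi (f i) (a i)) ->
  continuous (fun s => \sum_i f i s) /\ phi (fun s => \sum_i f i s) (fun n => \sum_i a i n).
Proof.
elim: k f a => [|k IH] f a cf pa.
  under eq_fun do rewrite big_ord0; under [X in phi _ X]eq_fun do rewrite big_ord0.
  split; first exact: continuous_cst_C.
  have [e [pe _ _]] := phi_ex (@continuous_cst_C 1).
  have := homZ hphi 0 (@continuous_cst_C 1) pe.
  by under eq_fun do rewrite mul0r; under [X in phi _ X]eq_fun do rewrite scale0r.
under eq_fun do rewrite big_ord_recl; under [X in phi _ X]eq_fun do rewrite big_ord_recl.
have [c1 p1] := IH _ _ (fun i => cf (lift ord0 i)) (fun i => pa (lift ord0 i)).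
split; first exact: (continuousD_C (cf ord0) c1).
exact: (homD hphi (cf ord0) c1 (pa ord0) p1).
Qed.

(* Multiplication by a function that is supported near [g] replaces [F] by [F g]. *)
Lemma Rep_local F y g (e : R) : Rep F y -> 0 < e -> exists2 U : set G, nbhs g U &
  forall f b, continuous f -> (forall s, cn (f s) <= 1) -> (forall s, ~ U s -> f s = 0) ->
    phi f b -> limsup_le (fun n => b n ** y n - b n ** F g) e.
Proof.
move=> RF; elim: RF e => {F y} [h a d ch pa Dd|F y F' y' RF IH RF' IH'|F y F' y' RF IH FF' yy'] e e0.
- have d1 : 0 < nrm d + 1 by rewrite ltr_wpDl ?nrm_ge0.
  have k0 : 0 < e / (nrm d + 1) by rewrite divr_gt0.
  exists [set s | cn (h s - h g) <= e / (nrm d + 1)].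
    exact: (iffLR (continuousP_cn h) ch).
  move=> f b cf f1 fU pb.
  have cg : continuous (fun s => h s + (- h g) * 1).
    exact: (@continuousD_C h _ ch (@continuousZ_C (- h g) _ (@continuous_cst_C 1))).
  have [c [pc _ _]] := phi_ex (@continuous_cst_C 1).
  have pz := homZ hphi (- h g) (@continuous_cst_C 1) pc.
  have pm := homM hphi cf cg pb (homD hphi ch (@continuousZ_C (- h g) _ (@continuous_cst_C 1)) pa pz).
  have H := phi_contr (ltW k0) (continuousM_C cf cg) _ pm Dd.
  have {}H : limsup_le (fun n => b n ** (a n + - h g *: c n) ** d) e.
    apply: limsup_le_le (H _); first by rewrite -mulrA ger_pMr // ler_pdivrMl // mulr1 lerDl.
    move=> s; rewrite mulr1 cnM.
    have [Us|/fU ->] := pselect (cn (h s - h g) <= e / (nrm d + 1)).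
      by rewrite -[X in _ <= X]mul1r ler_pM ?cn_ge0.
    by rewrite cn0 mul0r ltW.
  have cd := null_seqMl (phi_bdd cf pb) (null_seqZ (- h g) (phi_unit pc Dd)).
  have := limsup_leB H cd; rewrite addr0; apply: limsup_le_ext => n.
  by rewrite !calgE; lmod_ring.
- have e2 : 0 < e / 2 by rewrite divr_gt0.
  have [U gU HU] := IH _ e2; have [V gV HV] := IH' _ e2.
  exists (U `&` V); first exact: filterI.
  move=> f b cf f1 fU pb.
  have h1 := HU f b cf f1 (fun s Us => fU s (fun UV => Us (proj1 UV))) pb.
  have h2 := HV f b cf f1 (fun s Vs => fU s (fun UV => Vs (proj2 UV))) pb.
  have := limsup_leD h1 h2; have -> : e / 2 + e / 2 = e by lra.
  by apply: limsup_le_ext => n; rewrite !cmulDr; lmod_ring.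
- have [U gU HU] := IH _ e0; exists U => // f b cf f1 fU pb; rewrite FF'.
  apply: eq_mod_null_limsup (HU f b cf f1 fU pb).
  by apply: null_seq_ext (null_seqMl (phi_bdd cf pb) yy') => n; rewrite cmulBr; lmod_ring.
Qed.

(** Only exponents [2 ^ m] occur, for which the C*-identity gives the norm of the power of a
    self-adjoint element exactly. *)
Fixpoint sqn (x : nat -> A) (m : nat) : nat -> A :=
  if m is k.+1 then fun n => sqn x k n ** sqn x k n else x.

Lemma sqn_lims x (M : R) m : 0 <= M -> limsup_le x M -> limsup_le (sqn x m) (M ^+ (2 ^ m)).
Proof.
move=> M0 H; elim: m => [|m IH]; first by rewrite expn0 expr1.
by rewrite expnS mul2n -addnn exprD; apply: limsup_leM => //; exact: exprn_ge0.
Qed.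

Lemma sqn_Rep F y m : Rep F y -> exists F', Rep F' (sqn y m).
Proof.
move=> RF; elim: m => [|m [F' IH]]; first by exists F.
by exists (fun s => F' s ** F' s); exact: Rep_mul.
Qed.

Lemma sqn_nrm x m n : (forall n, star (x n) = x n) -> nrm (sqn x m n) = nrm (x n) ^+ (2 ^ m).
Proof.
move=> sx; have sa k : star (sqn x k n) = sqn x k n.
  by elim: k => [|k IH] //=; rewrite starM IH.
elim: m => [|m IH]; first by rewrite expn0 expr1.
by rewrite expnS mul2n -addnn exprD /= nrm_sa // IH expr2.
Qed.

Lemma bernoulli (x : R) n : 0 <= x -> 1 + n%:R * x <= (1 + x) ^+ n.
Proof.
move=> x0; elim: n => [|n IH]; first by rewrite mul0r addr0 expr0.
rewrite exprS -natr1.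
have : 0 <= n%:R * x * x by rewrite !mulr_ge0.
by have := ler_wpM2l (addr_ge0 ler01 x0) IH; lra.
Qed.

(* With a partition of unity [f i] and functions [f' i] that are 1 on the support of
   [f i], modulo null sequences [z^k] is the sum of the [f i z^k = f i (f' i z)^k].
   Each [f' i z] has norm at most about [M], and extracting k-th roots removes
   the dependence on the number of summands. *)
Lemma Rep_contr_sa F z (M : R) : Rep F z -> (forall n, star (z n) = z n) -> 0 <= M ->
  (forall s, nrm (F s) <= M) -> limsup_le z M.
Proof.
move=> RF sz M0 FM e' e'0.
pose e := e' / 2; have e0 : 0 < e by rewrite divr_gt0.
have HU g : exists U : set G, nbhs g U /\
  forall f b, continuous f -> (forall s, cn (f s) <= 1) -> (forall s, ~ U s -> f s = 0) ->
    phi f b -> limsup_le (fun n => b n ** z n - b n ** F g) e.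
  by have [U ? ?] := Rep_local g RF e0; exists U.
have [U {}HU] := choice HU.
have [k [p [f [f' [cff fb f1 ff' fU]]]]] :=
  partition_of_unity (R := R) hausdorff_G compact_G (fun g => (HU g).1).
pose h i s : C := rc (f i s); pose h' i s : C := rc (f' i s).
have ch i : continuous (h i) by apply: continuous_rc; case: (cff i).
have ch' i : continuous (h' i) by apply: continuous_rc; case: (cff i).
have [a Ha] := choice (fun i => phi_ex (ch i)).
have [b Hb] := choice (fun i => phi_ex (ch' i)).
have pa i : phi (h i) (a i) by case: (Ha i).
have pb i : phi (h' i) (b i) by case: (Hb i).
have ba i : bdd (a i) by case: (Ha i).
have h'1 i s : cn (h' i s) <= 1.
  by rewrite cn_rc ger0_norm; case: (fb i s) => _ /andP[].
pose L := M + e; have L0 : 0 < L by rewrite ltr_wpDl.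
pose w i n := b i n ** z n.
have wL i : limsup_le (w i) L.
  have h1 := (HU (p i)).2 (h' i) (b i) (ch' i) (h'1 i) _ (pb i).
  have {}h1 := h1 (fun s Us => congr1 (@rc R) (fU i s Us).2).
  have h2 := phi_contr ler01 (ch' i) (h'1 i) (pb i) (Rep_D (p i) RF).
  apply: limsup_le_le (limsup_le_ext _ (limsup_leD h2 h1)); last by move=> n; rewrite addrC subrK.
  by rewrite mul1r lerD2r.
have bw m i : bdd (sqn (w i) m) by exact: limsup_le_bdd (sqn_lims m (ltW L0) (wL i)).
have key m i : eq_mod_null (fun n => a i n ** sqn (w i) m n) (fun n => a i n ** sqn z m n).
  elim: m => [|m IH].
    have pab : phi (h i) (fun n => a i n ** b i n).
      have := homM hphi (ch i) (ch' i) (pa i) (pb i).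
      rewrite (_ : (fun s => _) = h i) //; apply/funext => s.
      by rewrite /h /h' -rcM mulrC ff'.
    apply: null_seq_ext (Rep_uniq_phi (ch i) pab (pa i) RF) => n.
    by rewrite /= /w cmulA.
  have [Fm RFm] := sqn_Rep m RF; have bz := Rep_bdd RFm.
  have cm := Rep_comm (ch i) (pa i) RFm.
  (* With [w] and [z] for the current powers, the products [a w w], [a z w], [z a w], [z a z],
     [a z z] agree in turn modulo null sequences. *)
  have H := null_seqD (null_seqD (null_seqMr IH (bw m i)) (null_seqMr cm (bw m i)))
                 (null_seqB (null_seqMl bz IH) (null_seqMr cm bz)).
  apply: null_seq_ext H => n /=; rewrite !calgE; lmod_ring.
have /choice[K HK] : forall i, exists K : R, 0 <= K /\ limsup_le (a i) K.
  by move=> i; have [K ? ?] := bdd_lims (ba i); exists K.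
pose S := \sum_i K i; have S0 : 0 <= S by apply: sumr_ge0 => i _; case: (HK i).
have bound m : limsup_le (sqn z m) (S * L ^+ (2 ^ m)).
  have [Fm RFm] := sqn_Rep m RF.
  have [c1 p1] := phi_sum ch pa.
  have E1 : (fun s => \sum_i h i s) = fun=> 1.
    by apply/funext => s; rewrite /h -rc_sum f1.
  rewrite E1 in p1; have U1 := Rep_unit p1 RFm.
  apply: eq_mod_null_limsup (eq_mod_null_sym U1) _.
  have H : eq_mod_null (fun n => (\sum_i a i n) ** sqn z m n) (fun n => \sum_i (a i n ** sqn (w i) m n)).
    have := eq_mod_null_sum (fun i => eq_mod_null_sym (key m i)); apply: null_seq_ext => n.
    by rewrite cmul_suml.
  apply: eq_mod_null_limsup H _; rewrite /S mulr_suml; apply: limsup_le_sum => i.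
  apply: limsup_leM => //; [by case: (HK i)|exact: exprn_ge0 (ltW L0)|by case: (HK i)|].
  exact: sqn_lims (ltW L0) (wL i).
(* Here [L * (1 + x) = M + e'], so a bound [(S + 1) * L ^ (2 ^ m)] on the power is good enough once
   [(1 + x) ^ (2 ^ m)] is at least [S + 1]. *)
pose x := e / L; have x0 : 0 < x by rewrite divr_gt0.
pose m := (Num.truncn ((S + 1) / x)).+1.
have Hm : S + 1 <= (1 + x) ^+ (2 ^ m).
  apply: le_trans (bernoulli _ (ltW x0)); apply: le_trans (_ : m%:R * x <= _).
    by rewrite -ler_pdivrMr //; apply/ltW/truncnS_gt.
  apply: le_trans (_ : (2 ^ m)%:R * x <= _); last by rewrite lerDr.
  by rewrite ler_pM2r // ler_nat ltnW // ltn_expl.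
have LL : 0 < L ^+ (2 ^ m) by rewrite exprn_gt0.
have [N HN] := bound m _ LL; exists N => n /HN; rewrite sqn_nrm // => h2.
rewrite leNgt; apply/negP => h3.
have Lx : L * (1 + x) = M + e' by rewrite mulrDr mulr1 /x mulrC divfK ?gt_eqF // /L /e; lra.
have h4 : L ^+ (2 ^ m) * (1 + x) ^+ (2 ^ m) < nrm (z n) ^+ (2 ^ m).
  rewrite -exprMn Lx ltrXn2r ?expn_eq0 // ?nnegrE ?nrm_ge0 //.
  by rewrite addr_ge0 // ltW.
have := ler_wpM2l (ltW LL) Hm; lra.
Qed.

(** The C*-identity reduces this to the self-adjoint case. Applied to differences with [M = 0], it
    says that [Rep] is a map modulo null sequences. *)
Lemma Rep_contr F y (M : R) : Rep F y -> 0 <= M -> (forall s, nrm (F s) <= M) -> limsup_le y M.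
Proof.
move=> RF M0 FM e e0.
have RZ := Rep_mul (Rep_star RF) RF.
have H := Rep_contr_sa RZ (fun n => _) (exprn_ge0 2 M0) _.
have e2 : 0 < e ^+ 2 by rewrite exprn_gt0.
have [||N HN] := H _ _ _ e2.
- by move=> n; rewrite starM starK.
- by move=> s; rewrite nrm_sqr ler_sqr ?nnegrE ?nrm_ge0.
exists N => n /HN; rewrite nrm_sqr => h; apply: nrm_sa_pow_le.
  by rewrite addr_ge0 // ltW.
by apply: le_trans h _; rewrite sqrrD -addrA lerD2l lerDr mulrn_wge0 // mulr_ge0 // ltW.
Qed.

(** [Rep] covers finite sums of elementary tensors, so an orbit function is only approximated, by a
    partition of unity. Equicontinuity comes from choosing representatives in [linfty_act]. *)
Lemma orbit_approx x (e : R) : D x -> 0 < e -> exists F y,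
  [/\ Rep F y, forall s, nrm (F s - alpha s x) <= e, bdd y & equicont y].
Proof.
move=> Dx e0.
have [k [p [f [f' [cff fb f1 _ fU]]]]] :=
  partition_of_unity (R := R) hausdorff_G compact_G (fun g => act_near alpha x g e0).
pose h i s : C := rc (f i s).
have ch i : continuous (h i) by apply: continuous_rc; case: (cff i).
have [a Ha] := choice (fun i => phi_ex (ch i)).
have pa i : phi (h i) (a i) by case: (Ha i).
have ba i : bdd (a i) by case: (Ha i).
have Ri i := Rep_el (ch i) (pa i) (inv_D (p i) Dx).
exists (fun s => \sum_i h i s *: alpha (p i) x), (fun n => \sum_i a i n ** alpha (p i) x); split.
- exact: Rep_sum Ri.
- move=> s.
  have -> : \sum_i h i s *: alpha (p i) x - alpha s x = \sum_i h i s *: (alpha (p i) x - alpha s x).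
    under [RHS]eq_bigr do rewrite scalerBr.
    by rewrite sumrB -scaler_suml /h -rc_sum f1 rc1 scale1r.
  apply: le_trans (nrm_sum _ _ _) _; rewrite -[e]mul1r -(f1 s) mulr_suml.
  apply: ler_sum => i _; rewrite nrmZ cn_rc ger0_norm; last by case: (fb i s).
  have [Us|/fU [-> _]] := pselect (nrm (alpha s x - alpha (p i) x) <= e).
    by rewrite ler_wpM2l //; [case: (fb i s)|rewrite nrmC].
  by rewrite !mul0r.
- exact: Rep_bdd (Rep_sum Ri).
have equicont_add y y' : equicont y -> equicont y' -> equicont (fun n => y n + y' n).
  move=> Hy Hy' g eps eps0; have e2 : 0 < eps / 2 by rewrite divr_gt0.
  apply: filterS2 (Hy g _ e2) (Hy' g _ e2) => t h1 h2 n.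
  have -> : alpha t (y n + y' n) - alpha g (y n + y' n) =
    (alpha t (y n) - alpha g (y n)) + (alpha t (y' n) - alpha g (y' n)).
    by rewrite !actD; lmod_ring.
  by apply: le_trans (nrmD _ _) _; have := h1 n; have := h2 n; lra.
have equicont_el i : equicont (fun n => a i n ** alpha (p i) x).
  move=> g eps eps0; have [K K0 HK] := ba i.
  have K1 : 0 < K + 1 by rewrite ltr_wpDl.
  have e2 : 0 < eps / 2 by rewrite divr_gt0.
  have x1 : 0 < nrm x + 1 by rewrite ltr_wpDl ?nrm_ge0.
  have [_ _ ei] := Ha i.
  apply: filterS2 (ei g _ (divr_gt0 e2 x1)) (act_near alpha (alpha (p i) x) g (divr_gt0 e2 K1)) => t h1 h2 n.
  set d := alpha (p i) x in h2 *; have dx : nrm d = nrm x by rewrite act_nrm.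
  have -> : alpha t (a i n ** d) - alpha g (a i n ** d) =
    (alpha t (a i n) - alpha g (a i n)) ** alpha t d + alpha g (a i n) ** (alpha t d - alpha g d).
    by rewrite !actMul !calgE; lmod_ring.
  apply: le_trans (nrmD _ _) _.
  have b1 := le_trans (nrmM _ _) (ler_pM (nrm_ge0 _) (nrm_ge0 _) (h1 n) (lexx (nrm (alpha t d)))).
  have b2 := le_trans (nrmM (alpha g (a i n)) (alpha t d - alpha g d)) (ler_pM (nrm_ge0 _) (nrm_ge0 _) (lexx _) h2).
  rewrite !act_nrm ?dx in b1 b2.
  have c1 : eps / 2 / (nrm x + 1) * nrm x <= eps / 2.
    by rewrite -mulrA ger_pMr // ler_pdivrMl // mulr1 lerDl.
  have c2 : nrm (a i n) * (eps / 2 / (K + 1)) <= eps / 2.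
    rewrite mulrA ler_pdivrMr // mulrC ler_pM2l //.
    by rewrite (le_trans (HK n)) // lerDl.
  by lra.
have equicont_sum m (y : 'I_m -> nat -> A) : (forall i, equicont (y i)) -> equicont (fun n => \sum_i y i n).
  elim: m y => [|m IH] y ey.
    by move=> g eps eps0; near=> t => n; rewrite !big_ord0 !act_0 subrr nrm0; exact: ltW.
  under eq_fun do rewrite big_ord_recl.
  by apply: equicont_add => //; exact: IH.
exact: equicont_sum.
Unshelve. all: by end_near.
Qed.

(* [y] almost lies in the fixed point algebra: its orbit map is represented by
   [F], which is almost [alpha]-invariant. *)
Lemma fixed_approx x (e : R) : D x -> 0 < e -> exists F y,
  [/\ Rep F y, forall s, nrm (F s - alpha s x) <= e, bdd y &
      exists N, forall n, (N <= n)%N ->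
        exists2 v, fixed_points alpha v & nrm (v - y n) <= 5 * e].
Proof.
move=> Dx e0; have [F [y [RF Fx By Ey]]] := orbit_approx Dx e0.
exists F, y; split=> //.
have pt g : limsup_le (fun n => alpha g (y n) - y n) (2 * e).
  apply: Rep_contr (Rep_sub (Rep_act g RF) RF) _ _; first by rewrite mulr_ge0 // ltW.
  move=> s; apply: le_trans (nrm_tri (alpha s x) _ _) _.
  have h1 := Fx (g^-1 * s)%g; have h2 := Fx s.
  rewrite [X in _ + X]nrmC.
  have -> : alpha s x = alpha g (alpha (g^-1 * s)%g x) by rewrite -actM mulgA mulgV mul1g.
  rewrite -{1}actB act_nrm -actM mulgA mulgV mul1g; lra.
(* The bounds in [pt] hold from an index that depends on [g]; equicontinuity and compactness give
   one index for all [g]. *)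
have : \forall n \near \oo, forall g, nrm (alpha g (y n) - y n) <= 4 * e.
  apply: (near_compact compact_G) => g.
  exists [set h | forall n, nrm (alpha h (y n) - alpha g (y n)) <= e]; first exact: Ey.
  have [N HN] := pt g _ e0; exists N => // n /HN h1 h Uh.
  by apply: le_trans (nrm_tri (alpha g (y n)) _ _) _; have := Uh n; lra.
case=> N _ HN; exists N => n /HN /(fixed_near compact_G)[v fv vy].
by exists v => //; lra.
Qed.

End Rokhlin.

(** * The fixed point algebra *)

Section FixedPointAlgebra.
Context {R : realType} {G : topGroupType} {A : cstarAlgType R}.
Variable alpha : cstar_action G A.
Hypothesis hausdorff_G : hausdorff_space G.
Hypothesis compact_G : compact [set: G].
Local Notation C := (Cplx R).

Lemma ideal_sum (S I : set A) k (v : 'I_k -> A) : closed_ideal S I -> (forall i, I (v i)) ->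
  I (\sum_i v i).
Proof.
move=> HI Hv; elim/big_rec: _ => [|i x _]; first exact: ideal0 HI.
exact: (idealD HI).
Qed.

Section Terms.
Variables (u : nat -> A) (D : set A) (phi : (G -> C) -> set (nat -> A)).
Hypothesis fau : fixed_approx_unit alpha u.
Hypothesis subalg_D : cstar_subalgebra D.
Hypothesis inv_D : invariant_set alpha D.
Hypothesis hphi : equivariant_unital_hom alpha D phi.

(** As [c] is fixed, the orbit function of [x ** c ** y] is the product of those of [x] and [y] with
    the constant [c] between them. Replacing the outer sequences by nearby fixed points leads into
    [I]. *)
Lemma ideal_term (I : set A) x c y (e : R) : closed_ideal (fixed_points alpha) I ->
  I c -> D x -> D c -> D y -> 0 < e -> exists F w,
  [/\ Rep D phi F w, forall s, nrm (F s - alpha s (x ** c ** y)) <= e &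
      exists N, forall n, (N <= n)%N -> exists2 v, I v & nrm (v - w n) <= e].
Proof.
move=> HI Ic Dx Dc Dy e0.
have fc := ideal_sub HI Ic.
(* The [5] is the loss in [fixed_approx]; [14] is twice the amount 7 by which the norms of the
   approximants may exceed those of [x] and [y]. *)
pose K := 5 * (nrm c * (nrm x + nrm y + 14)) + 1.
have cxy : 0 <= nrm c * (nrm x + nrm y + 14).
  by rewrite mulr_ge0 ?addr_ge0 ?nrm_ge0.
have K0 : 0 < K by rewrite ltr_wpDl // mulr_ge0.
pose d := Num.min 1 (e / K).
have d0 : 0 < d by rewrite lt_min ltr01 divr_gt0.
have d1 : d <= 1 by rewrite ge_min lexx.
have dK : d * K <= e by rewrite -ler_pdivlMr // ge_min lexx orbT.
have [F [w [RF Fx _ [N HN]]]] := fixed_approx hausdorff_G compact_G fau subalg_D inv_D hphi Dx d0.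
have [F' [w' [RF' Fy _ [N' HN']]]] := fixed_approx hausdorff_G compact_G fau subalg_D inv_D hphi Dy d0.
have Fb s : nrm (F s) <= nrm x + d.
  by have := nrm_le_sub (F s) (alpha s x); rewrite act_nrm; have := Fx s; lra.
have Fb' s : nrm (F' s) <= nrm y + d.
  by have := nrm_le_sub (F' s) (alpha s y); rewrite act_nrm; have := Fy s; lra.
have dx : 0 <= nrm x + d by rewrite addr_ge0 ?nrm_ge0 // ltW.
have [M HM] := Rep_contr hausdorff_G compact_G fau subalg_D hphi RF dx Fb d0.
have dy : 0 <= nrm y + d by rewrite addr_ge0 ?nrm_ge0 // ltW.
have [M' HM'] := Rep_contr hausdorff_G compact_G fau subalg_D hphi RF' dy Fb' d0.
have x0 := nrm_ge0 x; have y0 := nrm_ge0 y; have c0 := nrm_ge0 c.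
have est (a a' b b' : A) (p q : R) : nrm (a - a') <= p -> nrm (b - b') <= p ->
    0 <= p -> 
    nrm b <= nrm y + q -> nrm a' <= nrm x + q -> 0 <= q ->
    nrm (a ** c ** b - a' ** c ** b') <= p * (nrm c * (nrm x + nrm y + 2 * q)).
  move=> h1 h2 p0 h3 h4 q0.
  have -> : a ** c ** b - a' ** c ** b' = (a - a') ** c ** b + a' ** c ** (b - b').
    by rewrite !calgE; lmod_ring.
  apply: le_trans (nrmD _ _) _.
  have b1 := le_trans (nrmM ((a - a') ** c) b) (ler_wpM2r (nrm_ge0 _) (nrmM (a - a') c)).
  have b2 := le_trans (nrmM (a' ** c) (b - b')) (ler_wpM2r (nrm_ge0 _) (nrmM a' c)).
  have b3 : nrm (a - a') * nrm c * nrm b <= p * nrm c * (nrm y + q).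
    by rewrite ler_pM ?mulr_ge0 ?nrm_ge0 // ler_wpM2r.
  have b4 : nrm a' * nrm c * nrm (b - b') <= (nrm x + q) * nrm c * p.
    by rewrite ler_pM ?mulr_ge0 ?nrm_ge0 // ler_wpM2r.
  by lra.
exists (fun s => F s ** c ** F' s), (fun n => w n ** c ** w' n); split.
- exact: (Rep_mul subalg_D hphi (Rep_mulr subalg_D hphi Dc RF) RF').
- move=> s; rewrite !actMul (fc s).
  have := est (F s) (alpha s x) (F' s) (alpha s y) d 1 (Fx s) (Fy s) (ltW d0).
  rewrite !act_nrm ler01 => /(_ _ _ isT) H; apply: le_trans (H _ _) _.
  + by have := Fb' s; lra.
  + by rewrite lerDl.
  apply: le_trans dK; rewrite ler_wpM2l ?(ltW d0) // /K; nra.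
- exists (maxn (maxn N N') (maxn M M')) => n.
  rewrite !geq_max => /andP[/andP[/HN[v fv h1] /HN'[v' fv' h2]] /andP[/HM h3 /HM' h4]].
  exists (v ** c ** v'); first by apply: (idealMr HI) => //; exact: (idealMl HI).
  have := est v (w n) v' (w' n) (5 * d) 7 h1 h2.
  rewrite mulr_ge0 ?(ltW d0) // => /(_ isT) H; apply: le_trans (H _ _ _) _ => //.
  + by have := nrm_le_sub v' (w' n); lra.
  + by lra.
  apply: le_trans dK; rewrite /K; nra.
Qed.

(** A fixed [b] has a constant orbit function, so [Rep_contr] carries the approximation of [b] over
    to the sequences. It costs [3 * e], and passing to elements of [I] another [e]. *)
Lemma ideal_sum_term (I : set A) k (x c y : nat -> A) b (e : R) :
  closed_ideal (fixed_points alpha) I -> (forall i, I (c i)) ->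
  (forall i, D (x i)) -> (forall i, D (c i)) -> (forall i, D (y i)) -> D b -> fixed_points alpha b ->
  nrm (\sum_(i < k) x i ** c i ** y i - b) <= e -> 0 < e ->
  exists2 v, I v & nrm (v - b) <= 4 * e.
Proof.
move=> HI Ic Dx Dc Dy Db fb zb e0.
(* Tolerances are divided by [k.+1], which also serves the empty sum. *)
have k0 : (0 : R) < k.+1%:R by rewrite ltr0n.
have ek : 0 < e / k.+1%:R by rewrite divr_gt0.
have kek : k%:R * (e / k.+1%:R) <= e.
  by rewrite mulrA ler_pdivrMr // mulrC ler_pM2l // ler_nat.
have /choice[P HP] : forall i : 'I_k, exists P : (G -> A) * (nat -> A) * nat,
   [/\ Rep D phi P.1.1 P.1.2,
       forall s, nrm (P.1.1 s - alpha s (x i ** c i ** y i)) <= e / k.+1%:R &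
       forall n, (P.2 <= n)%N -> exists2 v, I v & nrm (v - P.1.2 n) <= e / k.+1%:R].
  move=> i; have [F [w [h1 h2 [N h3]]]] := ideal_term HI (Ic i) (Dx i) (Dc i) (Dy i) ek.
  by exists (F, w, N).
have R1 i : Rep D phi (P i).1.1 (P i).1.2 by case: (HP i).
have RF := Rep_sum fau subalg_D hphi R1.
have sumk (f : 'I_k -> A) : (forall i, nrm (f i) <= e / k.+1%:R) -> nrm (\sum_i f i) <= e.
  move=> H; apply: le_trans (nrm_sum _ _ _) _; apply: le_trans (ler_sum _ (fun i _ => H i)) _.
  by rewrite sumr_const card_ord -[X in X <= _]mulr_natl.
have := Rep_contr hausdorff_G compact_G fau subalg_D hphi (Rep_sub hphi RF (Rep_cst fau hphi Db))
  (M := 2 * e).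
rewrite mulr_ge0 ?(ltW e0) // => /(_ isT) H.
have [|N HN] := H _ _ e0.
  move=> s; apply: le_trans (nrm_tri (alpha s (\sum_(i < k) x i ** c i ** y i)) _ _) _.
  rewrite act_sum -sumrB.
  have h1 : nrm (\sum_i ((P i).1.1 s - alpha s (x i ** c i ** y i))) <= e.
    by apply: sumk => i; case: (HP i).
  by rewrite -act_sum -[X in nrm (alpha s _ - X)](fb s) -actB act_nrm; lra.
pose n := maxn N (\max_i (P i).2).
have Pn i : ((P i).2 <= n)%N.
  by rewrite /n leq_max; apply/orP; right; apply: (leq_bigmax i).
have /choice[v Hv] : forall i, exists v, I v /\ nrm (v - (P i).1.2 n) <= e / k.+1%:R.
  by move=> i; case: (HP i) => _ _ /(_ n (Pn i))[v ? ?]; exists v.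
exists (\sum_i v i); first by apply: ideal_sum HI _ => i; case: (Hv i).
have := HN n (leq_maxl _ _) => h2.
apply: le_trans (nrm_tri (\sum_i (P i).1.2 n) _ _) _.
have : nrm (\sum_i v i - \sum_i (P i).1.2 n) <= e.
  by rewrite -sumrB; apply: sumk => i; case: (Hv i).
lra.
Qed.

End Terms.

Definition sandwich (I : set A) : set A := [set z | exists k (x c y : nat -> A),
  (forall i, I (c i)) /\ z = \sum_(i < k) x i ** c i ** y i].

Lemma sandwich_term (I : set A) c x y : I c -> sandwich I (x ** c ** y).
Proof.
by move=> Ic; exists 1%N, (fun=> x), (fun=> c), (fun=> y); split => //; rewrite big_ord1.
Qed.

Lemma sandwichD (I : set A) a b : sandwich I a -> sandwich I b -> sandwich I (a + b).
Proof.
move=> [k [x [c [y [Ic ->]]]]] [k' [x' [c' [y' [Ic' ->]]]]].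
pose cat (T : Type) (f f' : nat -> T) i := if (i < k)%N then f i else f' (i - k)%N.
exists (k + k')%N, (cat _ x x'), (cat _ c c'), (cat _ y y'); split.
  by move=> i; rewrite /cat; case: ifP.
rewrite big_split_ord /=; congr (_ + _); apply: eq_bigr => i _; rewrite /cat.
  by rewrite ltn_ord.
by rewrite ltnNge leq_addr /= addKn.
Qed.

Lemma sandwich_map (I : set A) (f g : A -> A) a : {morph f : x y / x + y} ->
  (forall x c y, f (x ** c ** y) = x ** c ** g y) -> sandwich I a -> sandwich I (f a).
Proof.
move=> fD fg [k [x [c [y [Ic ->]]]]]; exists k, x, c, (fun i => g (y i)); split=> //.
have f0 : f 0 = 0 by apply: (addrI (f 0)); rewrite -fD !addr0.
by elim/big_rec2: _ => // i p q _ <-; rewrite fD fg.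
Qed.

Lemma sandwich_mapl (I : set A) (f g : A -> A) a : {morph f : x y / x + y} ->
  (forall x c y, f (x ** c ** y) = g x ** c ** y) -> sandwich I a -> sandwich I (f a).
Proof.
move=> fD fg [k [x [c [y [Ic ->]]]]]; exists k, (fun i => g (x i)), c, y; split=> //.
have f0 : f 0 = 0 by apply: (addrI (f 0)); rewrite -fD !addr0.
by elim/big_rec2: _ => // i p q _ <-; rewrite fD fg.
Qed.

Lemma sandwich_ideal (I : set A) c : I c -> closed_ideal [set: A] (closure (sandwich I)).
Proof.
move=> Ic.
have cl (f : A -> A) (K : R) : 0 <= K -> (forall a b, nrm (f a - f b) <= K * nrm (a - b)) ->
    (forall a, sandwich I a -> sandwich I (f a)) ->
    forall a, closure (sandwich I) a -> closure (sandwich I) (f a).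
  move=> K0 fK fI a /closureP Ha; apply/closureP => e e0.
  have K1 : 0 < K + 1 by rewrite ltr_wpDl.
  have [b Ib ba] := Ha _ (divr_gt0 e0 K1); exists (f b); first exact: fI.
  apply: le_trans (fK _ _) _; apply: le_trans (_ : (K + 1) * nrm (b - a) <= _).
    by rewrite ler_wpM2r ?nrm_ge0 // lerDl.
  by rewrite mulrC -ler_pdivlMr.
split.
- by [].
- exact: closed_closure.
- apply: subset_closure; have := sandwich_term 0 0 Ic; by rewrite cmul0r.
- move=> a b /closureP Ha /closureP Hb; apply/closureP => e e0.
  have e2 : 0 < e / 2 by rewrite divr_gt0.
  have [a' Ia aa] := Ha _ e2; have [b' Ib bb] := Hb _ e2.
  exists (a' + b'); first exact: sandwichD.
  have -> : a' + b' - (a + b) = (a' - a) + (b' - b) by lmod_ring.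
  by apply: le_trans (nrmD _ _) _; lra.
- move=> z; apply: (cl _ (cn z)) => [|a b|a]; first exact: cn_ge0.
    by rewrite -scalerBr nrmZ.
  apply: (sandwich_map (g := fun y => z *: y)) => [x y|x d y]; first by rewrite scalerDr.
  by rewrite cmulZr.
- move=> w b _; apply: (cl _ (nrm w)) => [|x y|x]; first exact: nrm_ge0.
    by rewrite -cmulBr nrmM.
  apply: (sandwich_mapl (g := fun y => w ** y)) => [p q|p d q]; first by rewrite cmulDr.
  by rewrite !cmulA.
- move=> b w + _; apply: (cl (fun b => b ** w) (nrm w)) => [|x y|x]; first exact: nrm_ge0.
    by rewrite -cmulBl mulrC nrmM.
  apply: (sandwich_map (f := fun y => y ** w) (g := fun y => y ** w)) => [p q|p d q]; first by rewrite cmulDl.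
  by rewrite !cmulA.
Qed.

Lemma fixed_points_simple : sigma_unital A -> @second_countable G ->
  rokhlin_property alpha -> simple [set: A] -> simple (fixed_points alpha).
Proof.
move=> su sc rok [[a _ a0] simA].
have [u fau] := fixed_approx_unit_exists alpha compact_G su.
have [fu u1 ul ur] := fau; split.
  have [//|H] := pselect (exists2 x, fixed_points alpha x & x != 0).
  have un n : u n = 0.
    by apply/eqP/negP => /negP un0; apply: H; exists (u n).
  have := ul a; under eq_fun do rewrite un cmul0l.
  by move=> /(lim_uniq (@seq_cvg_cst _ _ 0)) a0'; rewrite -a0' eqxx in a0.
move=> I HI; have [[c Ic c0]|H] := pselect (exists2 c, I c & c != 0); last first.
  left; apply/seteqP; split=> x /=.
    by move=> Ix; apply/eqP/negP => /negP x0; apply: H; exists x.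
  by move=> ->; exact: ideal0 HI.
right; apply/seteqP; split; first exact: ideal_sub HI.
(* The closure cannot be zero since it contains [c]: for want of a unit, [c] is the limit of
   [u n ** c ** u n]. *)
have K1 : closure (sandwich I) = [set: A].
  case: (simA _ (sandwich_ideal Ic)) => // E; exfalso.
  have : closure (sandwich I) c.
    have /cvg_seqP H := cmul_cvg (ul c) (@seq_cvg_cst _ _ c).
    have H2 : (fun n => u n ** c ** u n) @ \oo --> c.
      have /cvg_seqP h1 := ul c; have /cvg_seqP h2 := ur c; apply/cvg_seqP => e e0.
      have e2 : 0 < e / 2 by rewrite divr_gt0.
      have [N HN] := h1 _ e2; have [N' HN'] := h2 _ e2; exists (maxn N N') => n.
      rewrite geq_max => /andP[/HN g1 /HN' g2].
      have -> : u n ** c ** u n - c = (u n ** c - c) ** u n + (c ** u n - c).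
        by rewrite !calgE; lmod_ring.
      apply: le_trans (nrmD _ _) _; have := nrmM (u n ** c - c) (u n).
      by have := ler_wpM2l (nrm_ge0 (u n ** c - c)) (u1 n); lra.
    apply/closureP => e e0; have /cvg_seqP/(_ e e0)[N /(_ N (leqnn _)) HN] := H2.
    by exists (u N ** c ** u N) => //; exact: sandwich_term.
  by rewrite E /= => c00; rewrite c00 eqxx in c0.
move=> b fb; apply: (iffLR (closedP I) (ideal_closed HI)) => e e0.
have e4 : 0 < e / 4 by rewrite divr_gt0.
have : closure (sandwich I) b by rewrite K1.
move=> /closureP/(_ _ e4)[_ [k [x [d [y [Id ->]]]]] zb].
(* [separable_hull] takes a single sequence: first [b], then [x], [d] and [y] interleaved by
   residues modulo 3. *)
pose X n := if n is m.+1 then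
  (if m %% 3 == 0 then x (m %/ 3) else if m %% 3 == 1 then d (m %/ 3) else y (m %/ 3))%N else b.
have [D [sD sepD invD XD]] := separable_hull alpha X sc.
have [phi hphi] := rok D sD sepD invD.
have Dx i : D (x i) by have := XD (i * 3).+1; rewrite /X modnMl mulnK.
have Dd i : D (d i) by have := XD (i * 3 + 1).+1; rewrite /X modnMDl divnMDl //= addn0.
have Dy i : D (y i) by have := XD (i * 3 + 2).+1; rewrite /X modnMDl divnMDl //= addn0.
have [v Iv vb] := ideal_sum_term fau sD invD hphi HI Id Dx Dd Dy (XD 0%N) fb zb e4.
by exists v => //; lra.
Qed.

End FixedPointAlgebra.

(** * Saturation *)

Section Saturation.
Context {R : realType} {G : topGroupType} {A : cstarAlgType R}.
Variable alpha : cstar_action G A.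
Hypothesis hausdorff_G : hausdorff_space G.
Hypothesis compact_G : compact [set: G].
Local Notation C := (Cplx R).

Inductive kspan : (G -> A) -> Prop :=
| kspan_0 : kspan (fun=> 0)
| kspan_el a b : kspan (fun s => a ** alpha s b)
| kspan_add F F' : kspan F -> kspan F' -> kspan (fun s => F s + F' s).

Lemma kspan_sum k (F : 'I_k -> G -> A) : (forall i, kspan (F i)) ->
  kspan (fun s => \sum_i F i s).
Proof.
elim: k F => [|k IH] F H.
  by under eq_fun do rewrite big_ord0; exact: kspan_0.
under eq_fun do rewrite big_ord_recl.
by apply: kspan_add => //; exact: IH.
Qed.

Lemma continuous_mul3 (t0 : G) (k : G -> R) (s t : G) (e : R) : continuous k -> 0 < e ->
  exists2 V : set G, nbhs s V & \forall t' \near t, forall s', V s' ->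
    `|k (t0 * t'^-1 * s')%g - k (t0 * t^-1 * s)%g| <= e.
Proof.
move=> /continuousP_real ck e0.
have c1 : (fun p : G * G => p.1 * p.2)%g @ (t0 * t^-1, s)%g --> (t0 * t^-1 * s)%g.
  exact: (@mulg_continuous G (t0 * t^-1, s)%g).
have [[P Q] /= [tP sQ] PQ] := c1 _ (ck _ e e0).
exists Q => //.
have c2 : (fun t' : G => t0 * t'^-1)%g @ t --> (t0 * t^-1)%g.
  apply: (cvg_comp (fun t' : G => t'^-1)%g (fun r => t0 * r)%g).
    exact: invg_continuous.
  exact: mulg_left_continuous.
have H : \forall t' \near t, P (t0 * t'^-1)%g := c2 _ tP.
by apply: filterS H => t' Pt' s' Qs'; exact: (PQ (t0 * t'^-1, s')%g).
Qed.

(** With [h i r = k (p i * r^-1)], the translate [Lt s (h i)] takes at [t] the value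
    [k (p i * t^-1 * s)], close to [k s] if [t] is close to [p i]. So the sum of the
    [f i * Lt s (h i)] is nearly the constant [k s], and equivariance of [phi] turns it into the sum
    of the [a i ** alpha s (b i)]. *)
Lemma saturation_scalar (k : G -> R) d (e : R) : sigma_unital A -> @second_countable G ->
  rokhlin_property alpha -> continuous k -> 0 < e ->
  exists2 F, kspan F & forall s, nrm (F s - rc (k s) *: d) <= e.
Proof.
move=> su sc rok ck e0.
have [u fau] := fixed_approx_unit_exists alpha compact_G su.
have [D [sD sepD invD XD]] := separable_hull alpha (fun=> d) sc.
have Dd : D d := XD 0%N.
have [phi hphi] := rok D sD sepD invD.
have e4 : 0 < e / 4 by rewrite divr_gt0.
have d1 : 0 < nrm d + 1 by rewrite ltr_wpDl ?nrm_ge0.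
pose del := e / 4 / (nrm d + 1).
have del0 : 0 < del by rewrite divr_gt0.
have deld : del * nrm d <= e / 4.
  by rewrite /del -mulrA ger_pMr // ler_pdivrMl // mulr1 lerDl.
have HU t : \forall t' \near t, forall s, `|k (t * t'^-1 * s)%g - k s| <= del.
  apply: (near_compact compact_G) => s.
  have del2 : 0 < del / 2 by rewrite divr_gt0.
  have [V sV HV] := continuous_mul3 t s t ck del2.
  exists (V `&` [set s' | `|k s' - k s| <= del / 2]).
    by apply: filterI => //; exact: (iffLR (continuousP_real k) ck).
  apply: filterS HV => t' Ht' s' [Vs' ks']; have := Ht' s' Vs'.
  rewrite mulgV mul1g => h; move: ks' h; rewrite /= !ler_norml; lra.
have [m [p [f [f' [cff fb f1 _ fU]]]]] :=
  partition_of_unity (R := R) hausdorff_G compact_G HU.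
pose f_ i s : C := rc (f i s).
have cf i : continuous (f_ i) by apply: continuous_rc; case: (cff i).
pose h i r : C := rc (k (p i * r^-1)%g).
have ch i : continuous (h i).
  apply: continuous_rc => r; apply: (cvg_comp (fun r => p i * r^-1)%g k); last exact: ck.
  apply: (cvg_comp (fun r : G => r^-1)%g (fun r => p i * r)%g).
    exact: invg_continuous.
  exact: mulg_left_continuous.
have [a Ha] := choice (fun i => phi_ex hphi (cf i)).
have [b Hb] := choice (fun i => phi_ex hphi (ch i)).
have pa i : phi (f_ i) (a i) by case: (Ha i).
have pb i : phi (h i) (b i) by case: (Hb i).
have pt s : limsup_le (fun n => \sum_i d ** a i n ** alpha s (b i n) - rc (k s) *: d) (e / 4).
  have cL i : continuous (Lt s (h i)) by exact: continuous_Lt.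
  have pL i : phi (Lt s (h i)) (act_seq alpha s (b i)).
    by rewrite (hom_equivariant hphi) //; exists (b i).
  have [cw pw] := phi_sum hphi (fun i => continuousM_C (cf i) (cL i))
    (fun i => homM hphi (cf i) (cL i) (pa i) (pL i)).
  have R1 := Rep_sub hphi (Rep_el cw pw Dd) (Rep_cst fau hphi (subZ sD (rc (k s)) Dd)).
  have : limsup_le (fun n => (\sum_i a i n ** act_seq alpha s (b i) n) ** d - rc (k s) *: d) (e / 4).
    apply: (Rep_contr hausdorff_G compact_G fau sD hphi R1 (ltW e4)) => t; rewrite -scalerBl nrmZ; apply: le_trans deld.
    rewrite ler_wpM2r ?nrm_ge0 //.
    have -> : \sum_i f_ i t * Lt s (h i) t - rc (k s) =
        rc (\sum_i f i t * (k (p i * t^-1 * s)%g - k s)).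
      rewrite rc_sum.
      under [RHS]eq_bigr do rewrite rcM rcB mulrBr.
      rewrite sumrB -mulr_suml -rc_sum f1 rc1 mul1r; congr (_ - _).
      by apply: eq_bigr => i _; rewrite /Lt /h invgM invgK mulgA.
    rewrite cn_rc; apply: le_trans (ler_norm_sum _ _ _) _.
    rewrite -[del]mul1r -(f1 t) mulr_suml; apply: ler_sum => i _.
    have [fi0 _] := fb i t; rewrite normrM (ger0_norm fi0).
    have [Ut|/fU [-> _]] := pselect (forall s, `|k (p i * t^-1 * s)%g - k s| <= del).
      by rewrite ler_wpM2l.
    by rewrite !mul0r.
  apply: eq_mod_null_limsup.
  apply: null_seq_ext (eq_mod_null_sym (phi_comm hphi cw pw Dd)) => n.
  rewrite cmul_sumr /act_seq; under [X in _ = X - _ - _]eq_bigr do rewrite -cmulA.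
  by rewrite opprB [RHS]addrA subrK.
(* A single index must serve for all [s]; the sequences [b i] are equicontinuous. *)
have near_all : \forall n \near \oo, forall s,
    nrm (\sum_i d ** a i n ** alpha s (b i n) - rc (k s) *: d) <= e.
  apply: (near_compact compact_G) => s.
  have m0 : (0 : R) < m.+1%:R by rewrite ltr0n.
  have e4m : 0 < e / 4 / m.+1%:R by rewrite divr_gt0.
  have /choice[K HK] : forall i, exists K : R, 0 < K /\ forall n, nrm (d ** a i n) <= K.
    move=> i; have [_ [K K0 H] _] := Ha i; exists (nrm d * K + 1); split.
      by rewrite ltr_wpDl // mulr_ge0 ?nrm_ge0.
    move=> n; apply: le_trans (nrmM _ _) _; apply: le_trans (_ : nrm d * K <= _).
      by rewrite ler_wpM2l ?nrm_ge0.
    by rewrite lerDl.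
  have eq i : \forall s' \near s, forall n,
      nrm (d ** a i n ** alpha s' (b i n) - d ** a i n ** alpha s (b i n)) <= e / 4 / m.+1%:R.
    have [_ _ eb] := Hb i; have [K0 HKi] := HK i.
    apply: filterS (eb s _ (divr_gt0 e4m K0)) => s' Hs' n.
    rewrite -cmulBr; apply: le_trans (nrmM _ _) _.
    apply: le_trans (ler_pM (nrm_ge0 _) (nrm_ge0 _) (HKi n) (Hs' n)) _.
    by rewrite mulrC divfK ?gt_eqF.
  exists ([set s' | forall i n,
      nrm (d ** a i n ** alpha s' (b i n) - d ** a i n ** alpha s (b i n)) <= e / 4 / m.+1%:R]
    `&` [set s' | `|k s' - k s| <= del]).
    apply: filterI; last exact: (iffLR (continuousP_real k) ck).
    exact: (@filter_forall G 'I_m _ (nbhs s) _ eq).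
  have [N HN] := pt s _ e4; exists N => // n /HN h1 s' [h2 h3].
  have -> : \sum_i d ** a i n ** alpha s' (b i n) - rc (k s') *: d =
     (\sum_i d ** a i n ** alpha s (b i n) - rc (k s) *: d) +
     (\sum_i (d ** a i n ** alpha s' (b i n) - d ** a i n ** alpha s (b i n)) - rc (k s' - k s) *: d).
    rewrite sumrB rcB; set X := \sum_i d ** a i n ** alpha s' (b i n).
    by set Y := \sum_i d ** a i n ** alpha s (b i n); lmod_ring.
  apply: le_trans (nrmD _ _) _; apply: le_trans (lerD h1 (nrmB _ _)) _.
  have h4 : nrm (rc (k s' - k s) *: d) <= e / 4.
    by rewrite nrmZ cn_rc; apply: le_trans deld; rewrite ler_wpM2r ?nrm_ge0.
  have h5 : nrm (\sum_i (d ** a i n ** alpha s' (b i n) - d ** a i n ** alpha s (b i n))) <= e / 4.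
    apply: le_trans (nrm_sum _ _ _) _; apply: le_trans (ler_sum _ (fun i _ => h2 i n)) _.
    rewrite sumr_const card_ord -[X in X <= _]mulr_natl mulrA ler_pdivrMr // mulrC.
    by rewrite ler_pM2l // ler_nat.
  by lra.
case: near_all => N _ /(_ N (leqnn N)) HN.
exists (fun s => \sum_i d ** a i N ** alpha s (b i N)) => //.
by apply: kspan_sum => i; exact: kspan_el.
Qed.

Lemma saturation (f : G -> A) (e : R) : sigma_unital A -> @second_countable G ->
  rokhlin_property alpha -> continuous f -> 0 < e ->
  exists2 F, kspan F & forall s, nrm (F s - f s) <= e.
Proof.
move=> su sc rok cf e0.
have e2 : 0 < e / 2 by rewrite divr_gt0.
have HU t : \forall t' \near t, nrm (f t' - f t) <= e / 2.
  exact: (iffLR (continuousP_nrm f) cf).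
have [m [p [h [h' [cff fb f1 _ fU]]]]] :=
  partition_of_unity (R := R) hausdorff_G compact_G HU.
have m0 : (0 : R) < m.+1%:R by rewrite ltr0n.
have e2m : 0 < e / 2 / m.+1%:R by rewrite divr_gt0.
have /choice[F HF] : forall i, exists F, kspan F /\
    forall s, nrm (F s - rc (h i s) *: f (p i)) <= e / 2 / m.+1%:R.
  move=> i; have [F ? ?] := saturation_scalar (f (p i)) su sc rok (cff i).1 e2m.
  by exists F.
exists (fun s => \sum_i F i s); first by apply: kspan_sum => i; case: (HF i).
move=> s; apply: le_trans (nrm_tri (\sum_i rc (h i s) *: f (p i)) _ _) _.
have h1 : nrm (\sum_i F i s - \sum_i rc (h i s) *: f (p i)) <= e / 2.
  rewrite -sumrB; apply: le_trans (nrm_sum _ _ _) _.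
  apply: le_trans (ler_sum _ (fun i _ => (HF i).2 s)) _.
  rewrite sumr_const card_ord -[X in X <= _]mulr_natl mulrA ler_pdivrMr // mulrC.
  by rewrite ler_pM2l // ler_nat.
have h2 : nrm (\sum_i rc (h i s) *: f (p i) - f s) <= e / 2.
  have -> : \sum_i rc (h i s) *: f (p i) - f s = \sum_i rc (h i s) *: (f (p i) - f s).
    under [RHS]eq_bigr do rewrite scalerBr.
    by rewrite sumrB -scaler_suml -rc_sum f1 rc1 scale1r.
  apply: le_trans (nrm_sum _ _ _) _.
  have -> : e / 2 = \sum_i h i s * (e / 2) by rewrite -mulr_suml f1 mul1r.
  apply: ler_sum => i _; have [hi0 _] := fb i s; rewrite nrmZr //.
  have [Us|/fU [-> _]] := pselect (nrm (f s - f (p i)) <= e / 2).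
    by rewrite ler_wpM2l // nrmC.
  by rewrite !mul0r.
by lra.
Qed.

End Saturation.

(** * The Haar integral *)

Section Integral.
Context {R : realType} {G : topGroupType}.
Local Notation C := (Cplx R).
Hypothesis compact_G : compact [set: G].
Variable mu : probability (borel G) R.

Definition fmu (E : set (borel G)) : R := fine (mu E).

Lemma fmu_ge0 E : 0 <= fmu E. Proof. exact: fine_ge0. Qed.

Lemma open_borel (U : set G) : open U -> measurable (U : set (borel G)).
Proof. by move=> oU; apply: sub_sigma_algebra. Qed.

Definition borel_partition n (E : 'I_n -> set (borel G)) : Prop :=
  [/\ forall i, measurable (E i), trivIset setT E & \bigcup_i E i = setT].

Lemma fmu_part n (E : 'I_n -> set (borel G)) (B : set (borel G)) : borel_partition E -> measurable B ->
  fmu B = \sum_i fmu (E i `&` B).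
Proof.
move=> [mE tE cE] mB.
have fin i : mu (E i `&` B) \is a fin_num by apply: fin_num_measure; exact: measurableI.
have := measure_bigsetU_ord mu xpredT (fun i => measurableI _ _ (mE i) mB) (@trivIset_setIr _ _ _ E (fun=> B) tE).
have -> : \big[setU/set0]_(i < n) (E i `&` B) = B.
  rewrite -bigcup_seq /=; apply/seteqP; split=> s; first by case=> i _ [].
  move=> Bs; have : (\bigcup_i E i) s by rewrite cE.
  by case=> i _ Eis; exists i => //=; rewrite mem_index_enum.
by rewrite /fmu => ->; rewrite sum_fine.
Qed.

Lemma fmu_sum1 n (E : 'I_n -> set (borel G)) : borel_partition E -> \sum_i fmu (E i) = 1.
Proof.
move=> pE; have := fmu_part pE (measurableT).
rewrite /fmu probability_setT /= => ->; by apply: eq_bigr => i _; rewrite setIT.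
Qed.

Lemma fine_partition (U : G -> set G) : (forall g, nbhs g (U g)) ->
  exists n (E : 'I_n -> set (borel G)) (p : 'I_n -> G),
    borel_partition E /\ forall i s, E i s -> U (p i) s.
Proof.
move=> HU.
have [g|sq Hs] := finite_subcover compact_G (U := fun g => (U g)^°).
  exact: nbhs_interior.
pose F k : set (borel G) := if (k < size sq)%N then (U (nth 1%g sq k))^° else set0.
have mF k : measurable (F k).
  rewrite /F; case: ifP => _; last exact: measurable0.
  by apply: open_borel; exact: open_interior.
exists (size sq), (fun i => seqDU F i), (fun i => nth 1%g sq i); split; last first.
  move=> i s [+ _]; rewrite /F ltn_ord; exact: interior_subset.
split.
- by move=> i; exact: seqDU_measurable.
- have := trivIset_seqDU F => /trivIsetP H; apply/trivIsetP => i j _ _ ij; exact: H.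
apply/seteqP; split=> // s _; have [g gs gU] := Hs s.
have : (\bigcup_k F k) s.
  by exists (index g sq) => //; rewrite /F index_mem gs nth_index.
rewrite seqDU_bigcup_eq => -[k _ Fk].
have ks : (k < size sq)%N by case: Fk => + _; rewrite /F; case: ifP.
by exists (Ordinal ks).
Qed.

Lemma measurable_cont (f : G -> R) : continuous f ->
  measurable_fun (setT : set (borel G)) (f : borel G -> R).
Proof.
move=> cf; apply: (measurability _ (RGenOInfty.measurableE R)) => _ [_ [x ->] <-].
rewrite setTI; apply: open_borel; apply: open_comp; first by move=> t _; exact: cf.
exact: interval_open.
Qed.

Section Module.
Variable A : cstarAlgType R.

Definition rsum n (E : 'I_n -> set (borel G)) (x : 'I_n -> A) : A :=
  \sum_i rc (fmu (E i)) *: x i.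


(** Both sums are rewritten over the common refinement. A cell with a point forces [x i] and [y j]
    to be close, and an empty cell has measure 0. *)
Lemma rsum_compare n m (E : 'I_n -> set (borel G)) (F : 'I_m -> set (borel G)) x y (e : R) :
  borel_partition E -> borel_partition F -> (forall i j s, E i s -> F j s -> nrm (x i - y j) <= e) ->
  nrm (rsum E x - rsum F y) <= e.
Proof.
move=> pE pF H; have [mE _ _] := pE; have [mF _ _] := pF.
have -> : rsum E x = \sum_i \sum_j rc (fmu (F j `&` E i)) *: x i.
  by apply: eq_bigr => i _; rewrite (fmu_part pF (mE i)) rc_sum scaler_suml.
have -> : rsum F y = \sum_i \sum_j rc (fmu (F j `&` E i)) *: y j.
  rewrite exchange_big /=; apply: eq_bigr => j _.
  rewrite (fmu_part pE (mF j)) rc_sum scaler_suml; apply: eq_bigr => i _.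
  by rewrite setIC.
rewrite -sumrB; apply: le_trans (nrm_sum _ _ _) _.
rewrite -[e]mul1r -(fmu_sum1 pE) mulr_suml; apply: ler_sum => i _.
rewrite -sumrB; apply: le_trans (nrm_sum _ _ _) _.
rewrite (fmu_part pF (mE i)) mulr_suml; apply: ler_sum => j _.
rewrite -scalerBr nrmZr ?fmu_ge0 //.
have [[s [Fs Es]]|/set0P/negP/negPn/eqP ->] := pselect (F j `&` E i !=set0).
  by apply: ler_wpM2l; [exact: fmu_ge0|exact: H Es Fs].
by rewrite /fmu measure0 /= !mul0r.
Qed.

Local Notation I := (integral_A mu).

Lemma is_integralP (f : G -> A) v : is_integral mu f v <->
  forall e : R, 0 < e -> exists n (E : 'I_n -> set (borel G)) (x : 'I_n -> A),
    [/\ borel_partition E, forall i s, E i s -> nrm (f s - x i) <= e & nrm (v - rsum E x) <= e].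
Proof.
split=> H e.
  move=> e0; have := H (rc e); rewrite -rc0 rc_lt => /(_ e0)[n [E [x [h1 h2 h3 h4 h5]]]].
  exists n, E, x; split=> // [i s Es|].
    by have := h4 i s Es; rewrite nrmE rc_le.
  by move: h5; rewrite nrmE rc_le.
move=> /posC[r r0 ->]; have [n [E [x [[h1 h2 h3] h4 h5]]]] := H r r0.
exists n, E, x; split=> // [i s Es|]; first by rewrite nrmE rc_le; exact: h4 Es.
by rewrite nrmE rc_le.
Qed.

(** By [rsum_compare], step sums for the tolerances [1 / (k + 1)] form a Cauchy sequence. *)
Lemma integral_ex (f : G -> A) : continuous f -> exists v, is_integral mu f v.
Proof.
move=> cf.
have /choice[P HP] : forall k : nat, exists S : A,
  exists n (E : 'I_n -> set (borel G)) (x : 'I_n -> A),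
    [/\ borel_partition E, forall i s, E i s -> nrm (f s - x i) <= k.+1%:R^-1 & S = rsum E x].
  move=> k; have := fine_partition (fun g => iffLR (continuousP_nrm f) cf g _ (invS_gt0 k)).
  by move=> [n [E [p [pE HE]]]]; exists (rsum E (f \o p)), n, E, (f \o p); split.
have PP k l : nrm (P k - P l) <= k.+1%:R^-1 + l.+1%:R^-1.
  have [n [E [x [pE HE ->]]]] := HP k; have [m [F [y [pF HF ->]]]] := HP l.
  apply: rsum_compare => // i j s Es Fs; apply: le_trans (nrm_tri (f s) _ _) _.
  by apply: lerD; [rewrite nrmC; exact: HE Es|exact: HF Fs].
have [|v /cvg_seqP Pv] := cauchy_seqP (u := P).
  move=> e e0; have [N HN] := inv_small (divr_gt0 e0 (ltr0n _ 2)); exists N => k l /HN h1 /HN h2.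
  by apply: le_trans (PP k l) _; rewrite [e]splitr lerD.
exists v; apply/is_integralP => e e0; have [N HN] := inv_small e0; have [N' HN'] := Pv _ e0.
pose k := maxn N N'.
have [n [E [x [pE HE PE]]]] := HP k; exists n, E, x; split=> //.
  by move=> i s Es; apply: le_trans (HE _ _ Es) (HN _ (leq_maxl _ _)).
by rewrite -PE nrmC; apply: HN'; exact: leq_maxr.
Qed.

Lemma integral_approx (f : G -> A) n (E : 'I_n -> set (borel G)) x (e : R) : continuous f ->
  borel_partition E -> (forall i s, E i s -> nrm (f s - x i) <= e) -> nrm (I f - rsum E x) <= e.
Proof.
move=> cf pE HE; have H : is_integral mu f (I f).
  by rewrite /integral_A; case: xgetP => [y _ //|]; have [v Hv] := integral_ex cf => /(_ v).
apply/ler_addgt0Pr => d d0; have d2 : 0 < d / 2 by rewrite divr_gt0.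
have /is_integralP/(_ _ d2)[m [F [y [pF HF vF]]]] := H.
apply: le_trans (nrm_tri (rsum F y) _ _) _.
have : nrm (rsum F y - rsum E x) <= d / 2 + e.
  apply: rsum_compare => // i j s Fs Es; apply: le_trans (nrm_tri (f s) _ _) _.
  by apply: lerD; [rewrite nrmC; exact: HF Fs|exact: HE Es].
by lra.
Qed.

Lemma integral_uniq (f : G -> A) v : continuous f ->
  (forall e : R, 0 < e -> exists n (E : 'I_n -> set (borel G)) (x : 'I_n -> A),
    [/\ borel_partition E, forall i s, E i s -> nrm (f s - x i) <= e & nrm (v - rsum E x) <= e]) ->
  I f = v.
Proof.
move=> cf H; apply/eqP; rewrite -subr_eq0; apply/eqP/nrm_le0/ler_addgt0Pr => e e0.
have [n [E [x [pE HE vE]]]] := H _ (divr_gt0 e0 (ltr0n _ 2)).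
have := integral_approx cf pE HE; have := nrm_tri (rsum E x) (I f) v.
by rewrite (nrmC (rsum E x) v); lra.
Qed.

Lemma integral_ext (f h : G -> A) : f =1 h -> I f = I h.
Proof. by move=> /funext ->. Qed.

Lemma integral_near (f h : G -> A) M : continuous f -> continuous h ->
  (forall s, nrm (f s - h s) <= M) -> nrm (I f - I h) <= M.
Proof.
move=> cf ch H; apply/ler_addgt0Pr => d d0; have d2 : 0 < d / 2 by rewrite divr_gt0.
have [n [E [p [pE HE]]]] := fine_partition (fun g => iffLR (continuousP_nrm f) cf g _ d2).
have h1 := integral_approx cf pE HE.
have h2 : nrm (I h - rsum E (f \o p)) <= M + d / 2.
  apply: integral_approx => // i s Es; apply: le_trans (nrm_tri (f s) _ _) _.
  by rewrite nrmC; apply: lerD; [exact: H|exact: HE Es].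
by apply: le_trans (nrm_tri (rsum E (f \o p)) _ _) _; rewrite [X in _ + X]nrmC; lra.
Qed.

Lemma integral_cst (a : A) : I (fun=> a) = a.
Proof.
apply: integral_uniq => [t|e e0]; first exact: cvg_cst.
have [n [E [p [pE _]]]] := @fine_partition (fun=> setT) (fun g => filterT).
exists n, E, (fun=> a); split=> // [i s _|]; first by rewrite subrr nrm0 ltW.
by rewrite /rsum -scaler_suml -rc_sum (fmu_sum1 pE) rc1 scale1r subrr nrm0 ltW.
Qed.

Lemma integral_le (f : G -> A) M : continuous f -> (forall s, nrm (f s) <= M) -> nrm (I f) <= M.
Proof.
move=> cf fM; rewrite -[I f]subr0 -(integral_cst 0); apply: integral_near => //.
  by move=> t; exact: cvg_cst.
by move=> s; rewrite subr0.
Qed.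

Lemma continuousD_A (f h : G -> A) : continuous f -> continuous h ->
  continuous (fun s => f s + h s).
Proof. by move=> cf ch t; apply: cvgD; [exact: cf|exact: ch]. Qed.

Lemma integralD (f h : G -> A) : continuous f -> continuous h ->
  I (fun s => f s + h s) = I f + I h.
Proof.
move=> cf ch; apply: integral_uniq => [|e e0]; first exact: continuousD_A.
have e2 : 0 < e / 2 by rewrite divr_gt0.
have [n [E [p [pE HE]]]] := fine_partition (fun g =>
  filterI (iffLR (continuousP_nrm f) cf g _ e2) (iffLR (continuousP_nrm h) ch g _ e2)).
have HE1 i s : E i s -> nrm (f s - f (p i)) <= e / 2 by case/HE.
have HE2 i s : E i s -> nrm (h s - h (p i)) <= e / 2 by case/HE.
exists n, E, (fun i => f (p i) + h (p i)); split=> // [i s Es|].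
  have -> : f s + h s - (f (p i) + h (p i)) = (f s - f (p i)) + (h s - h (p i)) by lmod_ring.
  by apply: le_trans (nrmD _ _) _; have := HE1 i s Es; have := HE2 i s Es; lra.
have -> : rsum E (fun i => f (p i) + h (p i)) = rsum E (f \o p) + rsum E (h \o p).
  by rewrite /rsum -big_split; apply: eq_bigr => i _; rewrite scalerDr.
have h1 := integral_approx cf pE HE1; have h2 := integral_approx ch pE HE2.
rewrite opprD addrACA; apply: le_trans (nrmD _ _) _; lra.
Qed.

End Module.

(** Homogeneity is asked for real scalars, so that the conjugate linear map [star] is covered. *)
Lemma integral_lin (A B : cstarAlgType R) (L : A -> B) (K : R) (f : G -> A) : continuous f ->
  {morph L : x y / x + y} -> (forall (r : R) x, L (rc r *: x) = rc r *: L x) ->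
  (forall x, nrm (L x) <= K * nrm x) ->
  continuous (fun s => L (f s)) /\ integral_A mu (fun s => L (f s)) = L (integral_A mu f).
Proof.
move=> cf LD LZ LK.
have LB x y : L (x - y) = L x - L y.
  by rewrite -scaleN1r -rc1 -rcN LD LZ rcN rc1 scaleN1r.
have K0 : 0 < `|K| + 1 by rewrite ltr_wpDl.
have LK' x : nrm (L x) <= (`|K| + 1) * nrm x.
  apply: le_trans (LK x) _; rewrite ler_wpM2r ?nrm_ge0 //.
  by rewrite (le_trans (ler_norm K)) // lerDl.
have cLf : continuous (fun s => L (f s)).
  apply/continuousP_nrm => t e e0.
  apply: filterS (iffLR (continuousP_nrm f) cf t _ (divr_gt0 e0 K0)) => s H.
  by rewrite -LB (le_trans (LK' _)) // mulrC -ler_pdivlMr.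
split=> //; apply: integral_uniq => // e e0.
have [n [E [p [pE HE]]]] := fine_partition (fun g => iffLR (continuousP_nrm f) cf g _ (divr_gt0 e0 K0)).
exists n, E, (fun i => L (f (p i))); split=> // [i s Es|].
  by rewrite -LB (le_trans (LK' _)) // mulrC -ler_pdivlMr //; exact: HE Es.
have -> : rsum E (fun i => L (f (p i))) = L (rsum E (f \o p)).
  have L0 : L 0 = 0 by apply: (addrI (L 0)); rewrite -LD !addr0.
  by rewrite /rsum; elim/big_rec2: _ => // i x y _ ->; rewrite LD LZ.
rewrite -LB (le_trans (LK' _)) // mulrC -ler_pdivlMr //.
exact: integral_approx.
Qed.

(** * Invariance of the integral and Fubini *)

Section Invariance.
Variable A : cstarAlgType R.
Local Notation I := (integral_A mu).
Implicit Types f h : G -> A.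
Hypothesis haar_mu : haar mu.

Lemma measurable_left (g : G) (B : set (borel G)) : measurable B ->
  measurable ([set s | B (g * s)%g] : set (borel G)).
Proof.
move=> mB; apply: (@smallest_sub _ (sigma_algebra setT) open [set B : set (borel G) | measurable ([set s | B (g * s)%g] : set (borel G))] _ _ B mB) => /=.
- split=> /=.
  + exact: measurable0.
  + move=> D mD; have -> : [set s | ([set: G] `\` D) (g * s)%g] = ~` [set s | D (g * s)%g].
      by apply/seteqP; split=> s /=; [case|].
    exact: measurableC.
  + by move=> F mF; exact: (bigcup_measurable (fun k _ => mF k)).
move=> U oU /=; apply: open_borel; apply: open_comp oU => t _; exact: mulg_left_continuous.
Qed.

Lemma fmu_left (g : G) (B : set (borel G)) : measurable B ->
  fmu [set s | B (g * s)%g] = fmu B.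
Proof.
move=> mB; rewrite /fmu; congr fine; rewrite -(haar_mu g (measurable_left g mB)); congr (mu _).
apply/seteqP; split=> s /=; first by case=> t Bt <-.
by move=> Bs; exists (g^-1 * s)%g; rewrite mulgA mulgV mul1g.
Qed.

Lemma continuous_left f g : continuous f -> continuous (fun s => f (g * s)%g).
Proof.
by move=> cf t; apply: (cvg_comp (fun s => g * s)%g f); [exact: mulg_left_continuous|exact: cf].
Qed.

Lemma integral_left f g : continuous f -> I (fun s => f (g * s)%g) = I f.
Proof.
move=> cf; apply: integral_uniq => [|e e0]; first exact: continuous_left.
have [n [E [p [pE HE]]]] := fine_partition (fun g => iffLR (continuousP_nrm f) cf g _ e0).
have [mE tE cE] := pE.
exists n, (fun i => [set s | E i (g * s)%g]), (f \o p); split.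
- split.
  + by move=> i; exact: measurable_left.
  + apply/trivIsetP => i j _ _ ij; have /trivIsetP/(_ i j Logic.I Logic.I ij) H := tE.
    by apply/seteqP; split=> s //= [Ei Ej]; have : (E i `&` E j) (g * s)%g by []; rewrite H.
  + apply/seteqP; split=> s // _; have : (\bigcup_i E i) (g * s)%g by rewrite cE.
    by case=> i _ Ei; exists i.
- by move=> i s /= /HE.
have -> : rsum (fun i => [set s | E i (g * s)%g]) (f \o p) = rsum E (f \o p).
  by apply: eq_bigr => i _; rewrite fmu_left.
exact: integral_approx.
Qed.

Definition jointly_continuous (F : G -> G -> A) : Prop := forall (r s : G) (e : R), 0 < e ->
  exists2 P : set G, nbhs r P & exists2 Q : set G, nbhs s Q &
    forall r' s', P r' -> Q s' -> nrm (F r' s' - F r s) <= e.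

(** Compactness makes continuity in [r] uniform in [s], which is what integration over [s]
    requires. *)
Lemma continuous_integral (F : G -> G -> A) : jointly_continuous F ->
  [/\ forall r, continuous (F r), forall s, continuous (F^~ s),
      forall r (e : R), 0 < e -> \forall r' \near r, forall s, nrm (F r' s - F r s) <= e &
      continuous (fun r => I (F r))].
Proof.
move=> cF.
have c1 r : continuous (F r).
  apply/continuousP_nrm => s e e0; have [P rP [Q sQ PQ]] := cF r s e e0.
  by apply: filterS sQ => s' Qs'; apply: PQ Qs'; exact: nbhs_singleton rP.
have c2 s : continuous (F^~ s).
  apply/continuousP_nrm => r e e0; have [P rP [Q sQ PQ]] := cF r s e e0.
  by apply: filterS rP => r' Pr'; apply: PQ Pr' _; exact: nbhs_singleton sQ.
have c3 r (e : R) : 0 < e -> \forall r' \near r, forall s, nrm (F r' s - F r s) <= e.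
  move=> e0; apply: (near_compact compact_G) => s; have e2 : 0 < e / 2 by rewrite divr_gt0.
  have [P rP [Q sQ PQ]] := cF r s _ e2.
  exists Q => //; apply: filterS (rP) => r' Pr' s' Qs'.
  have h1 := PQ r' s' Pr' Qs'; have h2 := PQ r s' (nbhs_singleton rP) Qs'.
  by apply: le_trans (nrm_tri (F r s) _ _) _; rewrite [X in _ + X]nrmC; lra.
split=> //; apply/continuousP_nrm => r e e0; apply: filterS (c3 r e e0) => r' H.
exact: integral_near.
Qed.

Lemma integral_rsum n (E : 'I_n -> set (borel G)) (F : 'I_n -> G -> A) : (forall i, continuous (F i)) ->
  continuous (fun s => rsum E (F^~ s)) /\ I (fun s => rsum E (F^~ s)) = rsum E (fun i => I (F i)).
Proof.
rewrite /rsum; elim: n E F => [|n IH] E F cF.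
  under eq_fun do rewrite big_ord0; rewrite big_ord0; split; last first.
    exact: integral_cst.
  by move=> t; exact: cvg_cst.
have hZ (x : A) : nrm (rc (fmu (E ord0)) *: x) <= fmu (E ord0) * nrm x.
  by rewrite nrmZr ?fmu_ge0.
have [cZ IZ] := @integral_lin A A (fun x => rc (fmu (E ord0)) *: x) (fmu (E ord0)) (F ord0) (cF ord0)
  (scalerDr _) (fun r x => etrans (scalerA _ _ _) (etrans (congr1 (fun c => c *: x) (mulrC _ _)) (esym (scalerA _ _ _))))
  hZ.
have [cS IS] := IH (fun i => E (lift ord0 i)) (fun i => F (lift ord0 i)) (fun i => cF _).
have EE : (fun s => \sum_(i < n.+1) rc (fmu (E i)) *: F i s) =
  (fun s => rc (fmu (E ord0)) *: F ord0 s + \sum_(i < n) rc (fmu (E (lift ord0 i))) *: F (lift ord0 i) s).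
  by apply/funext => s; rewrite big_ord_recl.
rewrite EE; split; first exact: continuousD_A.
by rewrite integralD // IZ IS big_ord_recl.
Qed.

Lemma jointly_continuous_swap F : jointly_continuous F -> jointly_continuous (fun s r => F r s).
Proof.
move=> cF r s e e0; have [P rP [Q sQ PQ]] := cF s r e e0.
by exists Q => //; exists P => // r' s' Qr' Ps'; exact: PQ.
Qed.

(** No product measure enters: a partition in [r], fine enough uniformly in [s], replaces one
    integral by a finite sum, which commutes with the other. *)
Lemma fubini (F : G -> G -> A) : jointly_continuous F ->
  I (fun r => I (F r)) = I (fun s => I (F^~ s)).
Proof.
move=> cF; have [c1 c2 c3 c4] := continuous_integral cF.
have [_ _ _ c4'] := continuous_integral (jointly_continuous_swap cF).
apply: integral_uniq => // e e0.
have [n [E [p [pE HE]]]] := fine_partition (fun r => c3 r e e0).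
exists n, E, (fun i => I (F (p i))); split=> // [i r Er|].
  by apply: integral_near => // s; exact: HE Er s.
have [cR IR] := integral_rsum E (fun i => c1 (p i)).
rewrite -IR; apply: integral_near => // s.
by apply: integral_approx => // i r Er; exact: HE Er s.
Qed.

Lemma continuous_inv f : continuous f -> continuous (fun s => f s^-1%g).
Proof.
by move=> cf t; apply: (cvg_comp (fun s : G => s^-1)%g f); [exact: invg_continuous|exact: cf].
Qed.

(* Integrate [f (s^-1 r)] in both orders. *)
Lemma integral_inv f : continuous f -> I (fun s => f s^-1%g) = I f.
Proof.
move=> cf; pose F s r := f (s^-1 * r)%g.
have cF : jointly_continuous F.
  move=> s r e e0.
  have [[P Q] /= [sP rQ] PQ] := @mulg_continuous G (s^-1, r)%g _ (iffLR (continuousP_nrm f) cf _ _ e0).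
  exists [set s | P s^-1%g]; first exact: (@invg_continuous G s _ sP).
  by exists Q => // s' r' Ps' Qr'; exact: (PQ (s'^-1, r')%g).
have := fubini cF.
have -> : (fun s => I (F s)) = (fun=> I f).
  by apply/funext => s; exact: integral_left.
rewrite integral_cst => ->.
have -> : (fun r => I (F^~ r)) = (fun=> I (fun s => f s^-1%g)).
  apply/funext => r; have [_ c2 _ _] := continuous_integral cF.
  rewrite -(@integral_left (F^~ r) r) //; apply: integral_ext => s.
  by rewrite /F invgM -mulgA mulVg mulg1.
by rewrite integral_cst.
Qed.

(** Right translation is left translation between two inversions. *)
Lemma integral_right f g : continuous f ->
  continuous (fun s => f (s * g)%g) /\ I (fun s => f (s * g)%g) = I f.
Proof.
move=> cf; have E : (fun s => f (s * g)%g) = (fun s => f (g^-1 * s^-1)^-1%g).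
  by apply/funext => s; rewrite invgM !invgK.
have c1 := continuous_inv cf.
have c2 := continuous_left (g := g^-1%g) c1.
rewrite E; split; first exact: (continuous_inv c2).
by rewrite (integral_inv c2) (integral_left _ c1) integral_inv.
Qed.

End Invariance.

(** * Step sums and the L1 norm *)

Section L1.
Variable A : cstarAlgType R.
Implicit Types f : G -> A.

Lemma nrm_continuous f : continuous f -> continuous (fun s => nrm (f s)).
Proof.
move=> /continuousP_nrm cf; apply/continuousP_real => t e e0.
apply: filterS (cf t e e0) => s; apply: le_trans; rewrite ler_norml.
have := nrm_le_sub (f s) (f t); have := nrm_le_sub (f t) (f s).
by rewrite (nrmC (f t)); lra.
Qed.

Lemma nrm_bounded f : continuous f -> exists M, forall s, nrm (f s) <= M.
Proof.
move=> cf; have [n [E [p [[_ _ cE] HE]]]] :=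
  fine_partition (fun g => iffLR (continuousP_nrm f) cf g _ ltr01).
exists (\sum_i nrm (f (p i)) + 1) => s.
have : (\bigcup_i E i) s by rewrite cE.
case=> i _ /HE h; have := nrm_le_sub (f s) (f (p i)).
rewrite (bigD1 i) //=; have : 0 <= \sum_(j | j != i) nrm (f (p j)).
  by apply: sumr_ge0 => j _; exact: nrm_ge0.
by lra.
Qed.

Lemma nrm_integrable f : continuous f -> mu.-integrable setT (EFin \o (fun s : borel G => nrm (f s))).
Proof.
move=> cf; apply: measurable_bounded_integrable => //.
- exact: le_lt_trans (probability_le1 mu measurableT) (ltry 1).
- exact: (measurable_cont (nrm_continuous cf)).
have [M HM] := nrm_bounded cf; exists M; split; first exact: num_real.
by move=> x Mx s _ /=; rewrite ger0_norm ?nrm_ge0 // (le_trans (HM s)) // ltW.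
Qed.

Lemma L1norm_le f M : continuous f -> (forall s, nrm (f s) <= M) -> L1norm mu f <= M.
Proof.
move=> cf fM; have -> : M = \int[mu]_(s in setT) M.
  rewrite Rintegral_cst // [X in _ * X](_ : _ = 1) ?mulr1 //.
  exact: (congr1 fine (probability_setT mu)).
apply: le_Rintegral => //; first exact: nrm_integrable.
apply: measurable_bounded_integrable => //; first exact: le_lt_trans (probability_le1 mu measurableT) (ltry 1).
exists `|M|; split; first exact: num_real.
  by move=> x Mx s _; exact: ltW.
by move=> s _; exact: fM.
Qed.

(** Links the Lebesgue integral in [L1norm] with the step sums behind [integral_A]; [intop_en] needs
    it to get a bound by the L1 norm and not only by the sup norm. *)
Lemma L1norm_ge f n (E : 'I_n -> set (borel G)) (x : 'I_n -> A) (e : R) : continuous f ->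
  borel_partition E -> (forall i s, E i s -> nrm (f s - x i) <= e) ->
  \sum_i fmu (E i) * nrm (x i) <= L1norm mu f + e.
Proof.
move=> cf pE HE; have [mE tE cE] := pE.
have fi := nrm_integrable cf.
have mf := measurable_cont (nrm_continuous cf).
have -> : L1norm mu f = \sum_i \int[mu]_(s in E i) nrm (f s).
  have cE' : \big[setU/set0]_(i < n) E i = setT.
    rewrite -bigcup_seq /=; apply/seteqP; split=> // s _; have : (\bigcup_i E i) s by rewrite cE.
    by case=> i _ Eis; exists i => //=; rewrite mem_index_enum.
  rewrite /L1norm /Rintegral -cE' integral_bigsetU_EFin //.
  - rewrite -sum_fine // => i _; apply: integrable_fin_num => //.
    exact: integrableS fi.
  - exact: index_enum_uniq.
  - by apply: sub_trivIset tE.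
  - rewrite cE'; exact/measurable_EFinP.
rewrite -[e]mul1r -(fmu_sum1 pE) mulr_suml -big_split /=; apply: ler_sum => i _.
rewrite -lerBlDr -mulrBr mulrC -Rintegral_cst //.
apply: le_Rintegral => //.
- apply: measurable_bounded_integrable => //; first exact: le_lt_trans (probability_le1 mu (mE i)) (ltry 1).
  exists `|nrm (x i) - e|; split; first exact: num_real.
  by move=> y My s _; exact: ltW.
- exact: integrableS fi.
move=> s Es; have := HE i s Es; have := nrm_le_sub (x i) (f s); rewrite nrmC; lra.
Qed.

End L1.

End Integral.

(** * Hilbert modules *)

Section WSpace.
Variable R : realType.
Local Notation C := (Cplx R).

(* Both the completion of a pre-Hilbert module and the algebra of adjointable operators
   are complete spaces of functions [f] with [nrm (f x) <= M * w x] for some [M], the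
   least such [M] being the norm of [f]. *)
Record wspace := WSpace {
  ws_dom : Type;
  ws_cod : completeNormedModType C;
  ws_w : ws_dom -> R;
  ws_set : (ws_dom -> ws_cod) -> Prop;
  ws_w_ge0 : forall x, 0 <= ws_w x;
  ws_0 : ws_set (fun=> 0);
  ws_D : forall f g, ws_set f -> ws_set g -> ws_set (fun x => f x + g x);
  ws_Z : forall (c : C) f, ws_set f -> ws_set (fun x => c *: f x);
  ws_bdd : forall f, ws_set f -> exists M : R, 0 <= M /\ forall x, nrm (f x) <= M * ws_w x;
  ws_closed : forall f, (forall e : R, 0 < e -> exists g, ws_set g /\
    forall x, nrm (f x - g x) <= e * ws_w x) -> ws_set f
}.

Record wtype (W : wspace) := Wtype { wfun :> ws_dom W -> ws_cod W; wfunP : ws_set wfun }.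

HB.instance Definition _ W := gen_eqMixin (wtype W).
HB.instance Definition _ W := gen_choiceMixin (wtype W).

Section Structure.
Variable W : wspace.
Implicit Types f g h : wtype W.

Lemma wtype_eq f g : (forall x, f x = g x) -> f = g.
Proof.
case: f g => [f fP] [g gP] /= /funext E; case: _ / E in gP *.
by congr Wtype; exact: Prop_irrelevance.
Qed.

Definition wzero : wtype W := Wtype (ws_0 W).
Definition wadd f g : wtype W := Wtype (ws_D (wfunP f) (wfunP g)).
Definition wscale (c : C) f : wtype W := Wtype (ws_Z c (wfunP f)).
Definition wopp f : wtype W := wscale (-1) f.

Lemma waddA : associative wadd.
Proof. by move=> f g h; apply: wtype_eq => x /=; rewrite addrA. Qed.
Lemma waddC : commutative wadd.
Proof. by move=> f g; apply: wtype_eq => x /=; rewrite addrC. Qed.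
Lemma wadd0 : left_id wzero wadd.
Proof. by move=> f; apply: wtype_eq => x /=; rewrite add0r. Qed.
Lemma waddN : left_inverse wzero wopp wadd.
Proof. by move=> f; apply: wtype_eq => x /=; rewrite scaleN1r addNr. Qed.
HB.instance Definition _ := GRing.isZmodule.Build (wtype W) waddA waddC wadd0 waddN.

Lemma wscaleA a b f : wscale a (wscale b f) = wscale (a * b) f.
Proof. by apply: wtype_eq => x /=; rewrite scalerA. Qed.
Lemma wscale1 : left_id 1 wscale.
Proof. by move=> f; apply: wtype_eq => x /=; rewrite scale1r. Qed.
Lemma wscaleDr : right_distributive wscale +%R.
Proof. by move=> c f g; apply: wtype_eq => x /=; rewrite scalerDr. Qed.
Lemma wscaleDl f : {morph wscale^~ f : a b / a + b}.
Proof. by move=> a b; apply: wtype_eq => x /=; rewrite scalerDl. Qed.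
HB.instance Definition _ := GRing.Zmodule_isLmodule.Build C (wtype W)
  wscaleA wscale1 wscaleDr wscaleDl.

Definition wbounds f : set R := [set M | 0 <= M /\ forall x, nrm (f x) <= M * ws_w x].
Definition wnrm f : R := inf (wbounds f).

Lemma wbounds_inf f : has_inf (wbounds f).
Proof.
split; first by have [M HM] := ws_bdd (wfunP f); exists M.
by exists 0 => M [].
Qed.

Lemma wnrm_ge0 f : 0 <= wnrm f.
Proof. by apply: lb_le_inf; [case: (wbounds_inf f)|move=> M []]. Qed.

Lemma wnrm_le f (M : R) : 0 <= M -> (forall x, nrm (f x) <= M * ws_w x) -> wnrm f <= M.
Proof. by move=> M0 H; apply: ge_inf; [case: (wbounds_inf f)|]. Qed.

Lemma wnrm_bound f x : nrm (f x) <= wnrm f * ws_w x.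
Proof.
have [w0|w0] := eqVneq (ws_w x) 0.
  by have [M [_ /(_ x)]] := ws_bdd (wfunP f); rewrite w0 !mulr0.
have wp : 0 < ws_w x by rewrite lt_neqAle eq_sym w0 ws_w_ge0.
rewrite -ler_pdivrMr //; apply: lb_le_inf; first by case: (wbounds_inf f).
by move=> M [_ HM]; rewrite ler_pdivrMr.
Qed.

Definition wnorm f : C := rc (wnrm f).

Lemma wnormD f g : wnorm (f + g) <= wnorm f + wnorm g.
Proof.
rewrite /wnorm -rcD rc_le; apply: wnrm_le => [|x]; first by rewrite addr_ge0 ?wnrm_ge0.
by rewrite mulrDl; apply: le_trans (nrmD _ _) (lerD _ _); exact: wnrm_bound.
Qed.

Lemma wnormZ (c : C) f : wnorm (c *: f) = `|c| * wnorm f.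
Proof.
rewrite /wnorm cnE -rcM; congr rc; apply/eqP; rewrite eq_le; apply/andP; split.
  apply: wnrm_le => [|x]; first by rewrite mulr_ge0 ?cn_ge0 ?wnrm_ge0.
  by rewrite nrmZ -mulrA ler_wpM2l ?cn_ge0 // wnrm_bound.
have [->|c0] := eqVneq c 0; first by rewrite cn0 mul0r wnrm_ge0.
have cp : 0 < cn c by rewrite -rc_lt rc0 -cnE normr_gt0.
rewrite mulrC -ler_pdivlMr //; apply: wnrm_le => [|x]; first by rewrite divr_ge0 ?cn_ge0 ?wnrm_ge0.
rewrite mulrAC ler_pdivlMr // mulrC -nrmZ; exact: (wnrm_bound (c *: f)).
Qed.

Lemma wnorm0 f : wnorm f = 0 -> f = 0.
Proof.
rewrite /wnorm -rc0 => /rc_inj f0; apply: wtype_eq => x; apply: nrm_le0.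
by have := wnrm_bound f x; rewrite f0 mul0r.
Qed.

HB.instance Definition _ := Lmodule_isNormed.Build C (wtype W) wnormD wnormZ wnorm0.


(** A sequence [f k] is drawn from smaller and smaller balls in the filter; it converges pointwise,
    uniformly relative to the weight, and [ws_closed] keeps the limit in the space. *)
Lemma wtype_complete (F : set_system (wtype W)) : ProperFilter F -> cauchy F -> cvg F.
Proof.
move=> PF /cauchyP cF.
have /choice[f Hf] : forall k : nat, exists f : wtype W, F (ball f (rc k.+1%:R^-1 : C)).
  by move=> k; apply: cF; rewrite -rc0 rc_lt.
have ballE (a b : wtype W) (e : R) : ball a (rc e : C) b -> nrm (a - b) <= e.
  by rewrite -ball_normE /= nrmE rc_lt => /ltW.
have ff k l : nrm (f k - f l) <= k.+1%:R^-1 + l.+1%:R^-1.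
  have [h [/ballE h1 /ballE h2]] := filter_ex (filterI (Hf k) (Hf l)).
  by apply: le_trans (nrm_tri h _ _) _; rewrite [X in _ + X]nrmC lerD.
have ffx k l x : nrm (f k x - f l x) <= (k.+1%:R^-1 + l.+1%:R^-1) * ws_w x.
  have := wnrm_bound (f k - f l) x; rewrite /= scaleN1r => /le_trans; apply.
  by rewrite ler_wpM2r ?ws_w_ge0 //; exact: ff.
have /choice[g Hg] : forall x, exists y : ws_cod W, (fun k => f k x) @ \oo --> y.
  move=> x; apply: cauchy_seqP => e e0.
  have w1 : 0 < ws_w x + 1 by rewrite ltr_wpDl ?ws_w_ge0.
  have [N HN] := inv_small (divr_gt0 (divr_gt0 e0 w1) (ltr0n _ 2)).
  exists N => k l /HN h1 /HN h2; apply: le_trans (ffx k l x) _.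
  apply: le_trans (_ : e / (ws_w x + 1) * ws_w x <= _).
    by rewrite ler_wpM2r ?ws_w_ge0 // [X in _ <= X]splitr lerD.
  by rewrite -mulrA ger_pMr // ler_pdivrMl // mulr1 lerDl.
have gf x k : nrm (g x - f k x) <= k.+1%:R^-1 * ws_w x.
  apply/ler_addgt0Pr => e e0; have e2 : 0 < e / 2 by rewrite divr_gt0.
  have w1 : 0 < ws_w x + 1 by rewrite ltr_wpDl ?ws_w_ge0.
  have [N HN] := inv_small (divr_gt0 e2 w1).
  have /cvg_seqP/(_ _ e2)[N' HN'] := Hg x.
  have h1 := HN _ (leq_maxl N N'); have h2 := HN' _ (leq_maxr N N').
  apply: le_trans (nrm_tri (f (maxn N N') x) _ _) _; rewrite nrmC.
  have := ffx (maxn N N') k x; rewrite mulrDl.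
  have : (maxn N N').+1%:R^-1 * ws_w x <= e / 2.
    apply: le_trans (ler_wpM2r (ws_w_ge0 _) h1) _.
    by rewrite -mulrA ger_pMr // ler_pdivrMl // mulr1 lerDl.
  by set q := _.+1%:R^-1 * _; set q' := _.+1%:R^-1 * _; lra.
have gP : ws_set g.
  apply: ws_closed => e e0; have [N /(_ N (leqnn _)) HN] := inv_small e0.
  exists (f N); split; first exact: wfunP.
  by move=> x; apply: le_trans (gf x N) _; rewrite ler_wpM2r ?ws_w_ge0.
pose gw : wtype W := Wtype gP.
apply/cvg_ex; exists gw; apply/cvgrPdist_le => _ /posC[e e0 ->].
have [N /(_ N (leqnn _)) HN] := inv_small (divr_gt0 e0 (ltr0n _ 2)).
apply: filterS (Hf N) => h /ballE h1; rewrite nrmE rc_le.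
apply: le_trans (nrm_tri (f N) _ _) _.
have : nrm (gw - f N) <= N.+1%:R^-1.
  apply: wnrm_le => [|x]; first exact: ltW.
  by rewrite /= scaleN1r; exact: gf.
by set q := _.+1%:R^-1 in h1 HN *; lra.
Qed.

HB.instance Definition _ := Uniform_isComplete.Build (wtype W) wtype_complete.

End Structure.
End WSpace.

(** * The C*-algebra of adjointable operators *)

Section HilbertModule.
Variables (R : realType) (A : cstarAlgType R).
Local Notation C := (Cplx R).

(** Only the form of a Hilbert [A]-module is recorded. Cauchy-Schwarz is a field since its usual
    proof goes through a right action of [A]. *)
Record hmod := HMod {
  hm_sort :> completeNormedModType C;
  hform : hm_sort -> hm_sort -> A;
  hformDr : forall x y z, hform x (y + z) = hform x y + hform x z;
  hformZr : forall x (c : C) y, hform x (c *: y) = c *: hform x y;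
  hform_star : forall x y, star (hform x y) = hform y x;
  hform_nrm : forall x, nrm (hform x x) = nrm x ^+ 2;
  hform_CS : forall x y, nrm (hform x y) <= nrm x * nrm y
}.

Variable H : hmod.
Implicit Types (x y z : H) (S T : H -> H).
Local Notation "<< x , y >>" := (hform x y).

Lemma hformDl x y z : << x + y, z >> = << x, z >> + << y, z >>.
Proof. by rewrite -hform_star hformDr starD !hform_star. Qed.
Lemma hformZl x (c : C) y : << c *: x, y >> = c^* *: << x, y >>.
Proof. by rewrite -hform_star hformZr starZ hform_star. Qed.
Lemma hformBr x y z : << x, y - z >> = << x, y >> - << x, z >>.
Proof. by rewrite hformDr -scaleN1r hformZr scaleN1r. Qed.

Lemma hformBl x y z : << x - y, z >> = << x, z >> - << y, z >>.
Proof. by rewrite hformDl -scaleN1r hformZl rmorphN1 scaleN1r. Qed.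

Lemma hform_eq x y : (forall z, << z, x >> = << z, y >>) -> x = y.
Proof.
move=> E; apply/eqP; rewrite -subr_eq0; apply/eqP/nrm0_eq/eqP.
by rewrite -(sqrf_eq0 (nrm _)) -hform_nrm hformBr E subrr nrm0.
Qed.

Definition adjoint T T' : Prop := forall x y, << T x, y >> = << x, T' y >>.

Lemma adjoint_sym T T' : adjoint T T' -> adjoint T' T.
Proof. by move=> E x y; rewrite -hform_star -E hform_star. Qed.

Lemma adjoint_linear T T' : adjoint T T' ->
  {morph T : x y / x + y} /\ forall (c : C) x, T (c *: x) = c *: T x.
Proof.
move=> /adjoint_sym E; split=> [x y|c x]; apply: hform_eq => z.
  by rewrite -E !hformDr !E.
by rewrite -E !hformZr E.
Qed.

Lemma adjoint_bound T T' (M : R) : 0 <= M -> adjoint T T' -> (forall x, nrm (T x) <= M * nrm x) ->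
  forall y, nrm (T' y) <= M * nrm y.
Proof.
move=> M0 E TM y; have [->|n0] := eqVneq (nrm (T' y)) 0; first by rewrite mulr_ge0 ?nrm_ge0.
have np : 0 < nrm (T' y) by rewrite lt_neqAle eq_sym n0 nrm_ge0.
rewrite -(ler_pM2r np) -expr2 -hform_nrm -E.
by apply: le_trans (hform_CS _ _) _; rewrite mulrAC ler_wpM2r ?nrm_ge0.
Qed.

Definition adjointable T : Prop :=
  (exists M : R, 0 <= M /\ forall x, nrm (T x) <= M * nrm x) /\ exists T', adjoint T T'.

Lemma adjointable_0 : adjointable (fun=> 0).
Proof.
split; first by exists 0; split=> // x; rewrite nrm0 mul0r.
exists (fun=> 0) => x y.
by have := hformZr x 0 0; have := hformZl 0 0 y; rewrite !scale0r => -> ->; rewrite rmorph0 scale0r.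
Qed.

Lemma adjointable_D S T : adjointable S -> adjointable T -> adjointable (fun x => S x + T x).
Proof.
move=> [[M [M0 HM]] [S' ES]] [[N [N0 HN]] [T' ET]]; split.
  exists (M + N); split=> [|x]; first exact: addr_ge0.
  by rewrite mulrDl; apply: le_trans (nrmD _ _) (lerD _ _).
by exists (fun x => S' x + T' x) => x y; rewrite hformDl hformDr ES ET.
Qed.

Lemma adjointable_Z (c : C) T : adjointable T -> adjointable (fun x => c *: T x).
Proof.
move=> [[N [N0 HN]] [T' ET]]; split.
  exists (cn c * N); split=> [|x]; first by rewrite mulr_ge0 ?cn_ge0.
  by rewrite nrmZ -mulrA ler_wpM2l ?cn_ge0.
by exists (fun x => c^* *: T' x) => x y; rewrite hformZl hformZr ET.
Qed.

Lemma adjointable_M S T : adjointable S -> adjointable T -> adjointable (fun x => S (T x)).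
Proof.
move=> [[M [M0 HM]] [S' ES]] [[N [N0 HN]] [T' ET]]; split.
  exists (M * N); split=> [|x]; first exact: mulr_ge0.
  by apply: le_trans (HM _) _; rewrite -mulrA ler_wpM2l.
by exists (fun x => T' (S' x)) => x y; rewrite ES ET.
Qed.

(** By [adjoint_bound] the adjoints of the approximating operators are pointwise Cauchy, and their
    limit is an adjoint of [T]. *)
Lemma adjointable_closed T : (forall e : R, 0 < e -> exists S, adjointable S /\
    forall x, nrm (T x - S x) <= e * nrm x) -> adjointable T.
Proof.
move=> HT; split.
  have [S [[[M [M0 HM]] _] TS]] := HT 1 ltr01.
  exists (M + 1); split=> [|x]; first by rewrite addr_ge0.
  by rewrite mulrDl; apply: le_trans (nrm_le_sub _ (S x)) (lerD _ _).
have /choice[P HP] : forall k : nat, exists P : (H -> H) * (H -> H),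
    [/\ adjoint P.1 P.2, adjointable P.1 & forall x, nrm (T x - P.1 x) <= k.+1%:R^-1 * nrm x].
  move=> k; have [S [aS TS]] := HT _ (invS_gt0 k).
  by have [_ [S' ES]] := aS; exists (S, S').
have PP k l y : nrm ((P k).2 y - (P l).2 y) <= (k.+1%:R^-1 + l.+1%:R^-1) * nrm y.
  have [E1 _ h1] := HP k; have [E2 _ h2] := HP l.
  apply: (adjoint_bound (T := fun x => (P k).1 x - (P l).1 x) (T' := fun x => (P k).2 x - (P l).2 x)).
  - by rewrite addr_ge0 // ltW.
  - by move=> x z; rewrite hformBr -E1 -E2 hformBl.
  - move=> x; apply: le_trans (nrm_tri (T x) _ _) _; rewrite mulrDl.
    by rewrite nrmC lerD.
have /choice[T' HT'] : forall y, exists z : H, (fun k => (P k).2 y) @ \oo --> z.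
  move=> y; apply: cauchy_seqP => e e0.
  have w1 : 0 < nrm y + 1 by rewrite ltr_wpDl ?nrm_ge0.
  have [N HN] := inv_small (divr_gt0 (divr_gt0 e0 w1) (ltr0n _ 2)).
  exists N => k l /HN h1 /HN h2; apply: le_trans (PP k l y) _.
  apply: le_trans (_ : e / (nrm y + 1) * nrm y <= _).
    by rewrite ler_wpM2r ?nrm_ge0 // [X in _ <= X]splitr lerD.
  by rewrite -mulrA ger_pMr // ler_pdivrMl // mulr1 lerDl.
exists T' => x y.
have L0 (u v : nat -> H) a b : u @ \oo --> a -> v @ \oo --> b -> (fun k => << u k, v k >>) @ \oo --> << a, b >>.
  move=> /cvg_seqP ua /cvg_seqP vb; apply/cvg_seqP => e e0.
  have [d d0 Hd] := bilin_near a b hformBl hformBr (@hform_CS H) e0.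
  have [N1 h1] := ua _ d0; have [N2 h2] := vb _ d0.
  by exists (maxn N1 N2) => n; rewrite geq_max => /andP[/h1 g1 /h2 g2]; exact: Hd.
have l1 : (fun k => (P k).1 x) @ \oo --> T x.
  apply/cvg_seqP => e e0; have w1 : 0 < nrm x + 1 by rewrite ltr_wpDl ?nrm_ge0.
  have [N HN] := inv_small (divr_gt0 e0 w1); exists N => k /HN h1.
  have [_ _ h2] := HP k; rewrite nrmC; apply: le_trans (h2 x) _.
  apply: le_trans (ler_wpM2r (nrm_ge0 _) h1) _.
  by rewrite -mulrA ger_pMr // ler_pdivrMl // mulr1 lerDl.
have g1 := L0 _ _ _ _ l1 (@seq_cvg_cst _ _ y).
have g2 := L0 _ _ _ _ (@seq_cvg_cst _ _ x) (HT' y).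
apply: lim_uniq g1 _.
rewrite (_ : (fun k => << (P k).1 x, y >>) = (fun k => << x, (P k).2 y >>)) //.
by apply/funext => k; have [E _ _] := HP k; exact: E.
Qed.

Lemma adjointable_bdd T : adjointable T -> exists M : R, 0 <= M /\ forall x, nrm (T x) <= M * nrm x.
Proof. by case. Qed.

Definition adjW : wspace R := WSpace (@nrm_ge0 R H) adjointable_0 adjointable_D
  adjointable_Z adjointable_bdd adjointable_closed.

Definition adj := wtype adjW.

HB.instance Definition _ := CompleteNormedModule.copy adj (wtype adjW).

Definition adj_mul (S T : adj) : adj := @Wtype R adjW _ (adjointable_M (wfunP S) (wfunP T)).

Lemma adj_star_ex (T : adj) : exists T' : adj, adjoint T T'.
Proof.
have [[M [M0 TM]] [T' E]] := wfunP T.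
suff aT : adjointable T' by exists (@Wtype R adjW _ aT).
split; last by exists T; exact: adjoint_sym.
by exists M; split=> //; exact: (adjoint_bound M0 E TM).
Qed.

Definition adj_star (T : adj) : adj := xget T [set T' : adj | adjoint T T'].

Lemma adj_starP (T : adj) : adjoint T (adj_star T).
Proof. by rewrite /adj_star; case: xgetP => [T' _ //|]; have [T' E] := adj_star_ex T => /(_ T'). Qed.

Lemma adj_star_uniq (T T' : adj) : adjoint T T' -> adj_star T = T'.
Proof.
move=> E; apply: wtype_eq => y; apply: hform_eq => z.
by rewrite -E -adj_starP.
Qed.

Lemma adj_mulA : associative adj_mul.
Proof. by move=> S T U; exact: wtype_eq. Qed.
Lemma adj_mulDl : left_distributive adj_mul +%R.
Proof. by move=> S T U; exact: wtype_eq. Qed.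
Lemma adj_mulDr : right_distributive adj_mul +%R.
Proof.
move=> S T U; apply: wtype_eq => x /=.
have [_ [S' E]] := wfunP S; exact: (adjoint_linear E).1.
Qed.
Lemma adj_mulZl (c : C) (S T : adj) : adj_mul (c *: S) T = c *: adj_mul S T.
Proof. exact: wtype_eq. Qed.
Lemma adj_mulZr (c : C) (S T : adj) : adj_mul S (c *: T) = c *: adj_mul S T.
Proof.
apply: wtype_eq => x /=; have [_ [S' E]] := wfunP S; exact: (adjoint_linear E).2.
Qed.
Lemma adj_starK : involutive adj_star.
Proof. by move=> T; apply: adj_star_uniq; apply: adjoint_sym; exact: adj_starP. Qed.
Lemma adj_starD : {morph adj_star : S T / S + T}.
Proof.
move=> S T; apply: adj_star_uniq => x y /=.
by rewrite hformDl hformDr !adj_starP.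
Qed.
Lemma adj_starZ (c : C) (T : adj) : adj_star (c *: T) = c^* *: adj_star T.
Proof. by apply: adj_star_uniq => x y /=; rewrite hformZl hformZr adj_starP. Qed.
Lemma adj_starM (S T : adj) : adj_star (adj_mul S T) = adj_mul (adj_star T) (adj_star S).
Proof. by apply: adj_star_uniq => x y /=; rewrite !adj_starP. Qed.
Lemma adj_nrm_mul (S T : adj) : nrm (adj_mul S T) <= nrm S * nrm T.
Proof.
apply: wnrm_le => [|x]; first by rewrite mulr_ge0 ?nrm_ge0.
rewrite /= -mulrA; apply: le_trans (wnrm_bound S _) _.
exact: (ler_wpM2l (nrm_ge0 S) (wnrm_bound T x)).
Qed.
Lemma adj_nrm_star_le (T : adj) : nrm (adj_star T) <= nrm T.
Proof.
apply: wnrm_le => [|x]; first exact: nrm_ge0.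
by apply: (adjoint_bound (nrm_ge0 T) (@adj_starP T)) => y; exact: (wnrm_bound T).
Qed.
Lemma adj_nrm_sqr (T : adj) : nrm (adj_mul (adj_star T) T) = nrm T ^+ 2.
Proof.
apply/eqP; rewrite eq_le; apply/andP; split.
  apply: le_trans (adj_nrm_mul _ _) _; rewrite expr2 ler_wpM2r ?nrm_ge0 //.
  exact: adj_nrm_star_le.
set N := nrm (adj_mul _ _); have N0 : 0 <= N by exact: nrm_ge0.
rewrite -(sqr_sqrtr N0) ler_sqr ?nnegrE ?nrm_ge0 ?sqrtr_ge0 //.
apply: wnrm_le => [|x]; first exact: sqrtr_ge0.
apply: nrm_sa_pow_le => //.
  by rewrite mulr_ge0 ?sqrtr_ge0 ?nrm_ge0.
rewrite -hform_nrm adj_starP exprMn sqr_sqrtr //.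
apply: le_trans (hform_CS _ _) _; rewrite mulrC expr2 mulrA ler_wpM2r ?nrm_ge0 //.
exact: (wnrm_bound (adj_mul (adj_star T) T)).
Qed.

Lemma adj_cnormM (S T : adj) : `|adj_mul S T| <= `|S| * `|T|.
Proof. by rewrite !nrmE -rcM rc_le adj_nrm_mul. Qed.
Lemma adj_cnorm_star (T : adj) : `|adj_mul (adj_star T) T| = `|T| ^+ 2.
Proof. by rewrite !nrmE adj_nrm_sqr rcX. Qed.

HB.instance Definition _ := CompleteNormedModule_isCStar.Build R adj
  adj_mulA adj_mulDl adj_mulDr adj_mulZl adj_mulZr
  adj_starK adj_starD adj_starZ adj_starM adj_cnormM adj_cnorm_star.


End HilbertModule.

(** * Positive elements *)

Section Positivity.
Context {R : realType} {U : cstarAlgType R}.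
Local Notation C := (Cplx R).
Variable e1 : U.
Hypothesis e1l : forall x, e1 ** x = x.
Hypothesis e1r : forall x, x ** e1 = x.
Implicit Types (a b h p s v w x y z : U) (t : R).

Lemma star_e1 : star e1 = e1.
Proof. by rewrite -[LHS]e1r -{2}(starK e1) -starM e1r starK. Qed.

Lemma nrm_e1 : nrm e1 <= 1.
Proof.
have := nrm_sqr e1; rewrite star_e1 e1r => E.
rewrite leNgt; apply/negP => h; have : nrm e1 * 1 < nrm e1 * nrm e1.
  by rewrite ltr_pM2l // (lt_trans ltr01).
by rewrite mulr1 -expr2 -E ltxx.
Qed.

(* In a unital C*-algebra a self-adjoint element is positive exactly when it lies in a
   ball of radius [t] around [t *: e1]. *)
Definition pos h : Prop := star h = h /\ exists2 t, 0 <= t & nrm (rc t *: e1 - h) <= t.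

(** The radius may be enlarged, so that two positive elements can share one, as [psqrt_comm]
    demands. *)
Lemma pos_big h : pos h -> exists2 T : R, 0 < T & forall t, T <= t -> nrm (rc t *: e1 - h) <= t.
Proof.
case=> _ [T T0 HT]; exists (T + 1) => [|t Tt]; first by rewrite ltr_wpDl.
have -> : rc t *: e1 - h = rc (t - T) *: e1 + (rc T *: e1 - h) by rewrite rcB; lmod_ring.
apply: le_trans (nrmD _ _) _; have tT : 0 <= t - T by lra.
by rewrite nrmZr //; have := ler_wpM2l tT nrm_e1; lra.
Qed.

Lemma posD a b : pos a -> pos b -> pos (a + b).
Proof.
move=> [sa [t t0 ta]] [sb [t' t'0 tb]]; split; first by rewrite starD sa sb.
exists (t + t'); first exact: addr_ge0.
have -> : rc (t + t') *: e1 - (a + b) = (rc t *: e1 - a) + (rc t' *: e1 - b).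
  by rewrite rcD; lmod_ring.
by apply: le_trans (nrmD _ _) _; exact: lerD.
Qed.

Lemma posZ (r : R) a : 0 <= r -> pos a -> pos (rc r *: a).
Proof.
move=> r0 [sa [t t0 ta]]; split; first by rewrite starZr sa.
exists (r * t); first exact: mulr_ge0.
have -> : rc (r * t) *: e1 - rc r *: a = rc r *: (rc t *: e1 - a).
  by rewrite rcM; lmod_ring.
by rewrite nrmZr // ler_wpM2l.
Qed.

Lemma pos0 : pos 0.
Proof. by split; [exact: star0|exists 0 => //; rewrite rc0 scale0r subr0 nrm0]. Qed.

Lemma rc2E : rc (2 : R) = 1 + 1 :> C. Proof. by rewrite -rc1 -rcD. Qed.

Lemma unitary_pair a b : star a = a -> star b = b -> a ** b = b ** a ->
  a ** a + b ** b = e1 -> nrm a <= 1.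
Proof.
move=> sa sb ab E; apply: (@unitary_trick _ _ a (e1 - b)) => //.
- by rewrite starB star_e1 sb.
- by rewrite cmulBr cmulBl e1l e1r ab.
rewrite !calgE !e1l !e1r rc2E; move/(canRL (addrK _)): E => ->.
by lmod_ring.
Qed.

(** With [b = sqrt_lim (s ** s)], [e1 - s ** s] is the square of [e1 - b], the real part of the
    unitary [(e1 - b) + iu *: s]. *)
Lemma nrm_sub_sqr s : star s = s -> nrm s <= 1 -> nrm (e1 - s ** s) <= 1.
Proof.
move=> ss s1; have u1 : nrm (s ** s) <= 1 by rewrite nrm_sa // expr_le1 ?nrm_ge0.
have su : star (s ** s) = s ** s by rewrite starM ss.
pose b := sqrt_lim (s ** s); have sb : star b = b by exact: sqrt_lim_sa.
have bs : b ** s = s ** b by apply: sqrt_lim_comm => //; rewrite cmulA.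
have E := sqrt_limE u1; rewrite -/b in E.
have E2 : (e1 - b) ** (e1 - b) = e1 - s ** s.
  move/(canRL (addKr _)): E => E; rewrite !calgE !e1l !e1r E rc2E; lmod_ring.
rewrite -E2 nrm_sa ?starB ?star_e1 ?sb // expr_le1 ?nrm_ge0 //.
apply: (@unitary_pair _ s) => //; first by rewrite starB star_e1 sb.
  by rewrite cmulBl cmulBr e1l e1r bs.
by rewrite E2 subrK.
Qed.

Lemma pos_sqr_nrm s t : star s = s -> nrm s ^+ 2 <= t -> nrm (rc t *: e1 - s ** s) <= t.
Proof.
move=> ss st; have t0 : 0 <= t by apply: le_trans st; rewrite exprn_ge0 ?nrm_ge0.
have [t00|tn] := eqVneq t 0.
  have s0 : s = 0.
    by apply: nrm0_eq; apply/eqP; rewrite -sqrf_eq0 eq_le exprn_ge0 ?nrm_ge0 // andbT -t00.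
  by rewrite s0 cmul0l t00 rc0 scale0r subr0 nrm0.
have tp : 0 < t by rewrite lt_neqAle eq_sym tn.
have rp : 0 < Num.sqrt t by rewrite sqrtr_gt0.
have sn : nrm (rc (Num.sqrt t)^-1 *: s) <= 1.
  rewrite nrmZr ?invr_ge0 ?sqrtr_ge0 // ler_pdivrMl // mulr1.
  by apply: nrm_sa_pow_le; rewrite ?sqrtr_ge0 ?sqr_sqrtr.
have := nrm_sub_sqr _ sn; rewrite starZr ss => /(_ erefl) H.
have -> : rc t *: e1 - s ** s =
   rc t *: (e1 - (rc (Num.sqrt t)^-1 *: s) ** (rc (Num.sqrt t)^-1 *: s)).
  rewrite !calgE scalerBr !scalerA -!rcM -invfM -expr2 sqr_sqrtr //.
  by rewrite mulfV // rc1 scale1r.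
by rewrite nrmZr // -[X in _ <= X]mulr1 ler_wpM2l.
Qed.

Lemma pos_sqr s : star s = s -> pos (s ** s).
Proof.
move=> ss; split; first by rewrite starM ss.
by exists (nrm s ^+ 2); [rewrite exprn_ge0 ?nrm_ge0|exact: pos_sqr_nrm].
Qed.

(** The square root of [h], as [sqrt t] times that of [h / t], which lies in the unit ball around
    [e1]. *)
Definition psqrt t h : U := rc (Num.sqrt t) *: (e1 - sqrt_lim (e1 - rc t^-1 *: h)).

Section Psqrt.
Variables (t : R) (h : U).
Hypotheses (t0 : 0 < t) (sh : star h = h) (ht : nrm (rc t *: e1 - h) <= t).

Lemma psqrt_arg : nrm (e1 - rc t^-1 *: h) <= 1 /\ star (e1 - rc t^-1 *: h) = e1 - rc t^-1 *: h.
Proof.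
split; last by rewrite starB starZr sh star_e1.
have -> : e1 - rc t^-1 *: h = rc t^-1 *: (rc t *: e1 - h).
  by rewrite scalerBr scalerA -rcM mulVf ?gt_eqF // rc1 scale1r.
by rewrite nrmZr ?invr_ge0 ?(ltW t0) // ler_pdivrMl // mulr1.
Qed.

Lemma psqrt_sa : star (psqrt t h) = psqrt t h.
Proof. by case: psqrt_arg => u1 su; rewrite starZr starB star_e1 sqrt_lim_sa. Qed.

Lemma psqrtE : psqrt t h ** psqrt t h = h.
Proof.
case: psqrt_arg => u1 su; have := sqrt_limE u1.
set b := sqrt_lim _ => /(canRL (addKr _)) E.
pose k := rc t^-1 *: h; rewrite -/k in E.
have hk : h = (rc (Num.sqrt t) * rc (Num.sqrt t)) *: k.
  rewrite -rcM -expr2 sqr_sqrtr ?(ltW t0) // /k scalerA -rcM mulfV ?gt_eqF //.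
  by rewrite rc1 scale1r.
rewrite [RHS]hk /psqrt -/b !calgE !e1l !e1r E rc2E; lmod_ring.
Qed.

Lemma psqrt_pos : pos (psqrt t h).
Proof.
split; first exact: psqrt_sa.
exists (Num.sqrt t); first exact: sqrtr_ge0.
case: psqrt_arg => u1 su.
have -> : rc (Num.sqrt t) *: e1 - psqrt t h = rc (Num.sqrt t) *: sqrt_lim (e1 - rc t^-1 *: h).
  by rewrite /psqrt; lmod_ring.
by rewrite nrmZr ?sqrtr_ge0 // -[X in _ <= X]mulr1 ler_wpM2l ?sqrtr_ge0 // sqrt_lim_le.
Qed.
End Psqrt.

Lemma psqrt_comm t h h' y : 0 < t -> star h = h -> star h' = h' ->
  nrm (rc t *: e1 - h) <= t -> nrm (rc t *: e1 - h') <= t ->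
  h ** y = y ** h' -> psqrt t h ** y = y ** psqrt t h'.
Proof.
move=> t0 sh sh' ht ht' hy; have [u1 _] := psqrt_arg t0 sh ht; have [u1' _] := psqrt_arg t0 sh' ht'.
rewrite /psqrt cmulZl cmulZr cmulBl cmulBr e1l e1r (sqrt_lim_comm u1 u1') //.
by rewrite cmulBl cmulBr e1l e1r cmulZl cmulZr hy.
Qed.

Lemma pos_sqrt h : pos h -> exists s, [/\ star s = s, pos s, s ** s = h &
  forall y, h ** y = y ** h -> s ** y = y ** s].
Proof.
move=> ph; have [sh _] := ph; have [T T0 HT] := pos_big ph; have ht := HT T (lexx T).
exists (psqrt T h); split; [exact: psqrt_sa|exact: psqrt_pos|exact: psqrtE|].
by move=> y hy; exact: psqrt_comm.
Qed.

(** The root [c] of [p] commutes with [d], so this is the square of the self-adjoint [c ** d].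
    Nothing more general is available before [pos_star_mul]. *)
Lemma pos_conj_comm p d : pos p -> star d = d -> p ** d = d ** p -> pos (d ** p ** d).
Proof.
move=> pp sd pd; have [c [sc _ E cc]] := pos_sqrt pp.
have cd := cc d pd.
have -> : d ** p ** d = (c ** d) ** (c ** d) by rewrite -E !cmulA cd -!cmulA cd.
by apply: pos_sqr; rewrite starM sc sd cd.
Qed.

(** For commuting roots [q] of [p] and [r] of [- p], [z = q + iu *: r] has [star z ** z = 0]; so [z]
    vanishes, and [q] as its real part. *)
Lemma pos_proper p : pos p -> pos (- p) -> p = 0.
Proof.
move=> pp pn; have [q [sq _ Eq cq]] := pos_sqrt pp; have [r [sr _ Er cr]] := pos_sqrt pn.
have qr : q ** r = r ** q.
  apply: cq; symmetry; apply: cr.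
  by rewrite cmulNl cmulNr.
pose z := q + iu *: r.
have z0 : z = 0.
  have : star z ** z = 0.
    rewrite /z starD starZ sq sr conj_iu !calgE qr.
    rewrite (_ : q ** q = - (r ** r)); last by rewrite Er Eq opprK.
    by have I2 : iu * iu = -1 :> C := iu2; lmod_ring; ring: I2.
  by move=> E; apply: nrm0_eq; apply/eqP; rewrite -sqrf_eq0 -nrm_sqr E nrm0.
have q0 : rc 2 *: q = 0.
  have -> : rc 2 *: q = z + star z.
    by rewrite /z starD starZ sq sr conj_iu rc2E; lmod_ring.
  by rewrite z0 star0 addr0.
have {}q0 : q = 0.
  apply: nrm0_eq; apply/eqP; have := congr1 nrm q0; rewrite nrm0 nrmZr // => /eqP.
  by rewrite mulf_eq0 pnatr_eq0.
by rewrite -Eq q0 cmul0l.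
Qed.

Lemma pos_add0 a b : pos a -> pos b -> a + b = 0 -> a = 0.
Proof. by move=> pa pb /eqP; rewrite addr_eq0 => /eqP E; apply: pos_proper => //; rewrite E opprK. Qed.

Lemma sa_cube0 v : star v = v -> v ** v ** v = 0 -> v = 0.
Proof.
move=> sv v3; apply: sa_eq0 => //; apply: sa_eq0; first by rewrite starM sv.
by rewrite cmulA v3 cmul0l.
Qed.

(** The difference [d] of the two roots satisfies [d ** (s + w) = 0]. So the positive elements
    [d ** s ** d] and [d ** w ** d] add up to 0, both vanish, and with them the cube of [d]. *)
Lemma psqrt_uniq t w : 0 < t -> pos w -> nrm (rc t *: e1 - w ** w) <= t -> psqrt t (w ** w) = w.
Proof.
move=> t0 pw ht; have [sw _] := pw.
have sww : star (w ** w) = w ** w by rewrite starM sw.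
set s := psqrt t _; have ss : star s = s by exact: psqrt_sa.
have ps : pos s by exact: psqrt_pos.
have sE : s ** s = w ** w by exact: psqrtE.
have sw' : s ** w = w ** s by apply: psqrt_comm => //; rewrite cmulA.
pose d := s - w; have sd : star d = d by rewrite starB ss sw.
have sdc : s ** d = d ** s by rewrite cmulBr cmulBl sw'.
have wdc : w ** d = d ** w by rewrite cmulBr cmulBl sw'.
have d0 : d ** s + d ** w = 0.
  by rewrite -cmulDr cmulDr !cmulBl sE sw'; lmod_ring.
have p1 := pos_conj_comm ps sd sdc; have p2 := pos_conj_comm pw sd wdc.
have E12 : d ** s ** d + d ** w ** d = 0 by rewrite -cmulDl d0 cmul0l.
have z1 := pos_add0 p1 p2 E12.
have z2 : d ** w ** d = 0 by move: E12; rewrite z1 add0r.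
have : d = 0.
  by apply: sa_cube0 => //; rewrite {2}/d cmulBr cmulBl z1 z2 subrr.
by move/eqP; rewrite subr_eq0 => /eqP.
Qed.

(* If [x* x] is not positive, its negative part [v / 2] gives [y = x v] with [y* y <= 0],
   while [w = y y*] is positive; from [w y = - y z] and uniqueness of square roots one
   gets [w y = y z], hence [y = 0]. *)
Lemma pos_star_mul x : pos (star x ** x).
Proof.
set h := star x ** x; have sh : star h = h by rewrite /h starM starK.
have ph2 := pos_sqr sh; have [g [sg pg Eg cg]] := pos_sqrt ph2.
have gh : g ** h = h ** g by apply: cg; rewrite cmulA.
(* As [g] is the absolute value of [h], these are twice the negative and twice the positive part of
   [h]. *)
pose v := g - h; pose u := g + h.
have sv : star v = v by rewrite starB sg sh.
have uv : v ** u = 0.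
  by rewrite /u /v cmulBl !cmulDr Eg gh; lmod_ring.
have gv : g ** v = v ** g by rewrite /v cmulBr cmulBl gh.
have v3E : v ** v ** v = rc 2 *: (v ** g ** v).
  have -> : rc 2 *: (v ** g ** v) = v ** (u + v) ** v.
    have -> : u + v = rc 2 *: g by rewrite /u /v rc2E; lmod_ring.
    by rewrite cmulZr cmulZl.
  by rewrite (cmulDr v u v) uv add0r.
have pz2 : pos (v ** v ** v).
  by rewrite v3E; apply: posZ => //; exact: pos_conj_comm.
pose z := rc 2^-1 *: (v ** v ** v).
have pz : pos z by apply: posZ => //; rewrite invr_ge0.
have half (a : U) : rc 2^-1 *: (rc 2 *: a) = a.
  by rewrite scalerA -rcM mulVf ?pnatr_eq0 // rc1 scale1r.
pose y := x ** v.
have yy : star y ** y = - z.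
  rewrite /y starM sv cmulA -(cmulA v) -/h -[LHS]half /z -scalerN; congr (_ *: _).
  have -> : rc 2 *: (v ** h ** v) = v ** (u - v) ** v.
    have -> : u - v = rc 2 *: h by rewrite /u /v rc2E; lmod_ring.
    by rewrite cmulZr cmulZl.
  by rewrite (cmulBr v u v) uv sub0r cmulNl.
pose w := y ** star y.
have sz : star z = z by case: pz.
(* The squares of [a] and [b] add up to twice [y ** star y + star y ** y], and [star y ** y] is
   [- z]. *)
have pw : pos w.
  pose a := y + star y; pose b := iu *: (y - star y).
  have sa : star a = a by rewrite starD starK addrC.
  have sb : star b = b by rewrite /b starZ starB starK conj_iu scaleNr -scalerN opprB.
  have E : rc 2 *: w = (a ** a + b ** b) + rc 2 *: z.
    rewrite (_ : z = - (star y ** y)); last by rewrite yy opprK.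
    rewrite /a /b /w !calgE rc2E; have I2 : iu * iu = -1 :> C := iu2.
    by lmod_ring; ring: I2.
  rewrite -[w]half E; apply: posZ; first by rewrite invr_ge0.
  by apply: posD; [apply: posD; exact: pos_sqr|exact: posZ].
have wy : w ** y = - (y ** z) by rewrite /w -cmulA yy cmulNr.
have wwy : (w ** w) ** y = y ** (z ** z) by rewrite -cmulA wy cmulNr cmulA wy cmulNl opprK cmulA.
have sw : star w = w by case: pw.
have [T1 T10 H1] := pos_big (pos_sqr sw); have [T2 T20 H2] := pos_big (pos_sqr sz).
pose t := Num.max T1 T2.
have t0 : 0 < t by rewrite lt_max T10.
have h1 : nrm (rc t *: e1 - w ** w) <= t by apply: H1; rewrite le_max lexx.
have h2 : nrm (rc t *: e1 - z ** z) <= t by apply: H2; rewrite le_max lexx orbT.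
have sww : star (w ** w) = w ** w by rewrite (starM w w) sw.
have szz : star (z ** z) = z ** z by rewrite (starM z z) sz.
have wy' := psqrt_comm t0 sww szz h1 h2 wwy.
rewrite !psqrt_uniq // in wy'.
have yz0 : y ** z = 0.
  have E2 : rc 2 *: (y ** z) = 0 by rewrite rc2E scalerDl !scale1r -{1}wy' wy addNr.
  by rewrite -[y ** z]half E2 scaler0.
have z0 : z = 0.
  apply: sa_eq0 => //; have : star y ** (y ** z) = 0 by rewrite yz0 cmul0r.
  by rewrite cmulA yy cmulNl => /eqP; rewrite oppr_eq0 => /eqP.
have v0 : v = 0.
  apply: sa_cube0 => //; have -> : v ** v ** v = rc 2 *: z.
    by rewrite /z scalerA -rcM mulfV ?pnatr_eq0 // rc1 scale1r.
  by rewrite z0 scaler0.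
by move/eqP: v0; rewrite subr_eq0 => /eqP <-.
Qed.


Lemma pos_nrm_sub a t : star a = a -> nrm a <= t -> pos (rc t *: e1 - a).
Proof.
move=> sa at_; split; first by rewrite starB starZr star_e1 sa.
exists t; first exact: le_trans (nrm_ge0 _) at_.
by rewrite opprB addrC subrK.
Qed.

(** After scaling, both [e1 - a'] and [e1 + a'] are positive. Their roots [q] and [r] make
    [a' + iu *: (q ** r)] a unitary, with real part [a']. *)
Lemma pos_le a b : pos a -> pos (b - a) -> nrm a <= nrm b.
Proof.
move=> pa pba; have [sa _] := pa; have [sba _] := pba.
have sb : star b = b by rewrite -(subrK a b) starD sba sa.
have := pos_nrm_sub sb (lexx (nrm b)) => pb.
have pTa : pos (rc (nrm b) *: e1 - a).
  have -> : rc (nrm b) *: e1 - a = (rc (nrm b) *: e1 - b) + (b - a) by lmod_ring.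
  exact: posD.
have [T0|Tn] := eqVneq (nrm b) 0.
  by move: pTa; rewrite T0 rc0 scale0r sub0r => /(pos_proper pa) ->; rewrite nrm0.
have Tp : 0 < nrm b by rewrite lt_neqAle eq_sym Tn nrm_ge0.
pose a' := rc (nrm b)^-1 *: a.
have i0 : 0 <= (nrm b)^-1 by rewrite invr_ge0 nrm_ge0.
have pa' : pos a' by exact: posZ.
have sa' : star a' = a' by case: pa'.
have pq : pos (e1 - a').
  have -> : e1 - a' = rc (nrm b)^-1 *: (rc (nrm b) *: e1 - a).
    by rewrite scalerBr scalerA -rcM mulVf // rc1 scale1r.
  exact: posZ.
have pe : pos e1 by rewrite -(e1l e1); apply: pos_sqr; exact: star_e1.
have pr : pos (e1 + a') by exact: posD.
have [q [sq _ Eq cq]] := pos_sqrt pq; have [r [sr _ Er cr]] := pos_sqrt pr.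
have aq : q ** a' = a' ** q by apply: cq; rewrite cmulBl cmulBr e1l e1r.
have ar : r ** a' = a' ** r by apply: cr; rewrite cmulDl cmulDr e1l e1r.
have qr : q ** r = r ** q by apply: cq; rewrite cmulBl cmulBr e1l e1r ar.
have a1 : nrm a' <= 1.
  apply: (@unitary_pair _ (q ** r)) => //.
  - by rewrite starM sq sr qr.
  - by rewrite cmulA -aq -!cmulA ar.
  have -> : q ** r ** (q ** r) = (q ** q) ** (r ** r) by rewrite !cmulA -(cmulA q) -qr !cmulA.
  by rewrite Eq Er !calgE !e1l !e1r; lmod_ring.
by move: a1; rewrite nrmZr // ler_pdivrMl // mulr1.
Qed.

Lemma pos_bound h t : pos h -> nrm h <= t -> nrm (rc t *: e1 - h) <= t.
Proof.
move=> /pos_sqrt[s [ss _ <- _]] st; apply: pos_sqr_nrm => //.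
by rewrite -nrm_sa.
Qed.

Lemma pos_closed h : (forall e : R, 0 < e -> exists2 k, pos k & nrm (k - h) <= e) -> pos h.
Proof.
move=> H; have sh : star h = h.
  apply/eqP; rewrite -subr_eq0; apply/eqP/nrm_le0/ler_addgt0Pr => e e0.
  have [k [sk _] kh] := H _ (divr_gt0 e0 (ltr0n _ 2)).
  have -> : star h - h = star (h - k) + (k - h) by rewrite starB sk; lmod_ring.
  by apply: le_trans (nrmD _ _) _; rewrite nrm_star nrmC; lra.
split=> //; exists (nrm h + 1); first by rewrite addr_ge0 ?nrm_ge0.
apply/ler_addgt0Pr => e e0; pose d := Num.min 1 e.
have d0 : 0 < d by rewrite lt_min ltr01.
have [k pk kh] := H d d0.
have d1 : d <= 1 by rewrite ge_min lexx.
have de : d <= e by rewrite ge_min lexx orbT.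
have k1 : nrm k <= nrm h + 1 by have := nrm_le_sub k h; lra.
have -> : rc (nrm h + 1) *: e1 - h = (rc (nrm h + 1) *: e1 - k) + (k - h) by lmod_ring.
by apply: le_trans (nrmD _ _) _; have := pos_bound pk k1; lra.
Qed.

End Positivity.

(** * The regular representation and positivity in [A] *)

Section Regular.
Variables (R : realType) (A : cstarAlgType R).
Local Notation C := (Cplx R).

Definition reg_form (x y : A) : A := star x ** y.
Lemma reg_formDr (x y z : A) : reg_form x (y + z) = reg_form x y + reg_form x z.
Proof. exact: cmulDr. Qed.
Lemma reg_formZr (x : A) (c : C) y : reg_form x (c *: y) = c *: reg_form x y.
Proof. exact: cmulZr. Qed.
Lemma reg_form_star (x y : A) : star (reg_form x y) = reg_form y x.
Proof. by rewrite /reg_form starM starK. Qed.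
Lemma reg_form_CS (x y : A) : nrm (reg_form x y) <= nrm x * nrm y.
Proof. by rewrite -[nrm x]nrm_star nrmM. Qed.

Definition reg : hmod A := HMod reg_formDr reg_formZr reg_form_star (@nrm_sqr R A) reg_form_CS.

Lemma reg_adjoint a : @adjoint R A reg (fun x => a ** x : A) (fun x => star a ** x : A).
Proof. by move=> x y; rewrite /= /reg_form starM cmulA. Qed.

Lemma reg_adjointable a : @adjointable R A reg (fun x => a ** x : A).
Proof.
split; first by exists (nrm a); split=> [|x]; [exact: nrm_ge0|exact: nrmM].
by exists (fun x => star a ** x : A); exact: reg_adjoint.
Qed.

(* The left regular representation of [A] in the unital C*-algebra of adjointable
   operators on [A]. *)
Definition lreg (a : A) : adj reg := @Wtype R (adjW reg) _ (reg_adjointable a).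

Lemma reg_id_adjointable : @adjointable R A reg id.
Proof.
split; first by exists 1; split=> // x; rewrite mul1r.
by exists id.
Qed.
Definition reg1 : adj reg := @Wtype R (adjW reg) _ reg_id_adjointable.
Lemma reg1l (T : adj reg) : reg1 ** T = T. Proof. exact: wtype_eq. Qed.
Lemma reg1r (T : adj reg) : T ** reg1 = T. Proof. exact: wtype_eq. Qed.

Lemma lregD : {morph lreg : a b / a + b}.
Proof. by move=> a b; apply: wtype_eq => x /=; rewrite cmulDl. Qed.
Lemma lregZ (c : C) a : lreg (c *: a) = c *: lreg a.
Proof. by apply: wtype_eq => x /=; rewrite cmulZl. Qed.
Lemma lregM : {morph lreg : a b / a ** b}.
Proof. by move=> a b; apply: wtype_eq => x /=; rewrite cmulA. Qed.
Lemma lregS : {morph lreg : a / star a}.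
Proof. by move=> a; symmetry; apply: adj_star_uniq; exact: reg_adjoint. Qed.
Lemma lregB : {morph lreg : a b / a - b}.
Proof. by move=> a b; rewrite lregD -scaleN1r lregZ scaleN1r. Qed.
Lemma lreg_nrm a : nrm (lreg a) = nrm a.
Proof.
apply/eqP; rewrite eq_le; apply/andP; split.
  by apply: wnrm_le => [|x]; [exact: nrm_ge0|exact: nrmM].
apply: nrm_lmul => [|y]; first exact: nrm_ge0.
exact: (wnrm_bound (lreg a)).
Qed.

(** [A] may lack a unit, so positivity is tested on left multiplication operators. *)
Definition cpos (a : A) : Prop := pos reg1 (lreg a).

Lemma cpos_star_mul x : cpos (star x ** x).
Proof. rewrite /cpos lregM lregS; exact: (pos_star_mul reg1l reg1r). Qed.
Lemma cposD a b : cpos a -> cpos b -> cpos (a + b).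
Proof. by rewrite /cpos lregD; exact: posD. Qed.
Lemma cposZ (r : R) a : 0 <= r -> cpos a -> cpos (rc r *: a).
Proof. by rewrite /cpos lregZ; exact: posZ. Qed.
Lemma cpos0 : cpos 0.
Proof. by rewrite /cpos -(scale0r 0) lregZ scale0r; exact: pos0. Qed.
Lemma cpos_le a b : cpos a -> cpos (b - a) -> nrm a <= nrm b.
Proof.
rewrite /cpos lregB => pa pb; rewrite -!lreg_nrm.
exact: (pos_le reg1l reg1r pa pb).
Qed.
Lemma cpos_closed a : (forall e : R, 0 < e -> exists2 b, cpos b & nrm (b - a) <= e) -> cpos a.
Proof.
move=> H; apply: (pos_closed reg1l reg1r) => e /H[b pb ba]; exists (lreg b) => //.
by rewrite -lregB lreg_nrm.
Qed.
(** [K - b] need not be in [A], but its square root [s] is an operator on [A], and [y = s x] is an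
    element of [A]. A square is wanted, and not just positivity, so that [cexp_pos] applies in
    [en_mul]. *)
Lemma conj_sub_sqr (b x : A) (K : R) : star b = b -> nrm b <= K ->
  exists y, star y ** y = rc K *: (star x ** x) - star x ** b ** x.
Proof.
move=> sb bK.
have [|s [ss _ E _]] := pos_sqrt reg1l reg1r (h := rc K *: reg1 - lreg b).
  by apply: (pos_nrm_sub reg1r); rewrite -?lregS ?sb ?lreg_nrm.
exists (s x).
have := adj_starP s x (s x); rewrite /= /reg_form => ->.
have -> : adj_star s = s by exact: ss.
have -> : s (s x) = (s ** s) x by [].
by rewrite E /= scaleN1r cmulBr cmulZr cmulA.
Qed.
Lemma cpos_conj_le b x (K : R) : star b = b -> nrm b <= K ->
  cpos (rc K *: (star x ** x) - star x ** b ** x).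
Proof. by move=> sb /(conj_sub_sqr x sb)[y <-]; exact: cpos_star_mul. Qed.

End Regular.

(** * The conditional expectation *)

Section Expectation.
Context {R : realType} {G : topGroupType} {A : cstarAlgType R}.
Variable alpha : cstar_action G A.
Hypothesis compact_G : compact [set: G].
Local Notation C := (Cplx R).
Variable mu : probability (borel G) R.
Hypothesis haar_mu : haar mu.
Local Notation I := (integral_A mu).
Implicit Types (x y z c : A) (f h : G -> A).

Definition cexp x : A := I (fun r => alpha r x).

Lemma act_cont x : continuous (alpha^~ x). Proof. exact: act_continuous. Qed.

Lemma continuous_act f : continuous f -> continuous (fun s => alpha s (f s)).
Proof.
move=> /continuousP_nrm cf; apply/continuousP_nrm => t e e0.
have e2 : 0 < e / 2 by rewrite divr_gt0.
apply: filterS2 (cf t _ e2) (act_near alpha (f t) t e2) => s h1 h2.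
apply: le_trans (nrm_tri (alpha s (f t)) _ _) _.
by rewrite -{1}actB act_nrm; lra.
Qed.

Lemma continuous_act' g f : continuous f -> continuous (fun s => alpha g (f s)).
Proof.
move=> /continuousP_nrm cf; apply/continuousP_nrm => t e e0.
by apply: filterS (cf t e e0) => s h; rewrite -actB act_nrm.
Qed.

Lemma continuous_mul f h : continuous f -> continuous h -> continuous (fun s => f s ** h s).
Proof.
move=> /continuousP_nrm cf /continuousP_nrm ch; apply/continuousP_nrm => t e e0.
have [d d0 Hd] := bilin_near (f t) (h t) (@cmulBl R A) (@cmulBr R A) (@nrmM R A) e0.
by apply: filterS2 (cf t _ d0) (ch t _ d0) => s; exact: Hd.
Qed.

Lemma continuous_cst_A c : continuous ((fun=> c) : G -> A).
Proof. by move=> t; exact: cvg_cst. Qed.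
Arguments continuous_cst_A : clear implicits.

Lemma integral_mull c f : continuous f -> I (fun s => c ** f s) = c ** I f.
Proof.
move=> cf; have [_ E] := integral_lin compact_G mu cf (cmulDr c) (fun r x => cmulZr _ c x) (nrmM c).
exact: E.
Qed.
Lemma integral_mulr c f : continuous f -> I (fun s => f s ** c) = I f ** c.
Proof.
move=> cf; have le x : nrm (x ** c) <= nrm c * nrm x by rewrite mulrC nrmM.
have [_ E] := integral_lin compact_G mu cf (fun x y => cmulDl x y c) (fun r x => cmulZl _ x c) le.
exact: E.
Qed.
Lemma integral_act g f : continuous f -> I (fun s => alpha g (f s)) = alpha g (I f).
Proof.
move=> cf; have le x : nrm (alpha g x) <= 1 * nrm x by rewrite act_nrm mul1r.
have [_ E] := integral_lin compact_G mu cf (actD alpha g) (fun r x => actZ alpha g _ x) le.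
exact: E.
Qed.
Lemma integral_star f : continuous f ->
  continuous (fun s => star (f s)) /\ I (fun s => star (f s)) = star (I f).
Proof.
move=> cf; have le x : nrm (star x) <= 1 * nrm x by rewrite nrm_star mul1r.
exact (integral_lin compact_G mu cf (@starD R A) (@starZr R A) le).
Qed.
Lemma integralZ (c : C) f : continuous f ->
  continuous (fun s => c *: f s) /\ I (fun s => c *: f s) = c *: I f.
Proof.
move=> cf; have le x : nrm (c *: x) <= cn c * nrm x by rewrite nrmZ.
have lZ (r : R) x : c *: (rc r *: x) = rc r *: (c *: x) by rewrite !scalerA mulrC.
exact (integral_lin compact_G mu cf (scalerDr c) lZ le).
Qed.

Lemma cexpD x y : cexp (x + y) = cexp x + cexp y.
Proof.
rewrite /cexp -(integralD compact_G mu (@act_cont x) (@act_cont y)).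
by apply: integral_ext => s; rewrite actD.
Qed.
Lemma cexpZ (z : C) x : cexp (z *: x) = z *: cexp x.
Proof.
have [_ E] := integralZ z (@act_cont x); rewrite /cexp -E.
by apply: integral_ext => s; rewrite actZ.
Qed.
Lemma cexpB x y : cexp (x - y) = cexp x - cexp y.
Proof. by rewrite cexpD -scaleN1r cexpZ scaleN1r. Qed.
Lemma cexp_star x : cexp (star x) = star (cexp x).
Proof.
have [_ E] := integral_star (@act_cont x); rewrite /cexp -E.
by apply: integral_ext => s; rewrite actS.
Qed.
Lemma cexp_nrm x : nrm (cexp x) <= nrm x.
Proof. by apply: (integral_le compact_G mu (@act_cont x)) => s; rewrite act_nrm. Qed.
Lemma cexp_fixed x : fixed_points alpha (cexp x).
Proof.
move=> g; rewrite /cexp -(integral_act g (@act_cont x)).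
rewrite -(integral_left compact_G haar_mu g (@act_cont x)).
by apply: integral_ext => s; rewrite actM.
Qed.
Lemma cexp_act g x : cexp (alpha g x) = cexp x.
Proof.
have [_ E] := integral_right compact_G haar_mu g (@act_cont x); rewrite /cexp -E.
by apply: integral_ext => s; rewrite actM.
Qed.
Lemma cexp_mull c x : fixed_points alpha c -> cexp (c ** x) = c ** cexp x.
Proof.
move=> fc; rewrite /cexp -(integral_mull c (@act_cont x)); apply: integral_ext => s.
by rewrite actMul fc.
Qed.
Lemma cexp_mulr c x : fixed_points alpha c -> cexp (x ** c) = cexp x ** c.
Proof.
move=> fc; rewrite /cexp -(integral_mulr c (@act_cont x)); apply: integral_ext => s.
by rewrite actMul fc.
Qed.
Lemma cexp_id c : fixed_points alpha c -> cexp c = c.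
Proof.
move=> fc; rewrite -[RHS](integral_cst compact_G mu); apply: integral_ext => s; exact: fc.
Qed.
(** Step sums of the orbit lie in the cone of positive elements, which is closed. *)
Lemma cexp_pos x : cpos (cexp (star x ** x)).
Proof.
apply: cpos_closed => e e0.
have cx := @act_cont (star x ** x).
have [n [E [p [pE HE]]]] := fine_partition compact_G
  (fun g => iffLR (continuousP_nrm _) cx g _ e0).
exists (rsum mu E (fun i => alpha (p i) (star x ** x))).
  rewrite /rsum; elim/big_ind: _ => [|a b|i _]; [exact: cpos0|exact: cposD|].
  by apply: cposZ; [exact: fmu_ge0|rewrite actMul actS; exact: cpos_star_mul].
by rewrite nrmC; apply: integral_approx.
Qed.

Definition ip x y : A := cexp (star x ** y).
Definition en x : R := Num.sqrt (nrm (ip x x)).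

Lemma ip_star x y : star (ip x y) = ip y x.
Proof. by rewrite /ip -cexp_star starM starK. Qed.
Lemma ipDr x y z : ip x (y + z) = ip x y + ip x z. Proof. by rewrite /ip cmulDr cexpD. Qed.
Lemma ipZr x (k : C) y : ip x (k *: y) = k *: ip x y. Proof. by rewrite /ip cmulZr cexpZ. Qed.
Lemma ipDl x y z : ip (x + y) z = ip x z + ip y z. Proof. by rewrite /ip starD cmulDl cexpD. Qed.
Lemma ipZl (k : C) x y : ip (k *: x) y = k^* *: ip x y.
Proof. by rewrite /ip starZ cmulZl cexpZ. Qed.
Lemma en_ge0 x : 0 <= en x. Proof. exact: sqrtr_ge0. Qed.
Lemma en_sqr x : en x ^+ 2 = nrm (ip x x). Proof. by rewrite sqr_sqrtr ?nrm_ge0. Qed.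

(** The Hilbert module argument: expand the positive [ip w w] for [w = l x z - y], where
    [z = ip x y] is fixed by [alpha] and [l] is the inverse of [K]. Since [ip x x] is at most [K],
    this gives [l *: (star z ** z)] below [ip y y]. The summand [d] keeps [K] invertible. *)
Lemma ip_CS x y : nrm (ip x y) <= en x * en y.
Proof.
rewrite -(@ler_sqr R) ?nnegrE ?nrm_ge0 ?mulr_ge0 ?en_ge0 // exprMn !en_sqr.
apply/ler_addgt0Pr => e e0.
pose d := e / (nrm (ip y y) + 1).
have y1 : 0 < nrm (ip y y) + 1 by rewrite ltr_wpDl ?nrm_ge0.
have d0 : 0 < d by rewrite divr_gt0.
have dy : d * nrm (ip y y) <= e.
  by rewrite /d -mulrA ger_pMr // ler_pdivrMl // mulr1 lerDl.
pose K := nrm (ip x x) + d.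
have K0 : 0 < K by rewrite ltr_wpDl ?nrm_ge0.
pose z := ip x y; have fz : fixed_points alpha z by exact: cexp_fixed.
have fsz : fixed_points alpha (star z) by move=> g; rewrite actS fz.
have sz : star z = ip y x by exact: ip_star.
have sx : star (ip x x) = ip x x by exact: ip_star.
pose l := K^-1; have l0 : 0 <= l by rewrite invr_ge0 ltW.
pose w := rc l *: (x ** z) - y.
have Ew : cexp (star w ** w) =
  rc (l ^+ 2) *: (star z ** ip x x ** z) - rc (2 * l) *: (star z ** z) + ip y y.
  have -> : star w ** w = rc (l ^+ 2) *: (star z ** (star x ** x) ** z)
     - rc l *: (star z ** (star x ** y)) - rc l *: ((star y ** x) ** z) + star y ** y.
    rewrite /w !calgE rcX; lmod_ring.
  rewrite cexpD !cexpB !cexpZ !(cexp_mulr _ fz) !(cexp_mull _ fsz) -/(ip x x) -/(ip x y) -/(ip y x) -/(ip y y).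
  by rewrite -sz -/z; congr (_ + _); rewrite -addrA -opprD -scalerDl -rcD; congr (_ - rc _ *: _); ring.

have pw : cpos (rc l *: (star z ** z)) by apply: cposZ => //; exact: cpos_star_mul.
have lK : l * K = 1 by rewrite mulVf // gt_eqF.
have le : nrm (rc l *: (star z ** z)) <= nrm (ip y y).
  apply: cpos_le => //.
  have -> : ip y y - rc l *: (star z ** z) = cexp (star w ** w) +
     rc (l ^+ 2) *: (rc K *: (star z ** z) - star z ** ip x x ** z).
    have E : l ^+ 2 * K = l by rewrite expr2 -mulrA lK mulr1.
    have E2 : rc (2 * l) = rc l + rc l by rewrite -rcD; congr rc; ring.
    rewrite Ew E2 scalerBr scalerA -rcM E; lmod_ring.
  apply: cposD; first exact: cexp_pos.
  by apply: cposZ; [exact: sqr_ge0|apply: cpos_conj_le => //; rewrite lerDl ltW].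
move: le; rewrite nrmZr // nrm_sqr mulrC ler_pdivrMr // => le.
apply: le_trans le _; rewrite /K mulrDr; have := dy; rewrite mulrC; lra.
Qed.

Lemma en_le x : en x <= nrm x.
Proof.
rewrite -(@ler_sqr R) ?nnegrE ?nrm_ge0 ?en_ge0 // en_sqr.
by apply: le_trans (cexp_nrm _) _; rewrite nrm_sqr.
Qed.
Lemma enD x y : en (x + y) <= en x + en y.
Proof.
rewrite -(@ler_sqr R) ?nnegrE ?addr_ge0 ?en_ge0 // en_sqr sqrrD !en_sqr ipDl !ipDr.
apply: le_trans (nrmD _ _) _.
have h1 := nrmD (ip x x) (ip x y); have h2 := nrmD (ip y x) (ip y y).
have h3 := ip_CS x y; have h4 := ip_CS y x; rewrite mulr2n.
have := mulrC (en x) (en y); lra.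
Qed.
Lemma enZ (k : C) x : en (k *: x) = cn k * en x.
Proof.
apply/eqP; rewrite -(@eqrXn2 R 2) ?mulr_ge0 ?en_ge0 ?cn_ge0 // exprMn !en_sqr.
by rewrite ipZl ipZr scalerA nrmZ cnM cn_conj expr2.
Qed.
Lemma en_act g x : en (alpha g x) = en x.
Proof. by rewrite /en /ip -actS -actMul cexp_act. Qed.
Lemma en_mul c x : en (c ** x) <= nrm c * en x.
Proof.
rewrite -(@ler_sqr R) ?nnegrE ?mulr_ge0 ?en_ge0 ?nrm_ge0 // exprMn !en_sqr.
have ss : star (star c ** c) = star c ** c by rewrite starM starK.
have [|y yE] := @conj_sub_sqr R A (star c ** c) x (nrm c ^+ 2) ss.
  by rewrite nrm_sqr.
have E : ip (c ** x) (c ** x) = cexp (star x ** (star c ** c) ** x).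
  by rewrite /ip starM !cmulA.
rewrite -nrmZr ?sqr_ge0 //; apply: cpos_le; first exact: cexp_pos.
by rewrite E /ip -cexpZ -cexpB -yE; exact: cexp_pos.
Qed.
Lemma en_sum (J : Type) (r : seq J) (P : pred J) (F : J -> A) :
  en (\sum_(i <- r | P i) F i) <= \sum_(i <- r | P i) en (F i).
Proof.
elim/big_rec2: _ => [|i x y _ h]; first by apply: le_trans (en_le 0) _; rewrite nrm0.
by apply: le_trans (enD _ _) _; rewrite lerD2l.
Qed.

(* The integrated form of the covariant pair of left multiplication and [alpha]. *)
Definition intop f x : A := I (fun s => f s ** alpha s x).

Lemma intop_cont f x : continuous f -> continuous (fun s => f s ** alpha s x).
Proof. by move=> cf; apply: continuous_mul => //; exact: act_cont. Qed.

Lemma intopDl f h x : continuous f -> continuous h ->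
  intop (fun s => f s + h s) x = intop f x + intop h x.
Proof.
move=> cf ch; rewrite /intop -(integralD compact_G mu (intop_cont (x := x) cf) (intop_cont (x := x) ch)).
by apply: integral_ext => s; rewrite cmulDl.
Qed.
Lemma intopZl (k : C) f x : continuous f -> intop (fun s => k *: f s) x = k *: intop f x.
Proof.
move=> cf; have [_ E] := integralZ k (intop_cont (x := x) cf); rewrite /intop -E.
by apply: integral_ext => s; rewrite cmulZl.
Qed.
Lemma intop_cst c x : intop (fun=> c) x = c ** cexp x.
Proof. exact: (integral_mull c (@act_cont x)). Qed.

Lemma conv_star_cont f : continuous f -> continuous (conv_star alpha f).
Proof.
move=> cf; apply: (continuous_act (f := fun s => star (f s^-1%g))).
by have [] := integral_star (continuous_inv cf).
Qed.
Lemma conv_starK f : conv_star alpha (conv_star alpha f) = f.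
Proof.
apply/funext => s; rewrite /conv_star invgK -actS -actM mulgV act1 starK //.
Qed.

Lemma cexp_integral f : continuous f -> cexp (I f) = I (fun s => cexp (f s)) /\
  continuous (fun s => cexp (f s)).
Proof.
move=> cf; have le x : nrm (cexp x) <= 1 * nrm x by rewrite mul1r cexp_nrm.
have [c E] := integral_lin compact_G mu cf cexpD (fun r x => cexpZ _ x) le.
by rewrite E.
Qed.

(** The integrands match after inverting the variable and applying [alpha s] under [cexp], which is
    invariant. *)
Lemma intop_adjoint f x y : continuous f ->
  ip y (intop f x) = ip (intop (conv_star alpha f) y) x.
Proof.
move=> cf; pose F s := star y ** (f s ** alpha s x).
have cF : continuous F.
  by apply: continuous_mul; [exact: continuous_cst_A|exact: intop_cont].
have cs := conv_star_cont cf.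
have [c1 E1] := integral_star (intop_cont (x := y) cs).
rewrite /ip /intop -(integral_mull (star y) (intop_cont (x := x) cf)) -/F.
rewrite -E1 -(integral_mulr x c1) (cexp_integral cF).1.
rewrite -(integral_inv compact_G haar_mu (cexp_integral cF).2).
have c2 : continuous (fun s => star (conv_star alpha f s ** alpha s y) ** x).
  by apply: continuous_mul => //; exact: continuous_cst_A.
rewrite (cexp_integral c2).1; apply: integral_ext => s.
rewrite -(cexp_act s) /F !actMul -actM mulgV act1; congr cexp.
by rewrite starM /conv_star -!actS starK cmulA.
Qed.

Lemma intop_en f x : continuous f -> en (intop f x) <= L1norm mu f * en x.
Proof.
move=> cf; apply/ler_addgt0Pr => e e0.
pose d := e / (1 + en x).
have k0 : 0 < 1 + en x by rewrite ltr_pwDl ?en_ge0.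
have d0 : 0 < d by rewrite divr_gt0.
have cF := intop_cont (x := x) cf.
have [n [E [p [pE HE]]]] := fine_partition compact_G (fun g =>
  filterI (iffLR (continuousP_nrm _) cf g _ d0) (iffLR (continuousP_nrm _) cF g _ d0)).
have h1 := integral_approx compact_G mu cF pE (fun i s Es => (HE i s Es).2).
have h2 := L1norm_ge compact_G mu cf pE (fun i s Es => (HE i s Es).1).
set r := rsum _ _ _ in h1.
have h3 : en (intop f x) <= en r + en (intop f x - r).
  by have := enD r (intop f x - r); rewrite addrC subrK.
have h4 := le_trans (en_le _) h1.
have h5 : en r <= (\sum_i fmu mu (E i) * nrm (f (p i))) * en x.
  apply: le_trans (en_sum _ _ _) _; rewrite mulr_suml; apply: ler_sum => i _.
  rewrite enZ cn_rc ger0_norm ?fmu_ge0 // -mulrA ler_wpM2l ?fmu_ge0 //.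
  by apply: le_trans (en_mul _ _) _; rewrite en_act.
have h6 := le_trans h5 (ler_wpM2r (en_ge0 x) h2).
have -> : e = d + d * en x by rewrite -{1}[d]mulr1 -mulrDr /d divfK // gt_eqF.
by move: h6; rewrite mulrDl => h6; lra.
Qed.

Lemma jointly_continuous_conv f k : continuous f -> continuous k ->
  jointly_continuous (fun r s : G => f r ** alpha r (k (r^-1 * s)%g)).
Proof.
move=> cf ck r s e e0; have [M0 HM0] := nrm_bounded compact_G cf.
pose M := `|M0| + 1; have M1 : 0 < M by rewrite ltr_wpDl.
have HM t : nrm (f t) <= M.
  by apply: le_trans (HM0 t) _; rewrite /M; have := ler_norm M0; lra.
have eM : 0 < e / 2 / M by rewrite !divr_gt0.
have [[P Q] /= [sP rQ] PQ] := @mulg_continuous G (r^-1, s)%g _ (iffLR (continuousP_nrm k) ck _ _ eM).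
have e2 : 0 < e / 2 by rewrite divr_gt0.
have h1 := iffLR (continuousP_nrm _) (intop_cont (x := k (r^-1 * s)%g) cf) r _ e2.
exists ([set t | P t^-1%g] `&` [set t | nrm (f t ** alpha t (k (r^-1 * s)%g) -
    f r ** alpha r (k (r^-1 * s)%g)) <= e / 2]).
  by apply: filterI => //; exact: (@invg_continuous G r _ sP).
exists Q => // r' s' [Pr' /= h2] Qs'.
apply: le_trans (nrm_tri (f r' ** alpha r' (k (r^-1 * s)%g)) _ _) _.
rewrite [X in _ <= X]splitr; apply: lerD => //.
rewrite -cmulBr -actB; apply: le_trans (nrmM _ _) _; rewrite act_nrm.
have h3 : nrm (k (r'^-1 * s')%g - k (r^-1 * s)%g) <= e / 2 / M := PQ (r'^-1, s')%g (conj Pr' Qs').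
have -> : e / 2 = M * (e / 2 / M) by rewrite [RHS]mulrC divfK ?gt_eqF.
by apply: ler_pM => //; exact: nrm_ge0.
Qed.

Lemma conv_cont f h : continuous f -> continuous h -> continuous (conv alpha mu f h).
Proof.
move=> cf ch.
by have [_ _ _] := continuous_integral compact_G mu (jointly_continuous_swap (jointly_continuous_conv cf ch)).
Qed.

(** Fubini, followed by a left translation in the inner integral. *)
Lemma intop_conv f h x : continuous f -> continuous h ->
  intop (conv alpha mu f h) x = intop f (intop h x).
Proof.
move=> cf ch; have ck := intop_cont (x := x) ch.
have jF := jointly_continuous_conv cf ck; have jh := jointly_continuous_conv cf ch.
have [c1 c2 _ _] := continuous_integral compact_G mu jF.
have [_ d2 _ _] := continuous_integral compact_G mu jh.
rewrite /intop; transitivity (I (fun s => I (fun r => f r ** alpha r (h (r^-1 * s)%g ** alpha (r^-1 * s)%g x)))).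
  apply: integral_ext => s; rewrite /conv -(integral_mulr _ (d2 s)); apply: integral_ext => r.
  by rewrite actMul -actM mulgA mulgV mul1g cmulA.
rewrite -(fubini compact_G mu jF); apply: integral_ext => r.
have cr : continuous (fun s => h (r^-1 * s)%g ** alpha (r^-1 * s)%g x).
  exact: (continuous_left (g := r^-1%g) ck).
rewrite (integral_mull _ (continuous_act' (g := r) cr)) (integral_act r cr).
by rewrite (integral_left compact_G haar_mu _ ck).
Qed.

End Expectation.

(** * Completion of a pre-Hilbert module *)

(* The completion of the pre-Hilbert module [V] consists of the functions [V -> A] that are
   limits of functions [fun y => ip y x], in the norm of bounded maps. *)
Section Completion.
Variables (R : realType) (A : cstarAlgType R).
Local Notation C := (Cplx R).
Variables (V : lmodType C) (ip : V -> V -> A).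
Hypotheses (ipDr : forall x y z, ip x (y + z) = ip x y + ip x z)
  (ipZr : forall x (k : C) y, ip x (k *: y) = k *: ip x y)
  (ip_star : forall x y, star (ip x y) = ip y x).
Variable en : V -> R.
Hypotheses (en_ge0 : forall x, 0 <= en x) (en_sqr : forall x, en x ^+ 2 = nrm (ip x x)).
Hypothesis ip_CS : forall x y, nrm (ip x y) <= en x * en y.
Implicit Types x y z : V.

Lemma preip_Br x y z : ip x (y - z) = ip x y - ip x z.
Proof. by rewrite ipDr -scaleN1r ipZr scaleN1r. Qed.
Lemma preip_Bl x y z : ip (x - y) z = ip x z - ip y z.
Proof. by rewrite -ip_star preip_Br starB !ip_star. Qed.


Definition cset (f : V -> A) : Prop :=
  forall e : R, 0 < e -> exists x, forall y, nrm (f y - ip y x) <= e * en y.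

Lemma cset_0 : cset (fun=> 0).
Proof.
move=> e e0; exists 0 => y; have := ipZr y 0 0; rewrite !scale0r => ->.
by rewrite subrr nrm0 mulr_ge0 // ltW.
Qed.
Lemma cset_D f g : cset f -> cset g -> cset (fun x => f x + g x).
Proof.
move=> cf cg e e0; have e2 : 0 < e / 2 by rewrite divr_gt0.
have [x Hx] := cf _ e2; have [x' Hx'] := cg _ e2; exists (x + x') => y.
have -> : f y + g y - ip y (x + x') = (f y - ip y x) + (g y - ip y x').
  by rewrite ipDr; lmod_ring.
by rewrite [e]splitr mulrDl; apply: le_trans (nrmD _ _) (lerD _ _).
Qed.
Lemma cset_Z (c : C) f : cset f -> cset (fun x => c *: f x).
Proof.
move=> cf e e0; have c1 : 0 < cn c + 1 by rewrite ltr_wpDl ?cn_ge0.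
have [x Hx] := cf _ (divr_gt0 e0 c1); exists (c *: x) => y.
rewrite ipZr -scalerBr nrmZ; apply: le_trans (ler_wpM2l (cn_ge0 _) (Hx y)) _.
rewrite mulrA ler_wpM2r // mulrCA ger_pMr // ler_pdivrMr // mul1r lerDl //.
Qed.
Lemma cset_bdd f : cset f -> exists M : R, 0 <= M /\ forall x, nrm (f x) <= M * en x.
Proof.
move=> /(_ 1 ltr01)[x Hx]; exists (1 + en x); split; first by rewrite addr_ge0.
move=> y; apply: le_trans (nrm_le_sub _ (ip y x)) _; rewrite addrC mulrDl.
by apply: lerD => //; rewrite mulrC.
Qed.
Lemma cset_closed f : (forall e : R, 0 < e -> exists g, cset g /\
  forall x, nrm (f x - g x) <= e * en x) -> cset f.
Proof.
move=> H e e0; have e2 : 0 < e / 2 by rewrite divr_gt0.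
have [g [cg fg]] := H _ e2; have [x Hx] := cg _ e2; exists x => y.
by apply: le_trans (nrm_tri (g y) _ _) _; rewrite [e]splitr mulrDl lerD.
Qed.

Definition cspace : wspace R := WSpace (ws_w := en) en_ge0 cset_0 cset_D cset_Z
  cset_bdd cset_closed.
Local Notation E := (wtype cspace).
Implicit Types f g h : E.

Lemma cset_ip x : cset (fun y => ip y x).
Proof. by move=> e e0; exists x => y; rewrite subrr nrm0 mulr_ge0 // ltW. Qed.
Definition hat x : E := @Wtype R cspace _ (cset_ip x).

Lemma hatB x y : hat x - hat y = hat (x - y).
Proof. by apply: wtype_eq => z /=; rewrite scaleN1r preip_Br. Qed.
Lemma hatD x y : hat (x + y) = hat x + hat y.
Proof. by apply: wtype_eq => z /=; rewrite ipDr. Qed.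
Lemma hatZ (k : C) x : hat (k *: x) = k *: hat x.
Proof. by apply: wtype_eq => z /=; rewrite ipZr. Qed.

Lemma hat_nrm x : nrm (hat x) = en x.
Proof.
apply/eqP; rewrite eq_le; apply/andP; split.
  by apply: wnrm_le => // y /=; rewrite mulrC.
have [->|n0] := eqVneq (en x) 0; first exact: nrm_ge0.
have np : 0 < en x by rewrite lt_neqAle eq_sym n0 en_ge0.
rewrite -(ler_pM2r np) -expr2 en_sqr.
exact: (wnrm_bound (hat x)).
Qed.

Lemma cbound f x : nrm (f x) <= nrm f * en x. Proof. exact: wnrm_bound. Qed.

Lemma hat_dense f (e : R) : 0 < e -> exists x, nrm (f - hat x) <= e.
Proof.
move=> e0; have [x Hx] := wfunP f e e0; exists x.
by apply: wnrm_le => [|y]; [exact: ltW|rewrite /= scaleN1r].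
Qed.

Lemma cB f x y : f (x - y) = f x - f y.
Proof.
apply: (eq_of_eps (K := en (x - y) + en x + en y)) => d d0 _; have [z Hz] := hat_dense f d0.
have h u : nrm (f u - ip u z) <= d * en u.
  by have := cbound (f - hat z) u; rewrite /= scaleN1r => /le_trans; apply; rewrite ler_wpM2r.
have -> : f (x - y) - (f x - f y) = (f (x - y) - ip (x - y) z) - ((f x - ip x z) - (f y - ip y z)).
  by rewrite preip_Bl; lmod_ring.
apply: le_trans (nrmB _ _) _; have := nrmB (f x - ip x z) (f y - ip y z).
have := h x; have := h y; have := h (x - y); rewrite !mulrDr; lra.
Qed.

(** The form at [hat x] and [g] must be [g x]; this estimate pins down its extension to all [f]
    without choosing an approximating sequence. *)
Definition cform_spec f g (a : A) : Prop := forall x, nrm (a - g x) <= nrm (f - hat x) * nrm g.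

Lemma cform_ex f g : exists a, cform_spec f g a.
Proof.
have /choice[u Hu] := fun k : nat => hat_dense f (invS_gt0 k).
have gg x y : nrm (g x - g y) <= (nrm (f - hat x) + nrm (f - hat y)) * nrm g.
  rewrite -cB; apply: le_trans (cbound _ _) _; rewrite mulrC ler_wpM2r ?nrm_ge0 //.
  by rewrite -hat_nrm -hatB; apply: le_trans (nrm_tri f _ _) _; rewrite nrmC.
have g1 : 0 < 2 * (nrm g + 1) by rewrite mulr_gt0 // ltr_wpDl ?nrm_ge0.
have [|a Ha] := @cauchy_seqP R A (fun k => g (u k)).
  move=> e e0; have [N HN] := inv_small (divr_gt0 e0 g1).
  exists N => k l /HN h1 /HN h2; apply: le_trans (gg _ _) _.
  apply: le_trans (_ : e / (2 * (nrm g + 1)) * (2 * (nrm g + 1)) <= _); last by rewrite divfK ?gt_eqF.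
  have h3 := le_trans (Hu k) h1; have h4 := le_trans (Hu l) h2.
  have -> : e / (2 * (nrm g + 1)) * (2 * (nrm g + 1)) =
    (e / (2 * (nrm g + 1)) + e / (2 * (nrm g + 1))) * (nrm g + 1) by ring.
  by apply: ler_pM; rewrite ?addr_ge0 ?nrm_ge0 ?lerDl // lerD.
exists a => x; apply: (le_of_eps (K := 1 + nrm g)) => d d0 d1.
have /cvg_seqP/(_ _ d0)[N1 h1] := Ha; have [N2 h2] := inv_small d0.
have {}h1 := h1 _ (leq_maxl N1 N2); have {}h2 := h2 _ (leq_maxr N1 N2).
apply: le_trans (nrm_tri (g (u (maxn N1 N2))) _ _) _; rewrite nrmC.
have := gg (u (maxn N1 N2)) x; rewrite mulrDl.
have := ler_wpM2r (nrm_ge0 g) (le_trans (Hu _) h2).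
by rewrite mulrDr mulr1; lra.
Qed.

Definition cform f g : A := xget 0 [set a | cform_spec f g a].
Lemma cformP f g : cform_spec f g (cform f g).
Proof. by rewrite /cform; case: xgetP => [a _ //|]; have [a Ea] := cform_ex f g => /(_ a). Qed.

Lemma cform_hat x g : cform (hat x) g = g x.
Proof.
apply: (eq_of_eps (K := 0)) => d _ _; apply: le_trans (cformP _ _ _) _.
by rewrite subrr nrm0 mul0r mulr0.
Qed.

Lemma cform_approx f g x y :
  nrm (cform f g - ip x y) <= nrm (f - hat x) * nrm g + en x * nrm (g - hat y).
Proof.
apply: le_trans (nrm_tri (g x) _ _) _; apply: lerD; first exact: cformP.
by have := cbound (g - hat y) x; rewrite /= scaleN1r mulrC.
Qed.

Lemma cform_Dr f g h : cform f (g + h) = cform f g + cform f h.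
Proof.
apply: (eq_of_eps (K := nrm (g + h) + nrm g + nrm h)) => d d0 _.
have [x Hx] := hat_dense f d0.
have h1 k : nrm (cform f k - k x) <= d * nrm k.
  by apply: le_trans (cformP _ _ _) _; rewrite ler_wpM2r ?nrm_ge0.
have -> : cform f (g + h) - (cform f g + cform f h) =
  (cform f (g + h) - (g + h) x) - ((cform f g - g x) + (cform f h - h x)).
  by rewrite /=; lmod_ring.
apply: le_trans (nrmB _ _) _; have := nrmD (cform f g - g x) (cform f h - h x).
have := h1 g; have := h1 h; have := h1 (g + h); rewrite !mulrDr; lra.
Qed.
Lemma cform_Zr f (k : C) g : cform f (k *: g) = k *: cform f g.
Proof.
apply: (eq_of_eps (K := nrm (k *: g) + cn k * nrm g)) => d d0 _.
have [x Hx] := hat_dense f d0.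
have h1 h : nrm (cform f h - h x) <= d * nrm h.
  by apply: le_trans (cformP _ _ _) _; rewrite ler_wpM2r ?nrm_ge0.
have -> : cform f (k *: g) - k *: cform f g =
  (cform f (k *: g) - (k *: g) x) - k *: (cform f g - g x).
  by rewrite /=; lmod_ring.
apply: le_trans (nrmB _ _) _; rewrite mulrDr nrmZ mulrCA; apply: lerD; first exact: h1.
by apply: ler_wpM2l => //; exact: cn_ge0.
Qed.

Lemma en_near f x (d : R) : nrm (f - hat x) <= d -> en x <= nrm f + d.
Proof.
by move=> h; rewrite -hat_nrm; apply: le_trans (nrm_le_sub _ f) _; rewrite nrmC lerD2l.
Qed.

Lemma cform_star f g : star (cform f g) = cform g f.
Proof.
apply: (eq_of_eps (K := 2 * (nrm f + nrm g + 1))) => d d0 d1.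
have [x Hx] := hat_dense f d0; have [y Hy] := hat_dense g d0.
apply: le_trans (nrm_tri (ip y x) _ _) _.
rewrite -{1}(ip_star x y) -starB nrm_star [X in _ + X]nrmC.
have h1 := cform_approx f g x y; have h2 := cform_approx g f y x.
have e1 := en_near Hx; have e2 := en_near Hy.
have f1 := ler_wpM2r (nrm_ge0 g) Hx; have f2 := ler_wpM2r (nrm_ge0 f) Hy.
have f3 := ler_pM (en_ge0 x) (nrm_ge0 (g - hat y)) e1 Hy.
have f4 := ler_pM (en_ge0 y) (nrm_ge0 (f - hat x)) e2 Hx.
have f5 : d * d <= d by rewrite ger_pMr.
have E1 : (nrm f + d) * d = d * nrm f + d * d by ring.
have E2 : (nrm g + d) * d = d * nrm g + d * d by ring.
have -> : d * (2 * (nrm f + nrm g + 1)) = 2 * (d * nrm f) + 2 * (d * nrm g) + 2 * d by ring.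
by move: f3 f4; rewrite E1 E2 => f3 f4; lra.
Qed.

Lemma cform_nrm f : nrm (cform f f) = nrm f ^+ 2.
Proof.
have H (d : R) : 0 < d -> d <= 1 -> `|nrm (cform f f) - nrm f ^+ 2| <= d * (4 * nrm f + 4).
  move=> d0 d1; have [x Hx] := hat_dense f d0.
  have h1 := cform_approx f f x x; have e1 := en_near Hx.
  have e2 : nrm f <= en x + d by rewrite -hat_nrm; apply: le_trans (nrm_le_sub _ (hat x)) _; rewrite lerD2l.
  have E : nrm (ip x x) = en x ^+ 2 by rewrite en_sqr.
  have h2 := nrm_le_sub (cform f f) (ip x x); have h3 := nrm_le_sub (ip x x) (cform f f).
  rewrite nrmC in h3; rewrite E in h2 h3.
  have f1 := ler_wpM2r (nrm_ge0 f) Hx; have f2 := ler_wpM2l (en_ge0 x) Hx.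
  have f3 := ler_wpM2r (ltW d0) e1.
  have f4 : d * d <= d by rewrite ger_pMr.
  have n0 := nrm_ge0 f; have n1 := en_ge0 x.
  have s1 := ler_pM n1 n1 e1 e1; have s2 := ler_pM n0 n0 e2 e2.
  have E1 : (nrm f + d) * d = d * nrm f + d * d by ring.
  have E2 : (nrm f + d) * (nrm f + d) = nrm f * nrm f + 2 * (d * nrm f) + d * d by ring.
  have E3 : (en x + d) * (en x + d) = en x * en x + 2 * (en x * d) + d * d by ring.
  have -> : d * (4 * nrm f + 4) = 4 * (d * nrm f) + 4 * d by ring.
  move: h2 h3 s1 s2 f3; rewrite !expr2 E1 E2 E3 => h2 h3 s1 s2 f3.
  by rewrite ler_norml; apply/andP; split; lra.
by apply/eqP; rewrite eq_le; apply/andP; split; apply: (le_of_eps (K := 4 * nrm f + 4)) => d d0 d1;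
  have := H d d0 d1; rewrite ler_norml => /andP[]; lra.
Qed.

Lemma cform_CS f g : nrm (cform f g) <= nrm f * nrm g.
Proof.
apply: (le_of_eps (K := 2 * nrm g)) => d d0 d1; have [x Hx] := hat_dense f d0.
apply: le_trans (nrm_le_sub _ (g x)) _.
have h1 := cformP f g x; have h2 := cbound g x; have h3 := ler_wpM2r (nrm_ge0 g) Hx.
have h4 := ler_wpM2l (nrm_ge0 g) (en_near Hx).
have E1 : nrm g * (nrm f + d) = nrm f * nrm g + d * nrm g by ring.
have -> : d * (2 * nrm g) = 2 * (d * nrm g) by ring.
by rewrite E1 in h4; lra.
Qed.

Definition cmod : hmod A := HMod cform_Dr cform_Zr cform_star cform_nrm cform_CS.

(** Adjoints replace a density argument: values of [U] at any [f] are read off from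
    [star U (hat z)], and these from the [U (hat x)]. *)
Lemma adj_hat_eq (S T : adj cmod) : (forall x, S (hat x) = T (hat x)) -> S = T.
Proof.
move=> ST; have ev (U : adj cmod) f z : U f z = star (cform f (star U (hat z))).
  have E : cform (U f) (hat z) = cform f (star U (hat z)) := adj_starP U f (hat z).
  by rewrite -E cform_star cform_hat.
have ST' z : star S (hat z) = star T (hat z).
  by apply: wtype_eq => x; rewrite !ev !starK ST.
by apply: wtype_eq => f; apply: wtype_eq => z; rewrite !ev ST'.
Qed.

Lemma cset_ext (S S' : V -> V) (M : R) f : 0 <= M ->
  (forall x y, ip y (S x) = ip (S' y) x) -> (forall x, en (S' x) <= M * en x) ->
  cset (fun y => f (S' y)).
Proof.
move=> M0 SS' S'M e e0; have M1 : 0 < M + 1 by rewrite ltr_wpDl.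
have [x Hx] := hat_dense f (divr_gt0 e0 M1); exists (S x) => y; rewrite SS'.
have := cbound (f - hat x) (S' y); rewrite /= scaleN1r => /le_trans; apply.
apply: le_trans (ler_pM (nrm_ge0 _) (en_ge0 _) Hx (S'M y)) _.
rewrite mulrA ler_wpM2r // -mulrA ger_pMr // ler_pdivrMl // mulr1 lerDl //.
Qed.

(** Elements of the completion are functions on [V], so the extension of [S] is composition with its
    adjoint [S'], and no limit has to be taken. *)
Lemma cmod_extend (S S' : V -> V) (M : R) : 0 <= M ->
  (forall x y, ip y (S x) = ip (S' y) x) ->
  (forall x, en (S x) <= M * en x) -> (forall x, en (S' x) <= M * en x) ->
  exists T : adj cmod, (forall x, T (hat x) = hat (S x)) /\ nrm T <= M.
Proof.
move=> M0 SS' SM S'M.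
have S'S x y : ip y (S' x) = ip (S y) x by rewrite -ip_star -SS' ip_star.
pose T f : E := @Wtype R cspace _ (cset_ext f M0 SS' S'M).
pose T' f : E := @Wtype R cspace _ (cset_ext f M0 S'S SM).
have Th x : T (hat x) = hat (S x) by apply: wtype_eq => y /=; rewrite SS'.
have T'h x : T' (hat x) = hat (S' x) by apply: wtype_eq => y /=; rewrite S'S.
have TB f g : T (f - g) = T f - T g by apply: wtype_eq.
have T'B f g : T' (f - g) = T' f - T' g by apply: wtype_eq.
have TM f : nrm (T f) <= M * nrm f.
  apply: wnrm_le => [|y /=]; first by rewrite mulr_ge0 ?nrm_ge0.
  have := ler_wpM2l (nrm_ge0 f) (S'M y); rewrite mulrCA mulrA; apply: le_trans.
  exact: cbound.
have T'M f : nrm (T' f) <= M * nrm f.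
  apply: wnrm_le => [|y /=]; first by rewrite mulr_ge0 ?nrm_ge0.
  have := ler_wpM2l (nrm_ge0 f) (SM y); rewrite mulrCA mulrA; apply: le_trans.
  exact: cbound.
have adjT : adjoint (H := cmod) T T'.
  move=> f g; apply: (eq_of_eps (K := 2 * M * (nrm f + nrm g + 1))) => d d0 d1.
  have [x Hx] := hat_dense f d0; have [y Hy] := hat_dense g d0.
  apply: le_trans (nrm_tri (ip (S x) y) _ _) _; rewrite [X in _ + X]nrmC -{2}S'S.
  have h1 := cform_approx (T f) g (S x) y; have h2 := cform_approx f (T' g) x (S' y).
  have a1 : nrm (T f - hat (S x)) <= M * d.
    by rewrite -Th -TB; apply: le_trans (TM _) _; rewrite ler_wpM2l.
  have a2 : nrm (T' g - hat (S' y)) <= M * d.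
    by rewrite -T'h -T'B; apply: le_trans (T'M _) _; rewrite ler_wpM2l.
  have e1 := en_near Hx; have e2 := SM x; have e3 := ler_wpM2l M0 e1.
  have f1 := ler_wpM2r (nrm_ge0 g) a1.
  have f2 := ler_pM (en_ge0 _) (nrm_ge0 _) (le_trans e2 e3) Hy.
  have f3 := ler_pM (nrm_ge0 _) (nrm_ge0 _) Hx (T'M g).
  have f4 := ler_pM (en_ge0 _) (nrm_ge0 _) e1 a2.
  have E1 : M * (nrm f + d) * d = M * d * nrm f + M * d * d by ring.
  have E2 : (nrm f + d) * (M * d) = M * d * nrm f + M * d * d by ring.
  have E3 : d * (M * nrm g) = M * d * nrm g by ring.
  have f5 : M * d * d <= M * d by rewrite ler_piMr ?mulr_ge0 ?(ltW d0).
  have -> : d * (2 * M * (nrm f + nrm g + 1)) = 2 * (M * d * nrm f) + 2 * (M * d * nrm g) + 2 * (M * d) by ring.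
  by move: f2 f3 f4; rewrite E1 E2 E3 => f2 f3 f4; rewrite /hform /= in h1 h2 *; lra.
have aT : adjointable (H := cmod) T by split; [exists M|exists T'].
exists (@Wtype R (adjW cmod) _ aT); split=> //.
by apply: wnrm_le.
Qed.

End Completion.

(** * A representation of the crossed product *)

Section Representation.
Context {R : realType} {G : topGroupType} {A : cstarAlgType R}.
Variable alpha : cstar_action G A.
Hypotheses (compact_G : compact [set: G]).
Local Notation C := (Cplx R).
Variable mu : probability (borel G) R.
Hypothesis haar_mu : haar mu.
Local Notation T := (intop alpha mu).
Local Notation ip := (ip alpha mu).
Local Notation en := (en alpha mu).
Implicit Types (f h : G -> A).

Definition emod : hmod A := cmod (ipDr alpha compact_G mu) (ipZr alpha compact_G mu)
  (ip_star alpha compact_G mu) (en_ge0 alpha mu) (en_sqr alpha mu) (ip_CS alpha compact_G haar_mu).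
Definition emb (x : A) : emod := hat (ipDr alpha compact_G mu) (ipZr alpha compact_G mu)
  (en_ge0 alpha mu) (ip_CS alpha compact_G haar_mu) x.

Lemma emb_nrm x : nrm (emb x) = en x.
Proof. by apply: hat_nrm; exact: en_sqr. Qed.
Lemma embD x y : emb (x + y) = emb x + emb y. Proof. exact: hatD. Qed.
Lemma embZ (k : C) x : emb (k *: x) = k *: emb x. Proof. exact: hatZ. Qed.
Lemma emb_form x y : hform (emb x) (emb y) = ip x y.
Proof. exact: (cform_hat (ip_star alpha compact_G mu) (en_sqr alpha mu) x (emb y)). Qed.
Lemma adj_emb_eq (S U : adj emod) : (forall x, S (emb x) = U (emb x)) -> S = U.
Proof. exact: adj_hat_eq. Qed.
Lemma emb_eq (g h : emod) : (forall z, hform (emb z) g = hform (emb z) h) -> g = h.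
Proof.
move=> E; have F (k : emod) z : hform (emb z) k = k z.
  exact: (cform_hat (ip_star alpha compact_G mu) (en_sqr alpha mu) z).
by apply: wtype_eq => z; rewrite -!F E.
Qed.

Lemma irep_ex f : continuous f -> exists2 U : adj emod,
  (forall x, U (emb x) = emb (T f x)) & nrm U <= L1norm mu f.
Proof.
move=> cf; have M0 : 0 <= L1norm mu f by apply: Rintegral_ge0 => s _; exact: nrm_ge0.
have adjf x y := intop_adjoint alpha compact_G haar_mu x y cf.
have [||x|x|U [UE UM]] := @cmod_extend _ _ _ _ (ipDr alpha compact_G mu) (ipZr alpha compact_G mu)
  (ip_star alpha compact_G mu) _ (en_ge0 alpha mu) (en_sqr alpha mu) (ip_CS alpha compact_G haar_mu)
  (T f) (T (conv_star alpha f)) (L1norm mu f).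
- exact: M0.
- exact: adjf.
- exact: intop_en.
(* The bound for the adjoint is derived from that for [T f], which avoids comparing [L1norm] of [f]
   and of [conv_star alpha f]. *)
- have [->|n0] := eqVneq (en (T (conv_star alpha f) x)) 0; first by rewrite mulr_ge0 ?en_ge0.
  have np : 0 < en (T (conv_star alpha f) x) by rewrite lt_neqAle eq_sym n0 en_ge0.
  rewrite -(ler_pM2r np) -expr2 en_sqr -adjf mulrAC.
  have le := intop_en alpha compact_G haar_mu (T (conv_star alpha f) x) cf.
  apply: le_trans (ip_CS alpha compact_G haar_mu _ _) _; rewrite mulrC.
  by rewrite ler_wpM2r ?en_ge0.
by exists U.
Qed.

Definition irep f : adj emod := xget 0 [set U : adj emod | forall x, U (emb x) = emb (T f x)].

Lemma irepP f : continuous f -> forall x, irep f (emb x) = emb (T f x).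
Proof. by move=> cf; rewrite /irep; case: xgetP => [U _ //|]; have [U UE _] := irep_ex cf => /(_ U). Qed.

Lemma irep_hom : L1_hom alpha mu irep.
Proof.
split=> [f h cf ch|z f cf|f h cf ch|f cf|f cf].
- apply: adj_emb_eq => x /=; rewrite irepP; last exact: continuousD_A.
  by rewrite /= !irepP // intopDl // embD.
- have [cz _] := integralZ compact_G mu z cf.
  by apply: adj_emb_eq => x /=; rewrite !irepP // intopZl // embZ.
- apply: adj_emb_eq => x /=; rewrite irepP; last exact: (conv_cont compact_G).
  by rewrite !irepP // intop_conv.
- have cs := conv_star_cont (alpha := alpha) compact_G mu cf.
  apply: adj_emb_eq => x; rewrite irepP //; apply: emb_eq => z.
  have := adj_starP (irep f) (emb z) (emb x); rewrite irepP // => <-.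
  by rewrite !emb_form (intop_adjoint alpha compact_G haar_mu x z cs) conv_starK.
- have [U UE Ule] := irep_ex cf.
  have -> : irep f = U by apply: adj_emb_eq => x; rewrite irepP // UE.
  by rewrite nrmE rc_le.
Qed.

(** The constant [c] maps [emb (u N)] to [emb (c ** u N)], and [en] agrees with [nrm] on fixed
    points; [u N] takes the place of a unit. *)
Lemma irep_cst c (u : nat -> A) : fixed_approx_unit alpha u -> fixed_points alpha c ->
  nrm c <= nrm (irep (fun=> c)).
Proof.
move=> [fu u1 _ uu] fc; apply/ler_addgt0Pr => e e0.
have [N /(_ N (leqnn _)) HN] := iffLR (cvg_seqP _ _) (uu c) _ e0.
apply: le_trans (nrm_le_sub c (c ** u N)) _; rewrite nrmC; apply: lerD => //.
have fcu : fixed_points alpha (c ** u N) by move=> g; rewrite actMul fc fu.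
have fs : fixed_points alpha (star (c ** u N) ** (c ** u N)) by move=> g; rewrite actMul actS fcu.
have -> : nrm (c ** u N) = en (c ** u N).
  apply/eqP; rewrite -(@eqrXn2 R 2) ?nrm_ge0 ?en_ge0 // en_sqr /ip.
  by rewrite (cexp_id compact_G mu fs) nrm_sqr.
rewrite -emb_nrm -{1}(cexp_id compact_G mu (fu N)) -intop_cst // -irepP; last exact: continuous_cst_A.
apply: le_trans (wnrm_bound (irep (fun=> c)) (emb (u N))) _.
have e1 : nrm (emb (u N)) <= 1 by rewrite emb_nrm; exact: le_trans (en_le _ _ _ _) (u1 N).
by have := ler_wpM2l (nrm_ge0 (irep (fun=> c))) e1; rewrite mulr1.
Qed.
End Representation.

(** * Ideals of the crossed product *)

Section CrossedSimple.
Context {R : realType} {G : topGroupType} {A : cstarAlgType R}.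
Variable alpha : cstar_action G A.
Hypotheses (hausdorff_G : hausdorff_space G) (compact_G : compact [set: G]).
Hypotheses (suA : sigma_unital A) (scG : @second_countable G)
  (rok : rokhlin_property alpha).
Local Notation C := (Cplx R).
Variables (mu : probability (borel G) R) (B : cstarAlgType R) (j : (G -> A) -> B).
Hypotheses (haar_mu : haar mu) (hom_j : L1_hom alpha mu j)
  (dense_j : closure (j @` [set f | continuous f]) = [set: B])
  (univ_j : forall (B' : cstarAlgType R) (psi : (G -> A) -> B'), L1_hom alpha mu psi ->
     forall f, continuous f -> `|psi f| <= `|j f|).
Local Notation T := (intop alpha mu).
Local Notation E := (cexp alpha mu).
Local Notation fix_ := (fixed_points alpha).
Implicit Types (f h : G -> A) (a b c d : A) (x y z : B).

(** Acts through [intop] as the rank-one operator [x |-> a ** E (b ** x)], see [intop_kel]. *)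
Definition kel a b : G -> A := fun s => a ** alpha s b.
Local Notation cst c := ((fun=> c) : G -> A).

Lemma cst_cont c : continuous (cst c). Proof. exact: continuous_cst_A. Qed.
Lemma kel_cont a b : continuous (kel a b).
Proof. by apply: continuous_mul; [exact: continuous_cst_A|exact: act_cont]. Qed.
Local Hint Resolve kel_cont cst_cont : core.

Lemma kspan_cont F : kspan alpha F -> continuous F.
Proof.
elim=> [|a b|F1 F2 _ c1 _ c2]; [exact: continuous_cst_A|exact: kel_cont|exact: continuousD_A].
Qed.

Lemma kel_fixed a b : fix_ b -> kel a b = cst (a ** b).
Proof. by move=> fb; apply/funext => s; rewrite /kel fb. Qed.

Lemma conv_kel h c d : continuous h -> conv alpha mu h (kel c d) = kel (T h c) d.
Proof.
move=> ch; apply/funext => s; rewrite /conv /kel /intop.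
rewrite -(integral_mulr compact_G mu (alpha s d) (intop_cont (x := c) ch)); apply: integral_ext => r.
by rewrite actMul -actM mulgA mulgV mul1g cmulA.
Qed.

Lemma intop_kel a b c : T (kel a b) c = a ** E (b ** c).
Proof.
rewrite /intop /cexp -(integral_mull compact_G mu a (@act_cont _ _ _ alpha (b ** c))).
by apply: integral_ext => r; rewrite /kel actMul cmulA.
Qed.

Lemma j_kel h c d : continuous h -> j h ** j (kel c d) = j (kel (T h c) d).
Proof. by move=> ch; rewrite -(L1_homM hom_j) // conv_kel. Qed.

Lemma j_kel_kel a b c d : j (kel a b) ** j (kel c d) = j (kel (a ** E (b ** c)) d).
Proof. by rewrite j_kel // intop_kel. Qed.

Lemma j_cst_kel a c d : j (cst a) ** j (kel c d) = j (kel (a ** E c) d).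
Proof. by rewrite j_kel // intop_cst. Qed.

Lemma j_cst_cst a c : fix_ c -> j (cst a) ** j (cst c) = j (cst (a ** c)).
Proof.
move=> fc; rewrite -(L1_homM hom_j) //; congr j; apply/funext => s.
rewrite /conv -[RHS](integral_cst compact_G mu); apply: integral_ext => r; by rewrite fc.
Qed.

Lemma jB f h : continuous f -> continuous h ->
  continuous (fun s => f s - h s) /\ j f - j h = j (fun s => f s - h s).
Proof.
move=> cf ch; have [cN _] := integralZ compact_G mu (-1) ch.
have E1 : (fun s => f s - h s) = (fun s => f s + (-1) *: h s).
  by apply/funext => s; rewrite scaleN1r.
rewrite E1; split; first exact: continuousD_A.
by rewrite (L1_homD hom_j) // (L1_homZ hom_j) // scaleN1r.
Qed.

Lemma j0 : j (cst 0) = 0.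
Proof.
rewrite -[RHS](scale0r (j (cst 0))) -(L1_homZ hom_j 0 (@cst_cont 0)).
by congr j; apply/funext => s; rewrite scale0r.
Qed.

Lemma fixed_closed : closed fix_.
Proof.
apply/closedP => a H g; apply: (eq_of_eps (K := 2)) => d d0 _.
have [c fc ca] := H _ d0.
apply: le_trans (nrm_tri c _ _) _; rewrite -{1}(fc g) -actB act_nrm !(nrmC a).
by rewrite mulrDr mulr1 lerD.
Qed.

Lemma j_near f h M : continuous f -> continuous h -> (forall s, nrm (f s - h s) <= M) ->
  nrm (j f - j h) <= M.
Proof.
move=> cf ch fh; have [cd ->] := jB cf ch.
have := L1_hom_le hom_j cd; rewrite nrmE rc_le => /le_trans; apply.
exact: (L1norm_le compact_G mu cd).
Qed.

Lemma j_cst_near a c : nrm (j (cst a) - j (cst c)) <= nrm (a - c).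
Proof. exact: j_near. Qed.

Lemma j_kel_near a a' b b' :
  nrm (j (kel a b) - j (kel a' b')) <= nrm (a - a') * nrm b + nrm a' * nrm (b - b').
Proof.
apply: j_near => // s.
have -> : kel a b s - kel a' b' s = (a - a') ** alpha s b + a' ** alpha s (b - b').
  by rewrite /kel actB !calgE; lmod_ring.
apply: le_trans (nrmD _ _) _.
by apply: lerD; (apply: le_trans (nrmM _ _) _; rewrite act_nrm).
Qed.

(** Saturation gives density in the sup norm, which [j_near] turns into density in [B]. *)
Lemma kel_total (V : set B) : closed V -> V 0 -> (forall x y, V x -> V y -> V (x + y)) ->
  (forall a b, V (j (kel a b))) -> forall x, V x.
Proof.
move=> cV V0 VD Vk.
have Vs F : kspan alpha F -> V (j F).
  elim=> [|a b|F1 F2 k1 V1 k2 V2]; [by rewrite j0|exact: Vk|].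
  by rewrite (L1_homD hom_j); [exact: VD|exact: kspan_cont|exact: kspan_cont].
have Vj f : continuous f -> V (j f).
  move=> cf; apply/(iffLR (closedP _) cV) => e e0.
  have [F kF FE] := saturation hausdorff_G compact_G suA scG rok cf e0.
  by exists (j F); [exact: Vs|apply: j_near => //; exact: kspan_cont].
move=> x; apply/(iffLR (closedP _) cV) => e e0.
have : closure (j @` [set f | continuous f]) x by rewrite dense_j.
by move=> /closureP/(_ e e0)[_ [f cf <-] fx]; exists (j f) => //; exact: Vj.
Qed.

Variable u : nat -> A.
Hypothesis fau : fixed_approx_unit alpha u.

Lemma j_isometry c : fix_ c -> nrm c <= nrm (j (cst c)).
Proof.
move=> fc; apply: le_trans (irep_cst compact_G haar_mu fau fc) _.
by have := univ_j (irep_hom alpha compact_G haar_mu) (@cst_cont c); rewrite !nrmE rc_le.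
Qed.

(** By [j_isometry], constants whose images converge form a Cauchy sequence in [A]. *)
Lemma j_cst_closed z : (forall e : R, 0 < e -> exists2 c, fix_ c & nrm (z - j (cst c)) <= e) ->
  exists2 c, fix_ c & z = j (cst c).
Proof.
move=> H; have /choice[c Hc] : forall k : nat, exists c, fix_ c /\ nrm (z - j (cst c)) <= k.+1%:R^-1.
  by move=> k; have [c ? ?] := H _ (invS_gt0 k); exists c.
have [|a Ha] := @cauchy_seqP R A c.
  move=> e e0; have e2 : 0 < e / 2 by rewrite divr_gt0.
  have [N HN] := inv_small e2; exists N => m n /HN h1 /HN h2.
  have fm : fix_ (c m - c n) by move=> g; rewrite actB (Hc m).1 (Hc n).1.
  apply: le_trans (j_isometry fm) _; rewrite -(jB (@cst_cont (c m)) (@cst_cont (c n))).2.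
  apply: le_trans (nrm_tri z _ _) _; rewrite nrmC [e]splitr; apply: lerD.
    exact: le_trans (Hc m).2 h1.
  exact: le_trans (Hc n).2 h2.
exists a.
  apply/(iffLR (closedP _) fixed_closed) => e e0.
  have [N /(_ N (leqnn _)) HN] := iffLR (cvg_seqP _ _) Ha _ e0.
  by exists (c N) => //; exact: (Hc N).1.
apply: (eq_of_eps (K := 2)) => d d0 _.
have [N1 h1] := iffLR (cvg_seqP _ _) Ha _ d0; have [N2 h2] := inv_small d0.
have {}h1 := h1 _ (leq_maxl N1 N2); have {}h2 := h2 _ (leq_maxr N1 N2).
apply: le_trans (nrm_tri (j (cst (c (maxn N1 N2)))) _ _) _; rewrite mulrDr mulr1; apply: lerD.
  exact: le_trans (Hc _).2 h2.
exact: le_trans (j_cst_near _ _) h1.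
Qed.

(** Two ways of factoring: [kel (a ** u n) b] is [cst a] times [kel (u n) b], and
    [kel (a ** (u n ** u n)) b] is [kel a (u n)] times [kel (u n) b]. *)
Lemma kel_approx a b : (fun n => j (kel (a ** u n) b)) @ \oo --> j (kel a b) /\
  (fun n => j (kel (a ** (u n ** u n)) b)) @ \oo --> j (kel a b).
Proof.
have [fu u1 _ ur] := fau.
have H v : v @ \oo --> a -> (fun n => j (kel (v n) b)) @ \oo --> j (kel a b).
  move=> /cvg_seqP va; apply/cvg_seqP => e e0.
  have b1 : 0 < nrm b + 1 by rewrite ltr_wpDl ?nrm_ge0.
  have [N HN] := va _ (divr_gt0 e0 b1); exists N => n /HN h.
  apply: le_trans (j_kel_near _ _ _ _) _; rewrite subrr nrm0 mulr0 addr0.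
  apply: le_trans (ler_wpM2r (nrm_ge0 b) h) _.
  by rewrite -mulrA ger_pMr // ler_pdivrMl // mulr1 lerDl.
split; apply: H; first exact: ur.
apply/cvg_seqP => e e0; have [N HN] := iffLR (cvg_seqP _ _) (ur a) _ (divr_gt0 e0 (ltr0n _ 2)).
exists N => n /HN h; rewrite cmulA; apply: le_trans (nrm_tri (a ** u n) _ _) _.
rewrite [e]splitr; apply: lerD => //; rewrite -cmulBl; apply: le_trans (nrmM _ _) _.
by apply: le_trans (ler_piMr (nrm_ge0 _) (u1 n)) h.
Qed.

(** For [x = j h] the product is the constant [u n ** E (b ** T h c) ** u n]; [j_cst_closed] extends
    this to limits of such [x]. *)
Lemma corner n b c x : exists2 a, fix_ a &
  j (kel (u n) b) ** x ** j (kel c (u n)) = j (cst a).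
Proof.
have [fu _ _ _] := fau; apply: j_cst_closed => e e0.
pose y := j (kel (u n) b); pose z := j (kel c (u n)).
pose K := nrm y * nrm z + 1; have K0 : 0 < K by rewrite ltr_wpDl ?mulr_ge0 ?nrm_ge0.
have : closure (j @` [set f | continuous f]) x by rewrite dense_j.
move=> /closureP/(_ _ (divr_gt0 e0 K0))[_ [h ch <-] hx].
exists (u n ** E (b ** T h c) ** u n).
  by move=> g; rewrite !actMul fu cexp_fixed.
have -> : j (cst (u n ** E (b ** T h c) ** u n)) = y ** j h ** z.
  by rewrite /y /z -(cmulA (j (kel (u n) b))) j_kel // j_kel_kel kel_fixed.
rewrite -/y -/z -cmulBl -cmulBr nrmC in hx *.
apply: le_trans (nrmM _ _) _; apply: le_trans (ler_wpM2r (nrm_ge0 z) (nrmM _ _)) _.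
have le := ler_wpM2l (mulr_ge0 (nrm_ge0 y) (nrm_ge0 z)) hx.
rewrite mulrAC; apply: le_trans le _.
by rewrite mulrCA ger_pMr // ler_pdivrMr // mul1r /K lerDl.
Qed.

Lemma crossed_simple : simple fix_ -> simple [set: B].
Proof.
move=> [[c0 fc0 c00] sfix]; have [fu u1 ul ur] := fau; split.
  exists (j (cst c0)) => //; apply/eqP => j0.
  have := j_isometry fc0; rewrite j0 nrm0 => /nrm_le0 c0E.
  by rewrite c0E eqxx in c00.
move=> J idJ; have cJ := ideal_closed idJ.
have MlJ x y : J y -> J (x ** y) by exact: (idealMl idJ).
have MrJ x y : J x -> J (x ** y) by move=> Jx; exact: (idealMr idJ).
pose J' := [set c | fix_ c /\ J (j (cst c))].
have idJ' : closed_ideal fix_ J'.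
  split.
  - by move=> c [].
  - apply/closedP => c Hc; split.
      apply/(iffLR (closedP _) fixed_closed) => e e0.
      by have [c' [fc' _] cc'] := Hc _ e0; exists c'.
    apply/(iffLR (closedP _) cJ) => e e0; have [c' [fc' Jc'] cc'] := Hc _ e0.
    by exists (j (cst c')) => //; exact: le_trans (j_cst_near _ _) cc'.
  - split; first by move=> g; exact: act_0.
    by rewrite j0; exact: (ideal0 idJ).
  - move=> x y [fx Jx] [fy Jy]; split; first by move=> g; rewrite actD fx fy.
    by rewrite (L1_homD hom_j (@cst_cont x) (@cst_cont y)); exact: (idealD idJ).
  - move=> z x [fx Jx]; split; first by move=> g; rewrite actZ fx.
    by rewrite (L1_homZ hom_j z (@cst_cont x)); exact: (idealZ idJ).
  - move=> x y fx [fy Jy]; split; first by move=> g; rewrite actMul fx fy.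
    by rewrite -j_cst_cst //; exact: MlJ.
  - move=> x y [fx Jx] fy; split; first by move=> g; rewrite actMul fx fy.
    by rewrite -j_cst_cst //; exact: MrJ.
have lim_J (v : nat -> B) x : (forall n, J (v n)) -> v @ \oo --> x -> J x.
  move=> Jv /cvg_seqP vx; apply/(iffLR (closedP _) cJ) => e e0.
  by have [N /(_ N (leqnn _)) HN] := vx _ e0; exists (v N).
have [J'0|J'1] := sfix J' idJ'; [left|right]; apply/seteqP; split=> x //=; last first.
- move=> _; apply: kel_total => // [||a b]; first exact: (ideal0 idJ).
    exact: (idealD idJ).
  (* Here [a] need not be fixed: [j (cst (a ** u n))] has the factor [j (cst (u n))], which is in
     [J]. *)
  have Ja : J (j (cst a)).
    apply: (lim_J (fun n => j (cst (a ** u n)))) => [n|].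
      rewrite -j_cst_cst //; apply: MlJ.
      by have [] : J' (u n) by rewrite J'1; exact: fu.
    apply/cvg_seqP => e e0; have [N HN] := iffLR (cvg_seqP _ _) (ur a) _ e0.
    by exists N => n /HN; apply: le_trans; exact: j_cst_near.
  apply: (lim_J _ _ _ (kel_approx a b).1) => n.
  have -> : a ** u n = a ** E (u n) by rewrite (cexp_id compact_G mu (fu n)).
  by rewrite -j_cst_kel; exact: MrJ.
- by move=> ->; exact: (ideal0 idJ).
move=> Jx; have corner0 n b c : j (kel (u n) b) ** x ** j (kel c (u n)) = 0.
  have [a fa Ea] := corner n b c x.
  have : J' a by split=> //; rewrite -Ea; apply: MrJ; exact: MlJ.
  by rewrite J'0 => /= a0; rewrite Ea a0 j0.
(* Factoring both sides through [u n] puts a vanishing corner in the middle. *)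
have kxk a b c d : j (kel a b) ** x ** j (kel c d) = 0.
  have l1 := cmul_cvg (cmul_cvg (kel_approx a b).2 (@seq_cvg_cst _ _ x)) (kel_approx c d).2.
  apply: lim_uniq l1 _; rewrite (_ : (fun n => _) = (fun=> 0)); first exact: seq_cvg_cst.
  apply/funext => n.
  have Eu : u n ** u n = E (u n ** u n).
    by rewrite (cexp_id compact_G mu) // => g; rewrite actMul fu.
  rewrite Eu -!j_kel_kel.
  have -> (p q r s : B) : p ** q ** x ** (r ** s) = p ** (q ** x ** r) ** s by rewrite !cmulA.
  by rewrite corner0 cmul0r cmul0l.
have closed0 (f : B -> B) M : 0 <= M -> {morph f : y z / y - z} -> (forall y, nrm (f y) <= M * nrm y) ->
    closed [set y | f y = 0].
  move=> M0 fB fM; apply/closedP => y Hy; apply: (eq_of_eps (K := M)) => d d0 _ /=.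
  have [z /= fz zy] := Hy _ d0; rewrite -fz -fB; apply: le_trans (fM _) _.
  by rewrite mulrC nrmC ler_wpM2r.
(* Totality of the [j (kel a b)] is used once for the right factor and once for the left. *)
have kxy a b y : j (kel a b) ** x ** y = 0.
  apply: (kel_total (V := [set y | j (kel a b) ** x ** y = 0])) => /= [||y1 y2 e1 e2|c d] //.
  - apply: (closed0 _ (nrm (j (kel a b) ** x))) => [|y1 y2|y1]; [exact: nrm_ge0|exact: cmulBr|exact: nrmM].
  - exact: cmul0r.
  - by rewrite cmulDr e1 e2 addr0.
have yxz y z : y ** x ** z = 0.
  apply: (kel_total (V := [set y | y ** x ** z = 0])) => /= [||y1 y2 e1 e2|c d] //.
  - apply: (closed0 (fun y => y ** x ** z) (nrm x * nrm z)) => [|y1 y2|y1].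
    + by rewrite mulr_ge0 ?nrm_ge0.
    + by rewrite !cmulBl.
    + rewrite -cmulA; apply: le_trans (nrmM _ _) _; rewrite mulrC ler_wpM2r ?nrm_ge0 //.
      exact: nrmM.
  - by rewrite !cmul0l.
  - by rewrite !cmulDl e1 e2 addr0.
(* With no unit of [B] at hand for [y] and [z], [x] is reached through the square of
   [star x ** x]. *)
apply: nrm0_eq; apply/eqP; rewrite -(sqrf_eq0 (nrm x)) -nrm_sqr.
have -> : star x ** x = 0; last by rewrite nrm0.
by apply: sa_eq0; [rewrite starM starK|rewrite cmulA yxz cmul0l].
Qed.

End CrossedSimple.

Theorem corollary2p14 (R : realType) (A : cstarAlgType R) (G : topGroupType)
  (alpha : cstar_action G A)
  (sigma_unital_A : sigma_unital A)
  (hausdorff_G : hausdorff_space G)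
  (compact_G : compact [set: G])
  (second_countable_G : @second_countable G)
  (rokhlin_alpha : rokhlin_property alpha)
  (simple_A : simple [set: A]) :
  simple (fixed_points alpha) /\
  (forall B : cstarAlgType R, is_crossed_product alpha B -> simple [set: B]).
Proof.
have sfix := fixed_points_simple hausdorff_G compact_G sigma_unital_A second_countable_G
  rokhlin_alpha simple_A.
split=> // B [mu [j [haar_mu hom_j dense_j univ_j]]].
have [u fau] := fixed_approx_unit_exists alpha compact_G sigma_unital_A.
exact: (crossed_simple hausdorff_G compact_G sigma_unital_A second_countable_G rokhlin_alpha
  haar_mu hom_j dense_j univ_j fau sfix).
Qed.
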